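(* Let $k$ be a field, $Q$ a finite connected acyclic quiver of non-Dynkin type, $\Lambda_Q$ its preprojective algebra over $k$, and $\mathcal{R}_{\Lambda_Q}$ the triangulated hull of $D^b(\mathrm{rep}^n\Lambda_Q)/[2]$. Let $\eta:K_0(\mathcal{R}_{\Lambda_Q})\to\mathbb{Z}Q_0$ be the isomorphism sending the class $\hat S_i$ of the simple module $S_i$ to $\alpha_i$. For $i\in Q_0$ let $\boldsymbol{T}_i:K_0(\mathcal{R}_{\Lambda_Q})\to K_0(\mathcal{R}_{\Lambda_Q})$ be the map induced by the spherical twist functor $\bar T_{2,S_i}:\mathcal{R}_{\Lambda_Q}\to\mathcal{R}_{\Lambda_Q}$, and let $s_i\in\mathrm{Aut}(\mathbb{Z}Q_0)$ be the simple reflection $s_i(\lambda)=\lambda-(\lambda,\alpha_i)_A\,\alpha_i$. Then for every $i\in Q_0$, $$s_i=\eta\,\boldsymbol{T}_i\,\eta^{-1}\quad\text{in }\mathrm{Aut}(\mathbb{Z}Q_0);$$ that is, $\eta\,\boldsymbol{T}_i=s_i\,\eta$ as maps $K_0(\mathcal{R}_{\Lambda_Q})\to\mathbb{Z}Q_0$.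
   Context: $\Lambda_Q$ is the quotient of the path algebra of the double quiver $\overline{Q}$ (add an opposite arrow $\bar h$ for each arrow $h$ of $Q$) by the preprojective relations $\sum_{h\in Q_1}(h\bar h-\bar h h)=0$. $\mathrm{rep}^n\Lambda_Q$ is the abelian category of finite-dimensional nilpotent $\Lambda_Q$-modules, with simple objects $S_i$, $i\in Q_0$. $A=kQ$ is the path algebra; $(\cdot,\cdot)_A$ is the symmetric Euler form on $\mathbb{Z}Q_0=K_0(\mathrm{mod}\,A)$ (with $\alpha_i=\hat S_i$ the standard basis, the simple roots): $(\hat M,\hat N)_A=\langle\hat M,\hat N\rangle_A+\langle\hat N,\hat M\rangle_A$, $\langle\hat M,\hat N\rangle_A=\sum_i(-1)^i\dim_k\mathrm{Hom}_{D^b(A)}(M,N[i])$. $\mathrm{Proj}\,\Lambda_Q$ is the category of finitely generated projective $\Lambda_Q$-modules. A 2-periodic complex is $P^\bullet:\ P_0\overset{d^0}{\underset{d^1}{\rightleftarrows}}P_1$ with $d^1d^0=0=d^0d^1$; indices in $\mathbb{Z}/2$; the shift $[1]$ exchanges the components and changes the sign of the differential. $K_2(\mathrm{Proj}\,\Lambda_Q)$ is the (triangulated) homotopy category of 2-periodic complexes of finitely generated projective $\Lambda_Q$-modules. For a bounded complex $P$ of finitely generated projectives, $\Delta(P)$ is $\bigoplus_iP_{2i}\rightleftarrows\bigoplus_iP_{2i+1}$; $p(X)$ denotes the projective resolution of $X\in D^b(\mathrm{rep}^n\Lambda_Q)$, a bounded complex of finitely generated projectives. The orbit category $D^b(\mathrm{rep}^n\Lambda_Q)/[2]$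 has the same objects as $D^b(\mathrm{rep}^n\Lambda_Q)$ and morphisms $\bigoplus_{i\in\mathbb{Z}}\mathrm{Hom}(X,Y[2i])$; $\Delta\circ p$ embeds it fully faithfully in $K_2(\mathrm{Proj}\,\Lambda_Q)$. Its triangulated hull $\mathcal{R}_{\Lambda_Q}$ (Keller's construction) is regarded as a Hom-finite full triangulated subcategory of $K_2(\mathrm{Proj}\,\Lambda_Q)$: the smallest one containing this orbit category and closed under direct summands. Objects of $D^b(\mathrm{rep}^n\Lambda_Q)$ are viewed in $\mathcal{R}_{\Lambda_Q}$ via $\Delta\circ p$. It is recorded beforehand that $K_0(\mathcal{R}_{\Lambda_Q})\cong\mathbb{Z}Q_0$ via $\eta$. Spherical twist: for $P^\bullet,M^\bullet\in K_2(\mathrm{Proj}\,\Lambda_Q)$, $B_2(P^\bullet,M^\bullet)$ is the 2-periodic complex of vector spaces with degree-$j$ part $\bigoplus_{a\in\mathbb{Z}/2}\mathrm{Hom}_{\Lambda_Q}(P_a,M_{a+j})$ and differential $f\mapsto d_Mf-(-1)^jfd_P$. For a 2-periodic complex $V^\bullet$ of finite-dimensional vector spaces, $V^\bullet\otimes P^\bullet$ is the $\mathbb{Z}/2$-graded tensor product over $k$ with $d(v\otimes x)=dv\otimes x+(-1)^{|v|}v\otimes dx$. With $P_{S}$ the minimal projective resolution of a simple module $S$, the functor $\bar T_{2,S}:K_2(\mathrm{Proj}\,\Lambda_Q)\to K_2(\mathrm{Proj}\,\Lambda_Q)$ is $$\bar T_{2,S}(M^\bullet)=\mathrm{Cone}\big(\mathrm{ev}:B_2(\Delta(P_S),M^\bullet)\otimes\Delta(P_S)\to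 M^\bullet\big),\quad \mathrm{ev}(\varphi\otimes x)=\varphi(x),$$ with $\bar T_{2,S}(f)=\begin{bmatrix}f&0\\0&f_*\otimes1\end{bmatrix}$, $f_*$ being composition with $f$. Its restriction to $\mathcal{R}_{\Lambda_Q}$, a triangle autoequivalence of $\mathcal{R}_{\Lambda_Q}$, is again denoted $\bar T_{2,S}$ and called the spherical twist functor. *)

(* Defs.v *)
From HB Require Import structures.
From mathcomp Require Import all_boot all_order all_algebra.
From mathcomp Require Import boolp functions.

Set Implicit Arguments.
Unset Strict Implicit.
Unset Printing Implicit Defensive.

Import GRing.Theory.
Local Open Scope ring_scope.
Local Open Scope quotient_scope.

(* A connected quiver has at least one vertex; kQ is then a nonzero ring. *)
Record quiver := Quiver {
  vert : finType;
  arr : finType;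
  src : arr -> vert;
  tgt : arr -> vert;
  vert_gt0 : (0 < #|vert|)%N }.

Section QuiverShape.
Variable Q : quiver.

Fixpoint is_path (i : vert Q) (s : seq (arr Q)) : bool :=
  if s is h :: s' then (src h == i) && is_path (tgt h) s' else true.

Definition endpoint (i : vert Q) (s : seq (arr Q)) : vert Q :=
  last i (map (@tgt Q) s).

Definition quiver_acyclic : Prop :=
  forall i s, is_path i s -> endpoint i s = i -> s = [::].

Definition edges (i j : vert Q) : {set arr Q} :=
  [set h | ((src h == i) && (tgt h == j)) || ((src h == j) && (tgt h == i))].

Definition quiver_connected : Prop :=
  forall i j, connect (fun a b => edges a b != set0) i j.

End QuiverShape.

Definition symrel (e : rel nat) : rel nat := fun a b => e a b || e b a.

(* The chain 0 - 1 - ... - (n-2) with the vertex n-1 joined to the vertex m. *)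
Definition branched (n m : nat) : rel nat :=
  symrel (fun a b => ((a.+1 == b) && (b.+1 < n)%N) || ((a == m) && (b.+1 == n))).

Inductive dynkin_diagram : nat -> rel nat -> Prop :=
| Dynkin_A n : (0 < n)%N -> dynkin_diagram n (symrel (fun a b => a.+1 == b))
| Dynkin_D n : (4 <= n)%N -> dynkin_diagram n (branched n (n - 3))
| Dynkin_E n : (6 <= n <= 8)%N -> dynkin_diagram n (branched n 2).

Definition dynkin_type (Q : quiver) : Prop :=
  exists n (e : rel nat) (f : vert Q -> 'I_n),
    [/\ dynkin_diagram n e, bijective f &
        forall i j, #|edges i j| = e (f i) (f j)].

Definition double_quiver (Q : quiver) : quiver :=
  @Quiver (vert Q) (arr Q + arr Q)%type
    (fun h => match h with inl a => src a | inr a => tgt a end)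
    (fun h => match h with inl a => tgt a | inr a => src a end)
    (vert_gt0 Q).

(* An element of kQ is a finitely supported function on the paths of Q; the path
   with source i and successive arrows s is (i, s).  As Q is finite, finite
   support amounts to a bound on the lengths of the paths in the support. *)
Section PathAlgebra.
Variables (k : fieldType) (Q : quiver).

Definition path_supported : {pred (vert Q * seq (arr Q) -> k)} :=
  fun f => `[< (forall i s, f (i, s) != 0 -> is_path i s) /\
               (exists N, forall i s, (N <= size s)%N -> f (i, s) = 0) >].

Lemma path_supportedP f : reflect
  ((forall i s, f (i, s) != 0 -> is_path i s) /\
   (exists N, forall i s, (N <= size s)%N -> f (i, s) = 0))
  (f \in path_supported).
Proof. exact: asboolP. Qed.

Lemma path_supported_zmod : zmod_closed path_supported.
Proof.
split=> [|f g /path_supportedP [f1 [N fN]] /path_supportedP [g1 [N' gN]]].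
  by apply/path_supportedP; split=> [i s|]; [rewrite eqxx|exists 0].
have fgE x : (f - g) x = f x - g x by [].
apply/path_supportedP; split=> [i s|].
  rewrite fgE; have [->|/f1//] := eqVneq (f (i, s)) 0.
  by rewrite sub0r oppr_eq0 => /g1.
exists (maxn N N') => i s; rewrite geq_max => /andP[h1 h2].
by rewrite fgE fN // gN // subr0.
Qed.

HB.instance Definition _ :=
  GRing.isZmodClosed.Build (vert Q * seq (arr Q) -> k)%type path_supported
    path_supported_zmod.

Record path_algebra := PathAlgebra {
  path_coef :> vert Q * seq (arr Q) -> k;
  path_coefP : path_coef \in path_supported }.

HB.instance Definition _ := [isSub for path_coef].
HB.instance Definition _ := [Choice of path_algebra by <:].
HB.instance Definition _ := [SubChoice_isSubZmodule of path_algebra by <:].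

Lemma path_algebraP (f g : path_algebra) :
  (forall i s, f (i, s) = g (i, s)) -> f = g.
Proof. by move=> fg; apply/val_inj/funext => -[i s]; exact: fg. Qed.

Lemma path_scale_subproof (a : k) (f : path_algebra) :
  (fun x => a * f x) \in path_supported.
Proof.
have /path_supportedP [f1 [N fN]] := path_coefP f.
apply/path_supportedP; split=> [i s|]; last first.
  by exists N => i s hs; rewrite fN ?mulr0.
by rewrite mulf_eq0 negb_or => /andP[_ /f1].
Qed.

Definition path_scale a f := PathAlgebra (path_scale_subproof a f).

Lemma path_scaleA a b f : path_scale a (path_scale b f) = path_scale (a * b) f.
Proof. by apply: path_algebraP => i s; rewrite /= mulrA. Qed.

Lemma path_scale1 : left_id 1 path_scale.
Proof. by move=> f; apply: path_algebraP => i s; rewrite /= mul1r. Qed.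

Lemma path_scaleDr : right_distributive path_scale +%R.
Proof. by move=> a f g; apply: path_algebraP => i s; rewrite /= mulrDr. Qed.

Lemma path_scaleDl f : {morph path_scale^~ f : a b / a + b}.
Proof. by move=> a b; apply: path_algebraP => i s; rewrite /= mulrDl. Qed.

HB.instance Definition _ := GRing.Zmodule_isLmodule.Build k path_algebra
  path_scaleA path_scale1 path_scaleDr path_scaleDl.

Lemma path_algebra_path (f : path_algebra) i s : ~~ is_path i s -> f (i, s) = 0.
Proof.
case/path_supportedP: (path_coefP f) => h _ np; apply/eqP.
by apply: contraNT np; apply: h.
Qed.

Lemma path_algebra_bound (f : path_algebra) :
  exists N, forall i s, (N <= size s)%N -> f (i, s) = 0.
Proof. by case/path_supportedP: (path_coefP f). Qed.

Lemma is_path_cat i s t :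
  is_path i (s ++ t) = @is_path Q i s && is_path (endpoint i s) t.
Proof. by elim: s i => [|h s IH] i //=; rewrite IH andbA. Qed.

Lemma endpoint_cat i s t : @endpoint Q i (s ++ t) = endpoint (endpoint i s) t.
Proof. by rewrite /endpoint map_cat last_cat. Qed.

(* Paths compose like maps: in f * g the path of g comes first, so that left
   modules are representations of Q. *)
Definition path_mul_fun (f g : vert Q * seq (arr Q) -> k) x : k :=
  \sum_(j < (size x.2).+1)
    f (endpoint x.1 (take j x.2), drop j x.2) * g (x.1, take j x.2).

Lemma path_mul_subproof (f g : path_algebra) :
  path_mul_fun f g \in path_supported.
Proof.
apply/path_supportedP; split=> [i s|].
  apply: contraNT => np; rewrite /path_mul_fun big1 //= => j _.
  have := np; rewrite -{1}(cat_take_drop j s) is_path_cat negb_and.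
  by case/orP=> h; rewrite ?(path_algebra_path g h) ?(path_algebra_path f h)
    ?mul0r ?mulr0.
have [N fN] := path_algebra_bound f; have [N' gN] := path_algebra_bound g.
exists (N + N')%N => i s hs; rewrite /path_mul_fun big1 //= => j _.
have [hj|hj] := leqP N' j; last first.
  rewrite fN ?mul0r // size_drop leq_subRL; last by rewrite -ltnS.
  by apply: leq_trans hs; rewrite addnC leq_add2l ltnW.
by rewrite gN ?mulr0 // size_takel // -ltnS.
Qed.

Definition path_mul (f g : path_algebra) := PathAlgebra (path_mul_subproof f g).

Definition path_delta_fun (i : vert Q) (s : seq (arr Q)) :
    vert Q * seq (arr Q) -> k :=
  fun x => ((x == (i, s)) && is_path i s)%:R.

Lemma path_delta_subproof i s : path_delta_fun i s \in path_supported.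
Proof.
apply/path_supportedP; split=> [j t|].
  rewrite /path_delta_fun; case: (eqVneq (j, t) (i, s)) => [[-> ->]|] /=.
    by case: is_path => //; rewrite eqxx.
  by rewrite eqxx.
exists (size s).+1 => j t; rewrite /path_delta_fun.
by case: (eqVneq (j, t) (i, s)) => [[_ ->]|//]; rewrite ltnn.
Qed.

Definition path_delta i s := PathAlgebra (path_delta_subproof i s).

Definition path_one_fun (x : vert Q * seq (arr Q)) : k := (x.2 == [::])%:R.

Lemma path_one_subproof : path_one_fun \in path_supported.
Proof.
apply/path_supportedP; split=> [j t|]; first by case: t => // h t; rewrite /path_one_fun eqxx.
by exists 1%N => j [].
Qed.

Definition path_one := PathAlgebra path_one_subproof.

Let addE (f g : path_algebra) x : (f + g) x = f x + g x. Proof. by []. Qed.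
Let scaleE a (f : path_algebra) x : (a *: f) x = a * f x. Proof. by []. Qed.

Lemma path_mulA : associative path_mul.
Proof.
move=> f g h; apply: path_algebraP => i s; rewrite /= /path_mul_fun /=.
pose F (j m : nat) := f (endpoint i (take m s), drop m s) *
  g (endpoint i (take j s), drop j (take m s)) * h (i, take j s).
have -> : \sum_(j < (size s).+1) f (endpoint i (take j s), drop j s) *
    (\sum_(j0 < (size (take j s)).+1)
       g (endpoint i (take j0 (take j s)), drop j0 (take j s)) *
       h (i, take j0 (take j s))) =
    \sum_(m < (size s).+1) \sum_(j < (size s).+1 | (j <= m)%N) F j m.
  apply: eq_bigr => m _.
  have hm : (m <= size s)%N by rewrite -ltnS.
  rewrite big_distrr /= size_takel //.
  rewrite (big_ord_widen_cond (size s).+1 xpredT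
    (fun j => f (endpoint i (take m s), drop m s) *
      (g (endpoint i (take j (take m s)), drop j (take m s)) *
       h (i, take j (take m s))))) //.
  apply: eq_big => [j|j /= hj]; first by rewrite /= ltnS.
  by rewrite take_takel // /F mulrA.
rewrite (exchange_big_dep xpredT) //=; apply: eq_bigr => j _.
have hj : (j <= size s)%N by rewrite -ltnS.
rewrite -(big_mkord (fun m => (j <= m)%N) (fun m => F j m)).
rewrite (big_cat_nat (leq0n j) (leqW hj)) /=.
rewrite big_nat_cond big_pred0 ?add0r; last first.
  by move=> m; rewrite leq0n /= (ltnNge m); case: (j <= m)%N.
have -> : \sum_(j <= m < (size s).+1 | (j <= m)%N) F j m =
          \sum_(j <= m < (size s).+1) F j m.
  rewrite big_nat_cond [RHS]big_nat_cond; apply: eq_bigl => m.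
  by rewrite andbT andbAC andbb.
rewrite -{1}[j : nat]add0n big_addn subSn // big_mkord big_distrl /=.
rewrite size_drop; apply: eq_bigr => l _; rewrite /F.
have hl : (l + j <= size s)%N by have := ltn_ord l; rewrite ltnS leq_subRL // addnC.
rewrite drop_drop -endpoint_cat -takeD addnC; congr (_ * _ * _); congr (g (_, _)).
by rewrite take_drop [(l + j)%N]addnC.
Qed.

Lemma path_mul1 : left_id path_one path_mul.
Proof.
move=> f; apply: path_algebraP => i s; rewrite /= /path_mul_fun /path_one_fun /=.
rewrite big_ord_recr /= take_size drop_size mul1r big1 ?add0r // => j _.
suff /negPf-> : drop j s != [::] by rewrite mul0r.
by rewrite -size_eq0 size_drop subn_eq0 -ltnNge.
Qed.

Lemma path_mulr1 : right_id path_one path_mul.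
Proof.
move=> f; apply: path_algebraP => i s; rewrite /= /path_mul_fun /path_one_fun /=.
rewrite big_ord_recl /= take0 drop0 mulr1 big1 ?addr0 // => j _.
suff /negPf-> : take (bump 0 j) s != [::] by rewrite mulr0.
rewrite -size_eq0 size_takel //; have := ltn_ord j; by rewrite /bump.
Qed.

Lemma path_mulDl : left_distributive path_mul +%R.
Proof.
move=> f g h; apply: path_algebraP => i s; rewrite addE /= /path_mul_fun.
by rewrite -big_split /=; apply: eq_bigr => j _; rewrite -mulrDl.
Qed.

Lemma path_mulDr : right_distributive path_mul +%R.
Proof.
move=> f g h; apply: path_algebraP => i s; rewrite addE /= /path_mul_fun.
by rewrite -big_split /=; apply: eq_bigr => j _; rewrite -mulrDr.
Qed.

Lemma path_one_neq0 : path_one != 0.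
Proof.
have /card_gt0P[i _] := vert_gt0 Q.
by apply/eqP => /(congr1 (fun f : path_algebra => f (i, [::]))) /eqP; rewrite oner_eq0.
Qed.

HB.instance Definition _ := GRing.Zmodule_isNzRing.Build path_algebra
  path_mulA path_mul1 path_mulr1 path_mulDl path_mulDr path_one_neq0.

Lemma path_scaleAl (a : k) (f g : path_algebra) : a *: (f * g) = (a *: f) * g.
Proof.
apply: path_algebraP => i s; rewrite scaleE /= /path_mul_fun big_distrr /=.
by apply: eq_bigr => j _; rewrite mulrA.
Qed.

Lemma path_scaleAr (a : k) (f g : path_algebra) : a *: (f * g) = f * (a *: g).
Proof.
apply: path_algebraP => i s; rewrite scaleE /= /path_mul_fun big_distrr /=.
by apply: eq_bigr => j _; rewrite mulrCA.
Qed.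

HB.instance Definition _ :=
  GRing.Lmodule_isLalgebra.Build k path_algebra path_scaleAl.
HB.instance Definition _ :=
  GRing.Lalgebra_isAlgebra.Build k path_algebra path_scaleAr.

Definition path_vertex (i : vert Q) : path_algebra := path_delta i [::].
Definition path_arrow (h : arr Q) : path_algebra := path_delta (src h) [:: h].

(* The character of kQ that affords the simple module at i. *)
Definition path_char (i : vert Q) (f : path_algebra) : k := f (i, [::]).

Lemma path_char_zmod i : zmod_morphism (path_char i).
Proof. by []. Qed.

Lemma path_char_monoid i : monoid_morphism (path_char i).
Proof.
split=> // f g; rewrite /path_char /= /path_mul_fun /= big_ord_recl big_ord0.
by rewrite addr0.
Qed.

HB.instance Definition _ i :=
  GRing.isZmodMorphism.Build path_algebra k (path_char i) (path_char_zmod i).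
HB.instance Definition _ i :=
  GRing.isMonoidMorphism.Build path_algebra k (path_char i) (path_char_monoid i).

End PathAlgebra.

Section Preprojective.
Variables (k : fieldType) (Q : quiver).
Local Notation kQQ := (path_algebra k (double_quiver Q)).

Definition preprojective_relation : kQQ :=
  \sum_(h : arr Q)
    (path_arrow k (Q := double_quiver Q) (inl h)
       * path_arrow k (Q := double_quiver Q) (inr h)
     - path_arrow k (Q := double_quiver Q) (inr h)
       * path_arrow k (Q := double_quiver Q) (inl h)).

Definition preprojective_ideal : {pred kQQ} :=
  fun x => `[< exists s : seq (kQQ * kQQ),
               x = \sum_(p <- s) p.1 * preprojective_relation * p.2 >].

Lemma preprojective_ideal_zmod : zmod_closed preprojective_ideal.
Proof.
split=> [|x y /asboolP[s ->] /asboolP[t ->]].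
  by apply/asboolP; exists [::]; rewrite big_nil.
apply/asboolP; exists (s ++ [seq (- p.1, p.2) | p <- t]).
rewrite big_cat big_map /= -sumrN; congr (_ + _).
by apply: eq_bigr => p _; rewrite !mulNr.
Qed.

HB.instance Definition _ :=
  GRing.isZmodClosed.Build kQQ preprojective_ideal preprojective_ideal_zmod.

Lemma preprojective_idealMl a x :
  x \in preprojective_ideal -> a * x \in preprojective_ideal.
Proof.
move=> /asboolP[s ->]; apply/asboolP; exists [seq (a * p.1, p.2) | p <- s].
by rewrite big_map big_distrr /=; apply: eq_bigr => p _; rewrite !mulrA.
Qed.

Lemma preprojective_idealMr a x :
  x \in preprojective_ideal -> x * a \in preprojective_ideal.
Proof.
move=> /asboolP[s ->]; apply/asboolP; exists [seq (p.1, p.2 * a) | p <- s].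
by rewrite big_map big_distrl /=; apply: eq_bigr => p _; rewrite !mulrA.
Qed.

Lemma preprojective_ideal_char i x :
  x \in preprojective_ideal -> path_char i x = 0.
Proof.
pose e : {rmorphism kQQ -> k} := path_char i.
move=> /asboolP[s ->]; rewrite -[LHS]/(e _) rmorph_sum big1 // => p _.
rewrite !rmorphM /= -[path_char i preprojective_relation]/(e _) rmorph_sum.
rewrite big1 ?mulr0 ?mul0r // => h _.
by rewrite rmorphB !rmorphM /= mulrC subrr.
Qed.

Definition preprojective := Quotient.quot preprojective_ideal.
HB.instance Definition _ := GRing.Zmodule.on preprojective.

Definition preproj_pi (x : kQQ) : preprojective := \pi_(Quotient.quot preprojective_ideal) x.
Definition preproj_repr (x : preprojective) : kQQ := repr (x : Quotient.quot preprojective_ideal).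

Lemma preproj_reprK : cancel preproj_repr preproj_pi.
Proof. by move=> x; rewrite /preproj_pi /preproj_repr reprK. Qed.

Lemma preproj_piE x y :
  preproj_pi x = preproj_pi y <-> x - y \in preprojective_ideal.
Proof.
rewrite -Quotient.equivE.
by split=> [/eqquotP//|h]; apply/eqquotP.
Qed.

Lemma preproj_piD x y : preproj_pi (x + y) = preproj_pi x + preproj_pi y.
Proof. by rewrite /preproj_pi; exact: (raddfD (\pi_(Quotient.quot preprojective_ideal))). Qed.

Definition preproj_mul (x y : preprojective) : preprojective :=
  preproj_pi (preproj_repr x * preproj_repr y).
Definition preproj_scale (a : k) (x : preprojective) : preprojective :=
  preproj_pi (a *: preproj_repr x).

Lemma preproj_repr_pi x :
  x - preproj_repr (preproj_pi x) \in preprojective_ideal.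
Proof. by apply/preproj_piE; rewrite preproj_reprK. Qed.

Lemma preproj_piM x y :
  preproj_pi (x * y) = preproj_mul (preproj_pi x) (preproj_pi y).
Proof.
apply/preproj_piE; set x' := preproj_repr _; set y' := preproj_repr _.
have -> : x * y - x' * y' = x * (y - y') + (x - x') * y'.
  by rewrite mulrBr mulrBl addrA subrK.
apply: rpredD; first exact/preprojective_idealMl/preproj_repr_pi.
exact/preprojective_idealMr/preproj_repr_pi.
Qed.

Lemma preproj_piZ a x : preproj_pi (a *: x) = preproj_scale a (preproj_pi x).
Proof.
apply/preproj_piE; rewrite -scalerBr -mulr_algl.
exact/preprojective_idealMl/preproj_repr_pi.
Qed.

Lemma preproj_ind (P : preprojective -> Prop) :
  (forall x, P (preproj_pi x)) -> forall x, P x.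
Proof. by move=> h x; rewrite -[x]preproj_reprK. Qed.

Lemma preproj_mulA : associative preproj_mul.
Proof.
move=> x y z; elim/preproj_ind: x => x; elim/preproj_ind: y => y;
  elim/preproj_ind: z => z.
by rewrite -!preproj_piM mulrA.
Qed.

Lemma preproj_mul1 : left_id (preproj_pi 1) preproj_mul.
Proof. by move=> x; elim/preproj_ind: x => x; rewrite -preproj_piM mul1r. Qed.

Lemma preproj_mulr1 : right_id (preproj_pi 1) preproj_mul.
Proof. by move=> x; elim/preproj_ind: x => x; rewrite -preproj_piM mulr1. Qed.

Lemma preproj_mulDl : left_distributive preproj_mul +%R.
Proof.
move=> x y z; elim/preproj_ind: x => x; elim/preproj_ind: y => y;
  elim/preproj_ind: z => z.
by rewrite -preproj_piD -!preproj_piM -preproj_piD mulrDl.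
Qed.

Lemma preproj_mulDr : right_distributive preproj_mul +%R.
Proof.
move=> x y z; elim/preproj_ind: x => x; elim/preproj_ind: y => y;
  elim/preproj_ind: z => z.
by rewrite -preproj_piD -!preproj_piM -preproj_piD mulrDr.
Qed.

Lemma preproj_one_neq0 : preproj_pi 1 != 0.
Proof.
have /card_gt0P[i _] := vert_gt0 Q.
have -> : 0 = preproj_pi 0 :> preprojective.
  by apply: (addrI (preproj_pi 0)); rewrite -preproj_piD !addr0.
apply/eqP => /preproj_piE; rewrite subr0 => /(@preprojective_ideal_char i)/eqP.
by rewrite oner_eq0.
Qed.

HB.instance Definition _ := GRing.Zmodule_isNzRing.Build preprojective
  preproj_mulA preproj_mul1 preproj_mulr1 preproj_mulDl preproj_mulDr
  preproj_one_neq0.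

Lemma preproj_scaleA a b x :
  preproj_scale a (preproj_scale b x) = preproj_scale (a * b) x.
Proof. by elim/preproj_ind: x => x; rewrite -!preproj_piZ scalerA. Qed.

Lemma preproj_scale1 : left_id 1 preproj_scale.
Proof. by move=> x; elim/preproj_ind: x => x; rewrite -preproj_piZ scale1r. Qed.

Lemma preproj_scaleDr : right_distributive preproj_scale +%R.
Proof.
move=> a x y; elim/preproj_ind: x => x; elim/preproj_ind: y => y.
by rewrite -preproj_piD -!preproj_piZ -preproj_piD scalerDr.
Qed.

Lemma preproj_scaleDl x : {morph preproj_scale^~ x : a b / a + b}.
Proof.
by elim/preproj_ind: x => x a b; rewrite -!preproj_piZ -preproj_piD scalerDl.
Qed.

HB.instance Definition _ := GRing.Zmodule_isLmodule.Build k preprojective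
  preproj_scaleA preproj_scale1 preproj_scaleDr preproj_scaleDl.

Lemma preproj_scaleAl (a : k) (x y : preprojective) :
  a *: (x * y) = (a *: x) * y.
Proof.
elim/preproj_ind: x => x; elim/preproj_ind: y => y.
change (preproj_scale a (preproj_mul (preproj_pi x) (preproj_pi y)) =
        preproj_mul (preproj_scale a (preproj_pi x)) (preproj_pi y)).
by rewrite -preproj_piM -!preproj_piZ -preproj_piM scalerAl.
Qed.

Lemma preproj_scaleAr (a : k) (x y : preprojective) :
  a *: (x * y) = x * (a *: y).
Proof.
elim/preproj_ind: x => x; elim/preproj_ind: y => y.
change (preproj_scale a (preproj_mul (preproj_pi x) (preproj_pi y)) =
        preproj_mul (preproj_pi x) (preproj_scale a (preproj_pi y))).
by rewrite -preproj_piM -!preproj_piZ -preproj_piM scalerAr.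
Qed.

HB.instance Definition _ :=
  GRing.Lmodule_isLalgebra.Build k preprojective preproj_scaleAl.
HB.instance Definition _ :=
  GRing.Lalgebra_isAlgebra.Build k preprojective preproj_scaleAr.

Definition preproj_arrow (h : arr (double_quiver Q)) : preprojective :=
  preproj_pi (path_arrow k h).

Definition preproj_char (i : vert Q) (x : preprojective) : k :=
  path_char (Q := double_quiver Q) i (preproj_repr x).

Lemma preproj_char_pi i x :
  preproj_char i (preproj_pi x) = path_char (Q := double_quiver Q) i x.
Proof.
pose e : {rmorphism kQQ -> k} := path_char (Q := double_quiver Q) i.
apply/eqP; rewrite eq_sym -subr_eq0 -[path_char _ x]/(e x).
rewrite -[preproj_char _ _]/(e _) -rmorphB.
by apply/eqP/preprojective_ideal_char/preproj_repr_pi.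
Qed.

Lemma preproj_char_zmod i : zmod_morphism (preproj_char i).
Proof.
pose e : {rmorphism kQQ -> k} := path_char (Q := double_quiver Q) i.
move=> x y; elim/preproj_ind: x => x; elim/preproj_ind: y => y.
have -> : preproj_pi x - preproj_pi y = preproj_pi (x - y).
  by apply/eqP; rewrite subr_eq -preproj_piD subrK.
by rewrite !preproj_char_pi; exact: (rmorphB e).
Qed.

Lemma preproj_char_monoid i : monoid_morphism (preproj_char i).
Proof.
pose e : {rmorphism kQQ -> k} := path_char (Q := double_quiver Q) i.
split; first by rewrite preproj_char_pi; exact: (rmorph1 e).
move=> x y; elim/preproj_ind: x => x; elim/preproj_ind: y => y.
have -> : preproj_pi x * preproj_pi y = preproj_pi (x * y).
  by rewrite preproj_piM.
by rewrite !preproj_char_pi; exact: (rmorphM e).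
Qed.

HB.instance Definition _ i := GRing.isZmodMorphism.Build preprojective k
  (preproj_char i) (preproj_char_zmod i).
HB.instance Definition _ i := GRing.isMonoidMorphism.Build preprojective k
  (preproj_char i) (preproj_char_monoid i).

End Preprojective.

Arguments path_vertex {k Q}.
Arguments path_arrow {k Q}.
Arguments preproj_arrow {k Q}.

Definition lin_of (R : pzRingType) (U V : lmodType R) (f : U -> V)
  (fP : linear f) : {linear U -> V} := HB.pack f (GRing.isLinear.Build R U V *:%R f fP).

Lemma linear_ext (R : pzRingType) (U V : lmodType R) (f g : {linear U -> V}) :
  f =1 g -> f = g.
Proof.
case: f g => [f Hf] [g Hg] /= /funext fg; subst g; congr GRing.Linear.Pack.
by case: Hf Hg => [[a] [b]] [[c] [d]]; rewrite (Prop_irrelevance a c) (Prop_irrelevance b d).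
Qed.

Section SimpleModule.
Variables (k : fieldType) (L : pzRingType).

Definition char_module (chi : {rmorphism L -> k}) : Type := k.

Variable chi : {rmorphism L -> k}.
HB.instance Definition _ := GRing.Zmodule.on (char_module chi).

Definition char_scale (a : L) (x : char_module chi) : char_module chi :=
  (chi a * x : k).

Lemma char_scaleA a b x : char_scale a (char_scale b x) = char_scale (a * b) x.
Proof. by rewrite /char_scale rmorphM mulrA. Qed.

Lemma char_scale1 : left_id 1 char_scale.
Proof. by move=> x; rewrite /char_scale rmorph1 mul1r. Qed.

Lemma char_scaleDr : right_distributive char_scale +%R.
Proof. by move=> a x y; rewrite /char_scale -mulrDr. Qed.

Lemma char_scaleDl x : {morph char_scale^~ x : a b / a + b}.
Proof. by move=> a b; rewrite /char_scale rmorphD mulrDl. Qed.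

HB.instance Definition _ := GRing.Zmodule_isLmodule.Build L (char_module chi)
  char_scaleA char_scale1 char_scaleDr char_scaleDl.
End SimpleModule.

Section Modules.
Variable L : pzRingType.

Definition fin_generated (M : lmodType L) : Prop :=
  exists n (b : 'I_n -> M), forall x, exists c : 'I_n -> L,
    x = \sum_(i < n) c i *: b i.

Definition projective (P : lmodType L) : Prop :=
  forall (M N : lmodType L) (p : {linear M -> N}) (f : {linear P -> N}),
    (forall y, exists x, p x = y) -> exists g : {linear P -> M}, p \o g =1 f.

Definition fg_projective (P : lmodType L) : Prop :=
  fin_generated P /\ projective P.

End Modules.

Section HomSpace.
Variables (k : fieldType) (L : algType k).

Definition homk (P M : lmodType L) : Type := {linear P -> M}.

Variables P M : lmodType L.

HB.instance Definition _ := gen_eqMixin (homk P M).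
HB.instance Definition _ := gen_choiceMixin (homk P M).

Definition homk_fun (f : homk P M) : {linear P -> M} := f.
Coercion homk_fun : homk >-> GRing.Linear.type.

Lemma homk_ext (f g : homk P M) : f =1 g -> f = g.
Proof. exact: linear_ext. Qed.

Lemma homk_zero_linear : linear (fun _ : P => 0 : M).
Proof. by move=> a x y; rewrite scaler0 addr0. Qed.
Lemma homk_opp_linear (f : homk P M) : linear (fun x => - f x).
Proof. by move=> a x y; rewrite linearP opprD scalerN. Qed.
Lemma homk_add_linear (f g : homk P M) : linear (fun x => f x + g x).
Proof. by move=> a x y; rewrite !linearP scalerDr addrACA. Qed.
Lemma homk_scale_linear (c : k) (f : homk P M) : linear (fun x => c%:A *: f x).
Proof.
move=> a x y; rewrite linearP scalerDr !scalerA; congr (_ *: _ + _).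
by rewrite mulr_algl mulr_algr.
Qed.

Definition homk_zero : homk P M := lin_of homk_zero_linear.
Definition homk_opp f : homk P M := lin_of (homk_opp_linear f).
Definition homk_add f g : homk P M := lin_of (homk_add_linear f g).
Definition homk_scale c f : homk P M := lin_of (homk_scale_linear c f).

Lemma homk_addA : associative homk_add.
Proof. by move=> f g h; apply: homk_ext => x; exact: addrA. Qed.
Lemma homk_addC : commutative homk_add.
Proof. by move=> f g; apply: homk_ext => x; exact: addrC. Qed.
Lemma homk_add0 : left_id homk_zero homk_add.
Proof. by move=> f; apply: homk_ext => x; exact: add0r. Qed.
Lemma homk_addN : left_inverse homk_zero homk_opp homk_add.
Proof. by move=> f; apply: homk_ext => x; exact: addNr. Qed.

HB.instance Definition _ :=
  GRing.isZmodule.Build (homk P M) homk_addA homk_addC homk_add0 homk_addN.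

Lemma homk_scaleA a b f : homk_scale a (homk_scale b f) = homk_scale (a * b) f.
Proof.
by apply: homk_ext => x; rewrite /= scalerA -scalerAl mul1r scalerA.
Qed.
Lemma homk_scale1 : left_id 1 homk_scale.
Proof. by move=> f; apply: homk_ext => x; rewrite /= !scale1r. Qed.
Lemma homk_scaleDr : right_distributive homk_scale +%R.
Proof. by move=> a f g; apply: homk_ext => x; exact: scalerDr. Qed.
Lemma homk_scaleDl f : {morph homk_scale^~ f : a b / a + b}.
Proof.
by move=> a b; apply: homk_ext => x; rewrite /= scalerDl; exact: scalerDl.
Qed.

HB.instance Definition _ := GRing.Zmodule_isLmodule.Build k (homk P M)
  homk_scaleA homk_scale1 homk_scaleDr homk_scaleDl.

End HomSpace.

Section Restriction.
Variables (k : fieldType) (L : algType k).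
Definition resk (M : lmodType L) : Type := M.
Variable M : lmodType L.
HB.instance Definition _ := GRing.Zmodule.on (resk M).
Definition resk_scale (c : k) (x : resk M) : resk M := (c%:A : L) *: (x : M).
Lemma resk_scaleA a b f : resk_scale a (resk_scale b f) = resk_scale (a * b) f.
Proof. by rewrite /resk_scale scalerA -scalerAl mul1r scalerA. Qed.
Lemma resk_scale1 : left_id 1 resk_scale.
Proof. by move=> f; rewrite /resk_scale !scale1r. Qed.
Lemma resk_scaleDr : right_distributive resk_scale +%R.
Proof. by move=> a f g; exact: scalerDr. Qed.
Lemma resk_scaleDl f : {morph resk_scale^~ f : a b / a + b}.
Proof. by move=> a b; rewrite /resk_scale scalerDl; exact: scalerDl. Qed.
HB.instance Definition _ := GRing.Zmodule_isLmodule.Build k (resk M)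
  resk_scaleA resk_scale1 resk_scaleDr resk_scaleDl.
End Restriction.

Definition fin_dim (k : fieldType) (L : algType k) (M : lmodType L) : Prop :=
  fin_generated (resk M).

(* dim_k Z / B = n, where B is contained in Z. *)
Definition subquot_dim (k : fieldType) (V : lmodType k) (Z B : V -> Prop)
    (n : nat) : Prop :=
  exists b : 'I_n -> V, (forall i, Z (b i)) /\
    forall z, Z z -> exists! c : 'rV[k]_n, B (z - \sum_(i < n) c 0 i *: b i).

Section Tensor.
Variables (k : fieldType) (L : algType k).

(* Finite sums of pure tensors v (x) x, as lists of pairs, up to the relations
   that define the tensor product over k. *)
Inductive tensor_eq (V : lmodType k) (P : lmodType L) :
    seq (V * P) -> seq (V * P) -> Prop :=
| tensor_refl s : tensor_eq s s
| tensor_sym s t : tensor_eq s t -> tensor_eq t s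
| tensor_trans s t u : tensor_eq s t -> tensor_eq t u -> tensor_eq s u
| tensor_cat s s' t t' :
    tensor_eq s s' -> tensor_eq t t' -> tensor_eq (s ++ t) (s' ++ t')
| tensor_comm s t : tensor_eq (s ++ t) (t ++ s)
| tensor_opp v x : tensor_eq [:: (v, x); (- v, x)] [::]
| tensor_addl v v' x : tensor_eq [:: (v + v', x)] [:: (v, x); (v', x)]
| tensor_addr v x x' : tensor_eq [:: (v, x + x')] [:: (v, x); (v, x')]
| tensor_bal c v x : tensor_eq [:: (c *: v, x)] [:: (v, (c%:A : L) *: x)].

Variables (V : lmodType k) (P : lmodType L).

Definition tensor_eqb (s t : {classic seq (V * P)}) : bool :=
  `[< @tensor_eq V P s t >].

Lemma tensor_eqb_refl : reflexive tensor_eqb.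
Proof. by move=> s; apply/asboolP; exact: tensor_refl. Qed.
Lemma tensor_eqb_sym : symmetric tensor_eqb.
Proof. by move=> s t; apply/asboolP/asboolP; exact: tensor_sym. Qed.
Lemma tensor_eqb_trans : transitive tensor_eqb.
Proof.
by move=> s t u /asboolP h /asboolP h'; apply/asboolP; apply: tensor_trans h'.
Qed.

Canonical tensor_equiv :=
  EquivRel tensor_eqb tensor_eqb_refl tensor_eqb_sym tensor_eqb_trans.

Definition tensor := {eq_quot tensor_equiv}.
HB.instance Definition _ := Choice.on tensor.

Definition tensor_pi (s : seq (V * P)) : tensor :=
  \pi_({eq_quot tensor_equiv}) (s : {classic seq (V * P)}).
Definition tensor_repr (x : tensor) : seq (V * P) :=
  repr (x : {eq_quot tensor_equiv}).

Lemma tensor_reprK x : tensor_pi (tensor_repr x) = x.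
Proof. exact: reprK. Qed.

Lemma tensor_piE s t : tensor_pi s = tensor_pi t <-> tensor_eq s t.
Proof.
split=> [/eqquotP/asboolP//|h]; apply/eqquotP; exact/asboolP.
Qed.

Lemma tensor_repr_pi s : tensor_eq (tensor_repr (tensor_pi s)) s.
Proof. by apply/tensor_piE; rewrite tensor_reprK. Qed.

Definition pure (v : V) (x : P) : tensor := tensor_pi [:: (v, x)].

Definition opp_list (s : seq (V * P)) := [seq (- p.1, p.2) | p <- s].
Definition scale_list (a : L) (s : seq (V * P)) := [seq (p.1, a *: p.2) | p <- s].

Lemma opp_list_catr s : tensor_eq (s ++ opp_list s) [::].
Proof.
elim: s => [|[v x] s IH]; first exact: tensor_refl.
rewrite -[_ ++ _]/([:: (v, x)] ++ (s ++ ([:: (- v, x)] ++ opp_list s))).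
apply: tensor_trans (_ : tensor_eq ([:: (v, x)] ++ [:: (- v, x)] ++ (s ++ opp_list s)) _).
  apply: tensor_cat; first exact: tensor_refl.
  rewrite !catA; apply: tensor_cat; [exact: tensor_comm|exact: tensor_refl].
rewrite catA -[in X in tensor_eq _ X](cats0 [::]).
by apply: tensor_cat => //; exact: tensor_opp.
Qed.

Lemma tensor_eq_opp s t : tensor_eq s t -> tensor_eq (opp_list s) (opp_list t).
Proof.
move=> st.
apply: tensor_trans (_ : tensor_eq (opp_list s ++ (t ++ opp_list t)) _).
  rewrite -[in X in tensor_eq X _](cats0 (opp_list s)).
  apply: tensor_cat; first exact: tensor_refl.
  exact/tensor_sym/opp_list_catr.
rewrite catA -[in X in tensor_eq _ X](cat0s (opp_list t)).
apply: tensor_cat; last exact: tensor_refl.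
apply: tensor_trans (tensor_comm _ _) _.
apply: tensor_trans (opp_list_catr s).
by apply: tensor_cat; [exact: tensor_sym|exact: tensor_refl].
Qed.

Lemma tensor_eq_scale a s t :
  tensor_eq s t -> tensor_eq (scale_list a s) (scale_list a t).
Proof.
elim=> {s t} [s|s t _|s t u _ h _|s s' t t' _ h _ h'|s t|v x|v v' x|v x x'|c v x] /=.
- exact: tensor_refl.
- exact: tensor_sym.
- exact: tensor_trans.
- by rewrite /scale_list !map_cat; exact: tensor_cat.
- by rewrite /scale_list !map_cat; exact: tensor_comm.
- exact: tensor_opp.
- exact: tensor_addl.
- by rewrite scalerDr; exact: tensor_addr.
- have -> : a *: ((c%:A : L) *: x) = (c%:A : L) *: (a *: x).
    by rewrite !scalerA mulr_algl mulr_algr.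
  exact: tensor_bal.
Qed.

Definition tensor_zero := tensor_pi [::].
Definition tensor_add (x y : tensor) := tensor_pi (tensor_repr x ++ tensor_repr y).
Definition tensor_neg (x : tensor) := tensor_pi (opp_list (tensor_repr x)).
Definition tensor_scale (a : L) (x : tensor) :=
  tensor_pi (scale_list a (tensor_repr x)).

Lemma tensor_addE s t : tensor_add (tensor_pi s) (tensor_pi t) = tensor_pi (s ++ t).
Proof. by apply/tensor_piE/tensor_cat; exact: tensor_repr_pi. Qed.
Lemma tensor_negE s : tensor_neg (tensor_pi s) = tensor_pi (opp_list s).
Proof. by apply/tensor_piE/tensor_eq_opp/tensor_repr_pi. Qed.
Lemma tensor_scaleE a s : tensor_scale a (tensor_pi s) = tensor_pi (scale_list a s).
Proof. by apply/tensor_piE/tensor_eq_scale/tensor_repr_pi. Qed.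

Lemma tensor_pi_ind (A : tensor -> Prop) :
  (forall s, A (tensor_pi s)) -> forall x, A x.
Proof. by move=> h x; rewrite -[x]tensor_reprK. Qed.

Lemma tensor_addA : associative tensor_add.
Proof.
move=> x y z; elim/tensor_pi_ind: x => x; elim/tensor_pi_ind: y => y;
  elim/tensor_pi_ind: z => z.
by rewrite !tensor_addE catA.
Qed.
Lemma tensor_addC : commutative tensor_add.
Proof.
move=> x y; elim/tensor_pi_ind: x => x; elim/tensor_pi_ind: y => y.
by rewrite !tensor_addE; apply/tensor_piE/tensor_comm.
Qed.
Lemma tensor_add0 : left_id tensor_zero tensor_add.
Proof. by move=> x; elim/tensor_pi_ind: x => x; rewrite tensor_addE. Qed.
Lemma tensor_addN : left_inverse tensor_zero tensor_neg tensor_add.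
Proof.
move=> x; rewrite tensor_addC; elim/tensor_pi_ind: x => x.
by rewrite tensor_negE tensor_addE; apply/tensor_piE/opp_list_catr.
Qed.

HB.instance Definition _ :=
  GRing.isZmodule.Build tensor tensor_addA tensor_addC tensor_add0 tensor_addN.

Lemma tensor_pi_cat s t : tensor_pi (s ++ t) = tensor_pi s + tensor_pi t.
Proof. by rewrite -tensor_addE. Qed.

Lemma pure_addl v v' x : pure (v + v') x = pure v x + pure v' x.
Proof. by rewrite -tensor_pi_cat; apply/tensor_piE/tensor_addl. Qed.
Lemma pure_addr v x x' : pure v (x + x') = pure v x + pure v x'.
Proof. by rewrite -tensor_pi_cat; apply/tensor_piE/tensor_addr. Qed.
Lemma pure_bal c v x : pure (c *: v) x = pure v ((c%:A : L) *: x).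
Proof. by apply/tensor_piE/tensor_bal. Qed.

Lemma tensor_scaleA a b x : tensor_scale a (tensor_scale b x) = tensor_scale (a * b) x.
Proof.
elim/tensor_pi_ind: x => x; rewrite !tensor_scaleE /scale_list -map_comp.
by congr tensor_pi; apply: eq_map => p /=; rewrite scalerA.
Qed.
Lemma tensor_scale1 : left_id 1 tensor_scale.
Proof.
move=> x; elim/tensor_pi_ind: x => x; rewrite !tensor_scaleE; congr tensor_pi.
by rewrite -[RHS]map_id; apply: eq_map => -[v y] /=; rewrite scale1r.
Qed.
Lemma tensor_scaleDr : right_distributive tensor_scale +%R.
Proof.
move=> a x y; elim/tensor_pi_ind: x => x; elim/tensor_pi_ind: y => y.
by rewrite -tensor_pi_cat !tensor_scaleE -tensor_pi_cat /scale_list map_cat.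
Qed.
Lemma tensor_scaleDl x : {morph tensor_scale^~ x : a b / a + b}.
Proof.
move=> a b; elim/tensor_pi_ind: x => x; rewrite !tensor_scaleE.
elim: x => [|[v y] x IH] /=; first by rewrite -[RHS]tensor_pi_cat.
rewrite -cat1s tensor_pi_cat IH -[tensor_pi [:: _]]/(pure v _) scalerDl pure_addr.
by rewrite addrACA; congr (_ + _); exact: esym (tensor_pi_cat _ _).
Qed.

HB.instance Definition _ := GRing.Zmodule_isLmodule.Build L tensor
  tensor_scaleA tensor_scale1 tensor_scaleDr tensor_scaleDl.

Lemma pure_scale a v x : a *: pure v x = pure v (a *: x).
Proof. exact: tensor_scaleE. Qed.

Lemma tensor_ext (W : lmodType L) (f g : {linear tensor -> W}) :
  (forall v x, f (pure v x) = g (pure v x)) -> f =1 g.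
Proof.
move=> fg x; elim/tensor_pi_ind: x; elim=> [|[v x] s IH].
  by rewrite -[tensor_pi [::]]/(0 : tensor) !linear0.
by rewrite -cat1s tensor_pi_cat !linearD IH -[tensor_pi [:: _]]/(pure v x) fg.
Qed.

Section Lift.
Variables (W : lmodType L) (phi : V -> P -> W).

Definition bilinear_balanced : Prop :=
  [/\ forall v v' x, phi (v + v') x = phi v x + phi v' x,
      forall v a x y, phi v (a *: x + y) = a *: phi v x + phi v y &
      forall c v x, phi (c *: v) x = phi v ((c%:A : L) *: x)].

Hypothesis phiP : bilinear_balanced.

Definition lift_list (s : seq (V * P)) : W := \sum_(p <- s) phi p.1 p.2.

Lemma lift_list_eq s t : tensor_eq s t -> lift_list s = lift_list t.
Proof.
case: phiP => phiDl phiDr phiB; rewrite /lift_list.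
have phi0 x : phi 0 x = 0.
  by apply: (addrI (phi 0 x)); rewrite -phiDl !addr0.
elim=> {s t} [//|s t _ ->//|s t u _ -> //|s s' t t' _ h _ h'|s t|v x|v v' x|v x x'|c v x].
- by rewrite !big_cat h h'.
- by rewrite !big_cat /= addrC.
- by rewrite !big_cons !big_nil /= addr0 -phiDl subrr phi0.
- by rewrite !big_cons !big_nil /= !addr0 phiDl.
- by rewrite !big_cons !big_nil /= !addr0 -{1}[x]scale1r phiDr scale1r.
- by rewrite !big_cons !big_nil /= !addr0 phiB.
Qed.

Lemma tensor_lift_linear : linear (fun x : tensor => lift_list (tensor_repr x)).
Proof.
have E s : lift_list (tensor_repr (tensor_pi s)) = lift_list s.
  exact/lift_list_eq/tensor_repr_pi.
move=> a x y; elim/tensor_pi_ind: x => x; elim/tensor_pi_ind: y => y.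
have -> : a *: tensor_pi x = tensor_pi (scale_list a x) by exact: tensor_scaleE.
rewrite -tensor_pi_cat !E /lift_list big_cat big_map /= scaler_sumr.
congr (_ + _); apply: eq_bigr => p _; case: phiP => _ phiDr _.
have phi0 v : phi v 0 = 0.
  have := phiDr v 1 0 0; rewrite !scale1r addr0 => h.
  by apply: (addrI (phi v 0)); rewrite addr0 -h.
by rewrite -[_ *: p.2]addr0 phiDr phi0 addr0.
Qed.

Definition tensor_lift : {linear tensor -> W} := lin_of tensor_lift_linear.

Lemma tensor_lift_pure v x : tensor_lift (pure v x) = phi v x.
Proof.
rewrite /= (lift_list_eq (tensor_repr_pi _)) /lift_list big_cons big_nil.
exact: addr0.
Qed.

End Lift.
End Tensor.

Section TensorMap.
Variables (k : fieldType) (L : algType k).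
Variables (V V' : lmodType k) (P P' : lmodType L).
Variables (f : {linear V -> V'}) (g : {linear P -> P'}).

Lemma tensor_map_subproof :
  bilinear_balanced (fun v x => pure (f v) (g x)).
Proof.
split=> [v v' x|v a x y|c v x].
- by rewrite linearD pure_addl.
- by rewrite linearP pure_addr pure_scale.
- by rewrite !linearZ pure_bal.
Qed.

Definition tensor_map : {linear tensor V P -> tensor V' P'} :=
  tensor_lift tensor_map_subproof.

Lemma tensor_mapE v x : tensor_map (pure v x) = pure (f v) (g x).
Proof. exact: tensor_lift_pure. Qed.
End TensorMap.

Section DirectSum.
Variables (R : pzRingType) (I : choiceType) (M : I -> lmodType R).

Record dsum := DSum {
  dsum_fun :> forall i, M i;
  dsumP : exists s : seq I, forall i, i \notin s -> dsum_fun i = 0 }.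

HB.instance Definition _ := gen_eqMixin dsum.
HB.instance Definition _ := gen_choiceMixin dsum.

Lemma dsum_ext (x y : dsum) : (forall i, x i = y i) -> x = y.
Proof.
case: x y => [x xP] [y yP] /= xy.
have {}xy : x = y by apply: functional_extensionality_dep.
by subst y; rewrite (Prop_irrelevance xP yP).
Qed.

Lemma dsum_zero_subproof : exists s : seq I, forall i, i \notin s -> 0 = 0 :> M i.
Proof. by exists [::]. Qed.
Definition dsum_zero := DSum dsum_zero_subproof.

Lemma dsum_add_subproof (x y : dsum) :
  exists s : seq I, forall i, i \notin s -> x i + y i = 0.
Proof.
have [s hs] := dsumP x; have [t ht] := dsumP y; exists (s ++ t) => i.
by rewrite mem_cat negb_or => /andP[/hs -> /ht ->]; rewrite addr0.
Qed.
Definition dsum_add x y := DSum (dsum_add_subproof x y).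

Lemma dsum_opp_subproof (x : dsum) :
  exists s : seq I, forall i, i \notin s -> - x i = 0.
Proof. by have [s hs] := dsumP x; exists s => i /hs ->; rewrite oppr0. Qed.
Definition dsum_opp x := DSum (dsum_opp_subproof x).

Lemma dsum_scale_subproof (a : R) (x : dsum) :
  exists s : seq I, forall i, i \notin s -> a *: x i = 0.
Proof. by have [s hs] := dsumP x; exists s => i /hs ->; rewrite scaler0. Qed.
Definition dsum_scale a x := DSum (dsum_scale_subproof a x).

Lemma dsum_addA : associative dsum_add.
Proof. by move=> x y z; apply: dsum_ext => i; exact: addrA. Qed.
Lemma dsum_addC : commutative dsum_add.
Proof. by move=> x y; apply: dsum_ext => i; exact: addrC. Qed.
Lemma dsum_add0 : left_id dsum_zero dsum_add.
Proof. by move=> x; apply: dsum_ext => i; exact: add0r. Qed.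
Lemma dsum_addN : left_inverse dsum_zero dsum_opp dsum_add.
Proof. by move=> x; apply: dsum_ext => i; exact: addNr. Qed.
HB.instance Definition _ :=
  GRing.isZmodule.Build dsum dsum_addA dsum_addC dsum_add0 dsum_addN.

Lemma dsum_scaleA a b x : dsum_scale a (dsum_scale b x) = dsum_scale (a * b) x.
Proof. by apply: dsum_ext => i; exact: scalerA. Qed.
Lemma dsum_scale1 : left_id 1 dsum_scale.
Proof. by move=> x; apply: dsum_ext => i; exact: scale1r. Qed.
Lemma dsum_scaleDr : right_distributive dsum_scale +%R.
Proof. by move=> a x y; apply: dsum_ext => i; exact: scalerDr. Qed.
Lemma dsum_scaleDl x : {morph dsum_scale^~ x : a b / a + b}.
Proof. by move=> a b; apply: dsum_ext => i; exact: scalerDl. Qed.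
HB.instance Definition _ := GRing.Zmodule_isLmodule.Build R dsum
  dsum_scaleA dsum_scale1 dsum_scaleDr dsum_scaleDl.
End DirectSum.

Section Complexes.
Variable R : pzRingType.

(* Z-graded complexes with differential of degree 1; the differential is given
   as a map C i -> C j for all i, j, which vanishes unless j = i + 1. *)
Record cplx := Cplx {
  cobj :> int -> lmodType R;
  cdiff : forall i j, {linear cobj i -> cobj j};
  cdiff0 : forall i j, j != i + 1 -> forall x, cdiff i j x = 0;
  cdiffK : forall i j l x, cdiff j l (cdiff i j x) = 0 }.

Record cmap (C D : cplx) := CMap {
  cmap_fun :> forall i, {linear C i -> D i};
  cmapP : forall i j x, cmap_fun j (cdiff C i j x) = cdiff D i j (cmap_fun i x) }.

Definition quasi_iso (C D : cplx) (f : cmap C D) : Prop :=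
  forall n : int,
    (forall z, cdiff C n (n + 1) z = 0 ->
       (exists y, f n z = cdiff D (n - 1) n y) ->
       exists w, z = cdiff C (n - 1) n w) /\
    (forall x, cdiff D n (n + 1) x = 0 ->
       exists z, cdiff C n (n + 1) z = 0 /\
         exists y, x - f n z = cdiff D (n - 1) n y).

Definition vanishes_beyond (b : nat) (C : cplx) : Prop :=
  forall n : int, (b < `|n|)%N -> forall x : C n, x = 0.

Definition bounded (C : cplx) : Prop := exists b, vanishes_beyond b C.

Definition projective_resolution (P X : cplx) : Prop :=
  [/\ bounded P, forall n, fg_projective (P n) &
      exists q : cmap P X, quasi_iso q].

Definition stalk_obj (M : lmodType R) (n : int) : lmodType R :=
  if n == 0 then M else 'rV[R]_0.

Lemma zero_linear (U V : lmodType R) : linear (fun _ : U => 0 : V).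
Proof. by move=> a x y; rewrite scaler0 addr0. Qed.
Definition zero_map (U V : lmodType R) : {linear U -> V} :=
  lin_of (@zero_linear U V).

Definition stalk (M : lmodType R) : cplx :=
  @Cplx (stalk_obj M) (fun i j => zero_map _ _)
    (fun _ _ _ _ => erefl) (fun _ _ _ _ => erefl).

Record cplx2 := Cplx2 {
  c0 : lmodType R;
  c1 : lmodType R;
  d0 : {linear c0 -> c1};
  d1 : {linear c1 -> c0};
  d1d0 : forall x, d1 (d0 x) = 0;
  d0d1 : forall x, d0 (d1 x) = 0 }.

Record cmap2 (X Y : cplx2) := CMap2 {
  m0 : {linear c0 X -> c0 Y};
  m1 : {linear c1 X -> c1 Y};
  m0P : forall x, m1 (d0 X x) = d0 Y (m0 x);
  m1P : forall x, m0 (d1 X x) = d1 Y (m1 x) }.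

Definition homotopic (X Y : cplx2) (a0 b0 : c0 X -> c0 Y) (a1 b1 : c1 X -> c1 Y) :=
  exists (s0 : {linear c0 X -> c1 Y}) (s1 : {linear c1 X -> c0 Y}),
    (forall x, a0 x - b0 x = d1 Y (s0 x) + s1 (d0 X x)) /\
    (forall x, a1 x - b1 x = d0 Y (s1 x) + s0 (d1 X x)).

Definition homotopy_equiv (X Y : cplx2) : Prop :=
  exists (f : cmap2 X Y) (g : cmap2 Y X),
    homotopic (m0 g \o m0 f) id (m1 g \o m1 f) id /\
    homotopic (m0 f \o m0 g) id (m1 f \o m1 g) id.

Definition fg_projective2 (X : cplx2) : Prop :=
  fg_projective (c0 X) /\ fg_projective (c1 X).

Lemma opp_linear (U V : lmodType R) (f : {linear U -> V}) : linear (fun x : U => - f x : V).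
Proof. by move=> a x y; rewrite linearP opprD scalerN. Qed.
Definition opp_map (U V : lmodType R) (f : {linear U -> V}) : {linear U -> V} :=
  lin_of (opp_linear f).

Definition shift2 (X : cplx2) : cplx2.
Proof.
refine (@Cplx2 (c1 X) (c0 X) (opp_map (d1 X)) (opp_map (d0 X)) _ _) => x /=.
  by rewrite linearN d0d1 !oppr0.
by rewrite linearN d1d0 !oppr0.
Defined.

Lemma dsum2_linear (U U' V V' : lmodType R)
    (f : {linear U -> V}) (g : {linear U' -> V'}) :
  linear (fun x : U * U' => (f x.1, g x.2) : V * V').
Proof. by move=> a x y; rewrite /= !linearP. Qed.

Definition direct_sum2 (X Y : cplx2) : cplx2.
Proof.
refine (@Cplx2 (c0 X * c0 Y)%type (c1 X * c1 Y)%type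
  (lin_of (dsum2_linear (d0 X) (d0 Y)))
  (lin_of (dsum2_linear (d1 X) (d1 Y))) _ _) => x /=.
  by rewrite !d1d0.
by rewrite !d0d1.
Defined.

Lemma cone_linear (Y Y' X X' : lmodType R) (dY : {linear Y -> Y'})
    (f : {linear X -> Y'}) (dX : {linear X -> X'}) :
  linear (fun z : Y * X => (dY z.1 + f z.2, - dX z.2) : Y' * X').
Proof.
move=> a x y; by apply: injective_projections; rewrite /= !linearP // scalerDr addrACA.
Qed.

(* Y (+) X[1], with differential [d_Y, f; 0, -d_X]. *)
Definition cone (X Y : cplx2) (f : cmap2 X Y) : cplx2.
Proof.
refine (@Cplx2 (c0 Y * c1 X)%type (c1 Y * c0 X)%type
  (lin_of (cone_linear (d0 Y) (m1 f) (d1 X)))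
  (lin_of (cone_linear (d1 Y) (m0 f) (d0 X))) _ _) => -[y x] /=;
  apply: injective_projections => /=.
- by rewrite linearD d1d0 add0r linearN m1P addrN.
- by rewrite linearN opprK d0d1.
- by rewrite linearD d0d1 add0r linearN m0P addrN.
- by rewrite linearN opprK d1d0.
Defined.

(* Degree n of these families is degree 2n, resp. 2n + 1, of C. *)
Definition fold_even (C : cplx) : lmodType R := dsum (fun n : int => C (n * 2)).
Definition fold_odd (C : cplx) : lmodType R := dsum (fun n : int => C (n * 2 + 1)).

Lemma fold_d0_subproof (C : cplx) (x : fold_even C) :
  exists s : seq int, forall n, n \notin s ->
    cdiff C (n * 2) (n * 2 + 1) (dsum_fun x n) = 0.
Proof. by have [s hs] := dsumP x; exists s => n /hs ->; rewrite linear0. Qed.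

Lemma fold_d1_subproof (C : cplx) (x : fold_odd C) :
  exists s : seq int, forall n, n \notin s ->
    cdiff C ((n - 1) * 2 + 1) (n * 2) (dsum_fun x (n - 1)) = 0.
Proof.
have [s hs] := dsumP x; exists [seq m + 1 | m <- s] => n hn.
rewrite hs ?linear0 //; apply: contra hn => hn.
by apply/mapP; exists (n - 1); rewrite ?subrK.
Qed.

Definition fold_d0_fun C (x : fold_even C) : fold_odd C := DSum (fold_d0_subproof x).
Definition fold_d1_fun C (x : fold_odd C) : fold_even C := DSum (fold_d1_subproof x).

Lemma fold_d0_linear C : linear (@fold_d0_fun C).
Proof. by move=> a x y; apply: dsum_ext => n; exact: linearP. Qed.
Lemma fold_d1_linear C : linear (@fold_d1_fun C).
Proof. by move=> a x y; apply: dsum_ext => n; exact: linearP. Qed.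

(* Delta(C): the sum of the even terms against the sum of the odd terms. *)
Definition fold2 (C : cplx) : cplx2.
Proof.
refine (@Cplx2 (fold_even C) (fold_odd C) (lin_of (@fold_d0_linear C))
  (lin_of (@fold_d1_linear C)) _ _) => x /=; apply: dsum_ext => n; exact: cdiffK.
Defined.

End Complexes.

Section SphericalTwist.
Variables (k : fieldType) (L : algType k).

Section HomComp.
Variables P P' M M' : lmodType L.

Lemma comp_linear (g : {linear M -> M'}) (f : {linear P -> M}) :
  linear (fun x : P => g (f x) : M').
Proof. by move=> a x y; rewrite !linearP. Qed.

Definition hom_post_fun (g : {linear M -> M'}) (f : homk P M) : homk P M' :=
  lin_of (comp_linear g f).

Lemma hom_post_linear g : linear (hom_post_fun g).
Proof. by move=> a f f'; apply: homk_ext => x /=; rewrite linearP. Qed.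

Definition hom_post g : {linear homk P M -> homk P M'} :=
  lin_of (hom_post_linear g).
End HomComp.

Section HomPre.
Variables P P' M : lmodType L.

Definition hom_pre_fun (g : {linear P' -> P}) (f : homk P M) : homk P' M :=
  lin_of (comp_linear f g).

Lemma hom_pre_linear g : linear (hom_pre_fun g).
Proof. by move=> a f f'; apply: homk_ext. Qed.

Definition hom_pre g : {linear homk P M -> homk P' M} :=
  lin_of (hom_pre_linear g).
End HomPre.

Lemma pair_linear (R : pzRingType) (U U' V V' : lmodType R)
    (f : {linear U -> V}) (f' : {linear U' -> V})
    (g : {linear U -> V'}) (g' : {linear U' -> V'}) :
  linear (fun x : U * U' => (f x.1 + f' x.2, g x.1 + g' x.2) : V * V').
Proof.
by move=> a x y; apply: injective_projections;
  rewrite /= !linearP scalerDr addrACA.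
Qed.

(* [f, f'; g, g'] *)
Definition pair_map (R : pzRingType) (U U' V V' : lmodType R)
    (f : {linear U -> V}) (f' : {linear U' -> V})
    (g : {linear U -> V'}) (g' : {linear U' -> V'}) :
    {linear (U * U')%type -> (V * V')%type} :=
  lin_of (pair_linear f f' g g').

Lemma pair_map_comp0 (R : pzRingType) (U U' V V' W W' : lmodType R)
    (f : {linear U -> V}) (f' : {linear U' -> V})
    (g : {linear U -> V'}) (g' : {linear U' -> V'})
    (h : {linear V -> W}) (h' : {linear V' -> W})
    (e : {linear V -> W'}) (e' : {linear V' -> W'}) :
  (forall x, h (f x) + h' (g x) = 0) -> (forall x, h (f' x) + h' (g' x) = 0) ->
  (forall x, e (f x) + e' (g x) = 0) -> (forall x, e (f' x) + e' (g' x) = 0) ->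
  forall z, pair_map h h' e e' (pair_map f f' g g' z) = 0.
Proof.
move=> h1 h2 h3 h4 [x y]; apply: injective_projections; rewrite /= !linearD addrACA.
  by rewrite h1 h2 addr0.
by rewrite h3 h4 addr0.
Qed.

Lemma opp_mapE (R : pzRingType) (U V : lmodType R) (f : {linear U -> V}) x :
  opp_map f x = - f x.
Proof. by []. Qed.

(* Degree j is the sum over a in Z/2 of Hom(P_a, M_{a+j}); the differential is
   f |-> d_M f - (-1)^j f d_P. *)
Definition B2_0 (P M : cplx2 L) : lmodType k :=
  (homk (c0 P) (c0 M) * homk (c1 P) (c1 M))%type.
Definition B2_1 (P M : cplx2 L) : lmodType k :=
  (homk (c0 P) (c1 M) * homk (c1 P) (c0 M))%type.

Definition B2_d0 P M : {linear B2_0 P M -> B2_1 P M} :=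
  pair_map (hom_post _ (d0 M)) (opp_map (hom_pre _ (d0 P)))
           (opp_map (hom_pre _ (d1 P))) (hom_post _ (d1 M)).
Definition B2_d1 P M : {linear B2_1 P M -> B2_0 P M} :=
  pair_map (hom_post _ (d1 M)) (hom_pre _ (d0 P))
           (hom_pre _ (d1 P)) (hom_post _ (d0 M)).

Definition B2 (P M : cplx2 L) : cplx2 k.
Proof.
refine (@Cplx2 k (B2_0 P M) (B2_1 P M) (B2_d0 P M) (B2_d1 P M) _ _).
- move=> [f g]; apply: injective_projections; apply: homk_ext => x /=.
    by rewrite linearB (@d1d0 _ M) sub0r (@d1d0 _ P) linear0 oppr0 add0r addNr.
  by rewrite (@d0d1 _ P) linear0 subr0 linearD (@d0d1 _ M) addr0 linearN addrN.
- move=> [f g]; apply: injective_projections; apply: homk_ext => x /=.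
    by rewrite linearD (@d0d1 _ M) add0r (@d1d0 _ P) linear0 add0r addrN.
  by rewrite (@d0d1 _ P) linear0 addr0 linearD (@d1d0 _ M) addr0 addNr.
Defined.

Definition tensor_d0 (V : cplx2 k) (P : cplx2 L) :
    {linear (tensor (c0 V) (c0 P) * tensor (c1 V) (c1 P))%type ->
            (tensor (c0 V) (c1 P) * tensor (c1 V) (c0 P))%type} :=
  pair_map (tensor_map idfun (d0 P)) (tensor_map (d1 V) idfun)
           (tensor_map (d0 V) idfun) (opp_map (tensor_map idfun (d1 P))).
Definition tensor_d1 (V : cplx2 k) (P : cplx2 L) :
    {linear (tensor (c0 V) (c1 P) * tensor (c1 V) (c0 P))%type ->
            (tensor (c0 V) (c0 P) * tensor (c1 V) (c1 P))%type} :=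
  pair_map (tensor_map idfun (d1 P)) (tensor_map (d1 V) idfun)
           (tensor_map (d0 V) idfun) (opp_map (tensor_map idfun (d0 P))).

Lemma pure0l V P x : pure (0 : V) x = 0 :> @tensor k L V P.
Proof. by apply: (addrI (pure 0 x)); rewrite -pure_addl !addr0. Qed.
Lemma pure0r V P v : pure v (0 : P) = 0 :> @tensor k L V P.
Proof. by apply: (addrI (pure v 0)); rewrite -pure_addr !addr0. Qed.

Section TensorMapComp.
Variables (V V' V'' : lmodType k) (P P' P'' : lmodType L).

Lemma tensor_map_comp0r (f : {linear V -> V'}) (f' : {linear V' -> V''})
    (g : {linear P -> P'}) (g' : {linear P' -> P''}) :
  (forall x, g' (g x) = 0) -> forall t, tensor_map f' g' (tensor_map f g t) = 0.
Proof.
move=> gg; apply: (tensor_ext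
  (f := lin_of (comp_linear (tensor_map f' g') (tensor_map f g)))
  (g := zero_map _ _)) => v x.
by rewrite -[LHS]/(tensor_map f' g' (tensor_map f g _)) !tensor_mapE gg pure0r.
Qed.

Lemma tensor_map_comp0l (f : {linear V -> V'}) (f' : {linear V' -> V''})
    (g : {linear P -> P'}) (g' : {linear P' -> P''}) :
  (forall x, f' (f x) = 0) -> forall t, tensor_map f' g' (tensor_map f g t) = 0.
Proof.
move=> ff; apply: (tensor_ext
  (f := lin_of (comp_linear (tensor_map f' g') (tensor_map f g)))
  (g := zero_map _ _)) => v x.
by rewrite -[LHS]/(tensor_map f' g' (tensor_map f g _)) !tensor_mapE ff pure0l.
Qed.

Lemma tensor_map_swap (f : {linear V -> V'}) (g : {linear P -> P'}) t :
  tensor_map idfun g (tensor_map f idfun t) =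
  tensor_map f idfun (tensor_map idfun g t).
Proof.
apply: (tensor_ext
  (f := lin_of (comp_linear (tensor_map idfun g) (tensor_map f idfun)))
  (g := lin_of (comp_linear (tensor_map f idfun) (tensor_map idfun g)))) => v x.
rewrite -[LHS]/(tensor_map idfun g (tensor_map f idfun _)).
rewrite -[RHS]/(tensor_map f idfun (tensor_map idfun g _)).
by rewrite !tensor_mapE.
Qed.
End TensorMapComp.

(* V (x) P, with d(v (x) x) = dv (x) x + (-1)^|v| v (x) dx; the degree 0 part is
   V_0 (x) P_0 (+) V_1 (x) P_1, the degree 1 part V_0 (x) P_1 (+) V_1 (x) P_0. *)
Definition tensor2 (V : cplx2 k) (P : cplx2 L) : cplx2 L.
Proof.
refine (@Cplx2 L (tensor (c0 V) (c0 P) * tensor (c1 V) (c1 P))%type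
  (tensor (c0 V) (c1 P) * tensor (c1 V) (c0 P))%type
  (tensor_d0 V P) (tensor_d1 V P) _ _).
- apply: pair_map_comp0 => x.
  + by rewrite (tensor_map_comp0r _ _ (@d1d0 _ P)) add0r
      (tensor_map_comp0l _ _ (@d1d0 _ V)).
  + by rewrite opp_mapE linearN tensor_map_swap addrN.
  + by rewrite opp_mapE tensor_map_swap addrN.
  + by rewrite !opp_mapE linearN opprK (tensor_map_comp0l _ _ (@d0d1 _ V))
      add0r (tensor_map_comp0r _ _ (@d0d1 _ P)).
- apply: pair_map_comp0 => x.
  + by rewrite (tensor_map_comp0r _ _ (@d0d1 _ P)) add0r
      (tensor_map_comp0l _ _ (@d1d0 _ V)).
  + by rewrite opp_mapE linearN tensor_map_swap addrN.
  + by rewrite opp_mapE tensor_map_swap addrN.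
  + by rewrite !opp_mapE linearN opprK (tensor_map_comp0l _ _ (@d0d1 _ V))
      add0r (tensor_map_comp0r _ _ (@d1d0 _ P)).
Defined.

Lemma tensor_pure_ind (V : lmodType k) (P : lmodType L) (A : tensor V P -> Prop) :
  (forall v x, A (pure v x)) -> (forall t u, A t -> A u -> A (t + u)) ->
  forall t, A t.
Proof.
move=> Apure Aadd t; elim/tensor_pi_ind: t; elim=> [|[v x] s IH].
  by rewrite -[tensor_pi [::]]/(0 : tensor V P) -(pure0l V (0 : P)); exact: Apure.
by rewrite -cat1s tensor_pi_cat; apply: Aadd => //; exact: Apure.
Qed.

Lemma sum_linear (R : pzRingType) (U U' V : lmodType R)
    (f : {linear U -> V}) (f' : {linear U' -> V}) :
  linear (fun x : U * U' => f x.1 + f' x.2 : V).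
Proof. by move=> a x y; rewrite /= !linearP scalerDr addrACA. Qed.

Definition sum_map (R : pzRingType) (U U' V : lmodType R)
    (f : {linear U -> V}) (f' : {linear U' -> V}) : {linear (U * U')%type -> V} :=
  lin_of (sum_linear f f').

Lemma sum_pair_comm (U U' V V' W W' : lmodType L)
    (f : {linear U -> V}) (f' : {linear U' -> V})
    (g : {linear U -> V'}) (g' : {linear U' -> V'})
    (h : {linear V -> W}) (h' : {linear V' -> W})
    (e : {linear U -> W'}) (e' : {linear U' -> W'}) (d : {linear W' -> W}) :
  (forall x, h (f x) + h' (g x) = d (e x)) ->
  (forall x, h (f' x) + h' (g' x) = d (e' x)) ->
  forall z, sum_map h h' (pair_map f f' g g' z) = d (sum_map e e' z).
Proof.
by move=> h1 h2 [x y]; rewrite /= !linearD addrACA h1 h2.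
Qed.

Section Evaluation.
Variables (V : lmodType k) (P M : lmodType L) (r : {linear V -> homk P M}).

Lemma eval_subproof : bilinear_balanced (fun v x => (r v : homk P M) x).
Proof.
split=> [v v' x|v a x y|c v x]; first by rewrite linearD.
  by rewrite linearP.
by rewrite !linearZ.
Qed.

(* v (x) x |-> r(v)(x) *)
Definition eval : {linear tensor V P -> M} := tensor_lift eval_subproof.

Lemma evalE v x : eval (pure v x) = (r v : homk P M) x.
Proof. exact: tensor_lift_pure. Qed.
End Evaluation.

Section Twist.
Variables P M : cplx2 L.

Definition ev_00 : {linear tensor (B2_0 P M) (c0 P) -> c0 M} := eval fst.
Definition ev_11 : {linear tensor (B2_1 P M) (c1 P) -> c0 M} := eval snd.
Definition ev_01 : {linear tensor (B2_0 P M) (c1 P) -> c1 M} := eval snd.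
Definition ev_10 : {linear tensor (B2_1 P M) (c0 P) -> c1 M} := eval fst.

(* ev (phi (x) x) = phi x *)
Definition ev : cmap2 (tensor2 (B2 P M) P) M.
Proof.
refine (@CMap2 _ (tensor2 (B2 P M) P) M (sum_map ev_00 ev_11) (sum_map ev_01 ev_10) _ _).
- apply: sum_pair_comm; apply: tensor_pure_ind => [f x|t u IHt IHu].
  + by rewrite !tensor_mapE !evalE /= addrC subrK.
  + by rewrite !linearD addrACA IHt IHu.
  + by rewrite !opp_mapE linearN !tensor_mapE !evalE /= addrC addKr.
  + by rewrite !linearD addrACA IHt IHu.
- apply: sum_pair_comm; apply: tensor_pure_ind => [f x|t u IHt IHu].
  + by rewrite !tensor_mapE !evalE /= addrA addrN add0r.
  + by rewrite !linearD addrACA IHt IHu.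
  + by rewrite !opp_mapE linearN !tensor_mapE !evalE /= addrK.
  + by rewrite !linearD addrACA IHt IHu.
Defined.

Definition twist : cplx2 L := cone ev.
End Twist.

End SphericalTwist.

Section Hull.
Variables (k : fieldType) (Q : quiver).
Local Notation Lambda := (preprojective k Q).

Definition nilpotent (M : lmodType Lambda) : Prop :=
  exists N, forall (w : seq (arr (double_quiver Q))) (x : M), size w = N ->
    foldr (fun h y => preproj_arrow h *: y) x w = 0.

Definition rep_complex (X : cplx Lambda) : Prop :=
  bounded X /\ forall n, fin_dim (X n) /\ nilpotent (X n).

(* The objects of the smallest strictly full triangulated subcategory of
   K_2(Proj Lambda) that is closed under direct summands and contains
   Delta(p(X)) for all X in D^b(rep^n Lambda).  The terms of Delta(p(X)), of
   shifts and of cones are finitely generated projective; the other closure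
   rules require it. *)
Inductive in_hull : cplx2 Lambda -> Prop :=
| hull_orbit X P :
    rep_complex X -> projective_resolution P X -> in_hull (fold2 P)
| hull_iso X Y :
    in_hull X -> fg_projective2 Y -> homotopy_equiv X Y -> in_hull Y
| hull_shift X : in_hull X -> in_hull (shift2 X)
| hull_cone X Y (f : cmap2 X Y) : in_hull X -> in_hull Y -> in_hull (cone f)
| hull_summand X Y Z :
    in_hull X -> fg_projective2 Y -> fg_projective2 Z ->
    homotopy_equiv X (direct_sum2 Y Z) -> in_hull Y.

Record hull := Hull { hull_obj :> cplx2 Lambda; hullP : in_hull hull_obj }.

Definition simple (i : vert Q) : lmodType Lambda :=
  char_module (@preproj_char k Q i).

Lemma simple_scale i (a : Lambda) (x : simple i) :
  a *: x = (preproj_char i a * (x : k) : k).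
Proof. by []. Qed.

Lemma simple_fin_dim i : fin_dim (simple i).
Proof.
exists 1%N, (fun _ => (1 : k) : resk (simple i)) => x.
exists (fun _ => (x : k)); rewrite big_ord1.
rewrite -[RHS]/(((x : k)%:A : Lambda) *: ((1 : k) : simple i)) simple_scale mulr1.
pose e : {rmorphism path_algebra k (double_quiver Q) -> k} :=
  path_char (Q := double_quiver Q) i.
rewrite -[1 : Lambda]/(preproj_pi 1).
rewrite -[_ *: _]/(preproj_scale _ _) -preproj_piZ preproj_char_pi.
by rewrite /path_char /= mulr1.
Qed.

Lemma simple_nilpotent i : nilpotent (simple i).
Proof.
exists 1%N => -[|h [|//]] // x _ /=.
by rewrite simple_scale preproj_char_pi /path_char /= /path_delta_fun xpair_eqE andbF mul0r.
Qed.

Lemma zero_fin_dim : fin_dim ('rV[Lambda]_0 : lmodType Lambda).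
Proof.
by exists 0%N, (fun _ => 0) => x; exists (fun _ => 0); rewrite big_ord0;
  apply: thinmx0.
Qed.

Lemma zero_nilpotent : nilpotent ('rV[Lambda]_0 : lmodType Lambda).
Proof. by exists 0%N => w x _; apply: thinmx0. Qed.

Lemma simple_rep_complex i : rep_complex (stalk (simple i)).
Proof.
split=> [|n].
  exists 0%N => n; rewrite /= /stalk_obj; case: eqP => [->//|_ _ x].
  exact: thinmx0.
rewrite /= /stalk_obj; case: eqP => _.
  by split; [exact: simple_fin_dim|exact: simple_nilpotent].
by split; [exact: zero_fin_dim|exact: zero_nilpotent].
Qed.

(* S_i as an object of the hull, computed with the resolution P. *)
Definition simple_hull i P (hP : projective_resolution P (stalk (simple i))) :
    hull :=
  Hull (hull_orbit (simple_rep_complex i) hP).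

(* J M, for J the ideal generated by the arrows; J is also the right ideal
   generated by the arrows. *)
Definition in_arrow_radical (M : lmodType Lambda) (x : M) : Prop :=
  exists y : arr (double_quiver Q) -> M, x = \sum_h preproj_arrow h *: y h.

(* Minimality refers to the ideal generated by the arrows: Lambda is graded but
   not complete, and that ideal need not be its Jacobson radical. *)
Definition minimal_resolution (P : cplx Lambda) (i : vert Q) : Prop :=
  [/\ projective_resolution P (stalk (simple i)),
      forall n : int, 0 < n -> forall x : P n, x = 0 &
      forall n (x : P n), in_arrow_radical (cdiff P n (n + 1) x)].

(* The Grothendieck group: formal sums of signed objects, modulo the relations
   of an abelian group and [Y] = [X] + [Z] for every distinguished triangle
   X -> Y -> Z -> X[1].  It is given as a type with explicit operations, because
   the universe of modules over Lambda is too large for zmodType. *)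
Definition formal_sum := seq (bool * hull).

Inductive K0_eq : formal_sum -> formal_sum -> Prop :=
| K0_refl s : K0_eq s s
| K0_sym s t : K0_eq s t -> K0_eq t s
| K0_trans s t u : K0_eq s t -> K0_eq t u -> K0_eq s u
| K0_cat s s' t t' : K0_eq s s' -> K0_eq t t' -> K0_eq (s ++ t) (s' ++ t')
| K0_comm s t : K0_eq (s ++ t) (t ++ s)
| K0_cancel b X : K0_eq [:: (b, X); (~~ b, X)] [::]
| K0_triangle (X Y Z : hull) (f : cmap2 X Y) :
    homotopy_equiv Z (cone f) ->
    K0_eq [:: (true, Y)] [:: (true, X); (true, Z)].

Definition K0 : Type :=
  {C : formal_sum -> Prop | exists s, C = K0_eq s}.

Definition K0_pi (s : formal_sum) : K0 := exist _ (K0_eq s) (ex_intro _ s erefl).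
Definition K0_class (X : hull) : K0 := K0_pi [:: (true, X)].

Definition K0_repr (x : K0) : formal_sum := projT1 (cid (svalP x)).
Definition K0_add (x y : K0) : K0 := K0_pi (K0_repr x ++ K0_repr y).

Lemma K0_reprK x : K0_pi (K0_repr x) = x.
Proof.
rewrite /K0_repr; case: cid => s /= xs; case: x xs => C CP /= xs.
by subst C; exact: eq_exist.
Qed.

Lemma K0_piE s t : K0_pi s = K0_pi t <-> K0_eq s t.
Proof.
split=> [[st]|st].
  have : K0_eq t t by exact: K0_refl.
  by rewrite -st.
have h : K0_eq s = K0_eq t.
  apply/funext => u; apply/propext; split=> h; last exact: K0_trans h.
  by apply: K0_trans h; exact: K0_sym.
exact: eq_exist.
Qed.

Lemma K0_addE s t : K0_add (K0_pi s) (K0_pi t) = K0_pi (s ++ t).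
Proof.
by apply/K0_piE/K0_cat; apply/K0_piE; rewrite K0_reprK.
Qed.

(* The terms of B_2(P, M) are infinite dimensional in general, so the terms of
   twist P M are projective but not finitely generated.  The object of the hull
   that it defines is any N in the hull homotopy equivalent to it. *)
Definition induced_by_twist (P : cplx Lambda) (T : K0 -> K0) : Prop :=
  {morph T : x y / K0_add x y} /\
  forall M N : hull, homotopy_equiv N (twist (fold2 P) M) ->
    T (K0_class M) = K0_class N.

End Hull.

Section RootLattice.
Variables (k : fieldType) (Q : quiver).
Local Notation A := (path_algebra k Q).

Definition root_lattice := {ffun vert Q -> int}.
Definition simple_root (i : vert Q) : root_lattice := [ffun j => (j == i)%:R].

(* v is the class of M in K_0(mod A) = ZQ_0, of coordinates dim e_j M. *)
Definition dim_vector (M : lmodType A) (v : root_lattice) : Prop :=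
  forall j, exists2 n : nat, v j = n%:Z &
    subquot_dim (V := resk M) (fun x : M => path_vertex j *: x = x)
      (fun x => x = 0) n.

(* dim Hom_{D^b(A)}(M, N[i]) = n, for P a projective resolution of M: the
   morphisms are the maps of complexes P -> N[i] modulo homotopy. *)
Definition derived_hom_dim (P : cplx A) (N : lmodType A) (i : int) (n : nat) : Prop :=
  subquot_dim (V := homk (P (- i)) N)
    (fun f => forall x, f (cdiff P (- i - 1) (- i) x) = 0)
    (fun f => exists g : homk (P (- i + 1)) N,
       forall x, f x = g (cdiff P (- i) (- i + 1) x)) n.

Definition euler_form (B : root_lattice -> root_lattice -> int) : Prop :=
  [/\ forall u v w, B (u + v) w = B u w + B v w,
      forall u v w, B u (v + w) = B u v + B u w &
      (* The sum is over the degrees j - b, from -b to b. *)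
      forall (M N : lmodType A) (u v : root_lattice) (P : cplx A) (b : nat)
             (e : int -> nat),
        fin_dim M -> fin_dim N -> dim_vector M u -> dim_vector N v ->
        projective_resolution P (stalk M) -> vanishes_beyond b P ->
        (forall i, derived_hom_dim P N i (e i)) ->
        B u v = \sum_(j < b.*2.+1) (-1) ^+ (j + b) * (e (j%:Z - b%:Z))%:Z].

Definition symmetric_form (B : root_lattice -> root_lattice -> int) u v : int :=
  B u v + B v u.

Definition simple_reflection (B : root_lattice -> root_lattice -> int)
    (i : vert Q) (u : root_lattice) : root_lattice :=
  u - simple_root i *~ symmetric_form B u (simple_root i).

End RootLattice.

(* Main.v *)
(* As Q is not Dynkin, there is a nonzero delta : Q_0 -> nat with 2 delta <= A delta,
   A the adjacency matrix.  A nonzero element of Lambda killed on the right by all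
   arrows would make Lambda finite dimensional, and the dimensions G_j of the
   Lambda e_j would satisfy A G < 2 G; pairing with delta, this is absurd.  Hence
     0 -> Lambda e_j -> (+)_(b : j -> r) Lambda e_r -> Lambda e_j -> S_j -> 0,
   the sum being over the arrows b of the double quiver, is exact on the left as
   well, and B_2(P_(S_i), P_(S_j)) has cohomology of dimension 2 [i = j] in degree
   0 and #{arrows i -> j of the double quiver} in degree 1; the difference of the
   two is (alpha_j, alpha_i).  Over k the complex B_2 is homotopy equivalent to its
   cohomology, which turns the cone of ev into a cone between objects of the hull:
   [T S_j] = [S_j] - (alpha_j, alpha_i) [S_i].  The classes [S_j] span K_0. *)

From HB Require Import structures.
From mathcomp Require Import all_boot all_order all_algebra.
From mathcomp Require Import zify.
From mathcomp Require Import boolp classical_sets functions.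
Require Import Defs.

Set Implicit Arguments.
Unset Strict Implicit.
Unset Printing Implicit Defensive.

(** * Graphs without subadditive functions *)

(** The function delta is obtained by contraposition: a connected graph on which 2 delta <= A delta
    forces delta = 0 contains no extended Dynkin diagram, and a longest simple path with what hangs
    on it then has type A, D or E. Finite dimensionality rests on a duality: a homogeneous x0 = x0
    e_l of least degree N killed by all arrows realises every functional on paths of length p out of
    l as left multiplication by an element of degree N - p with values in k x0, so paths of length N
    + 1 vanish. The resolution P of the statement is an arbitrary minimal one, whereas dimensions
    are computed with an explicit three-term complex; both are compared through the simple module
    they resolve, since every map from either folded complex to an acyclic one is nullhomotopic. As
    the terms of B_2 may be infinite dimensional, splitting off its cohomology takes complements
    given by Zorn's lemma. The splitting is normalised so that its homotopy kills the chosen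
    representatives: otherwise replacing B_2 inside the cone would need a homotopy between
    homotopies. *)

Definition weight_adj (V : Type) (a : V -> V -> nat) : rel V :=
  fun x y => a x y != 0%N.

(* The hypotheses on vertices slow lia down considerably. *)
Ltac index_lia :=
  repeat match goal with
  | H : forall _, _ |- _ => clear H
  | H : is_true (_ \in _) |- _ => clear H
  | H : is_true (_ \notin _) |- _ => clear H
  | H : is_true (weight_adj _ _ _) |- _ => clear H
  | H : is_true (uniq _) |- _ => clear H
  | x := _ : nat -> nat |- _ => clear x
  end; lia.

Section DynkinClassification.
Local Open Scope nat_scope.
Variables (V : finType) (a : V -> V -> nat) (x0 : V).
Hypotheses (a_sym : forall x y, a x y = a y x) (a_irr : forall x, a x x = 0).
Local Notation e := (weight_adj a).
Hypothesis a_conn : forall x y, connect e x y.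
Hypothesis no_subadditive : forall delta : V -> nat,
  (forall v, 2 * delta v <= \sum_u a v u * delta u) -> forall v, delta v = 0.

Let e_sym x y : e x y = e y x. Proof. by rewrite /weight_adj a_sym. Qed.

(** Weights extended by zero outside [q] stay subadditive: the inequality is trivial where the
    weight is zero, and further edges or multiplicities only enlarge its right-hand side. So [ns]
    may list just some neighbours, and extended Dynkin diagrams need not be induced subgraphs. *)
Lemma no_weighted_subgraph (q : seq V) (phi : nat -> nat) : uniq q ->
  (forall t, t < size q -> 0 < phi t -> exists ns : seq nat,
     [/\ uniq ns, forall u, u \in ns -> u < size q /\ e (nth x0 q t) (nth x0 q u) &
         2 * phi t <= sumn [seq phi u | u <- ns]]) ->
  forall t, t < size q -> phi t = 0.
Proof.
move=> uq h t tq; pose delta v := if v \in q then phi (index v q) else 0.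
suff /no_subadditive/(_ (nth x0 q t)) : forall v, 2 * delta v <= \sum_u a v u * delta u.
  by rewrite /delta mem_nth // index_uniq.
move=> v; case: (posnP (delta v)) => [->//|]; rewrite {1 2}/delta.
case: ifP => // vq phi_gt0; have iq : index v q < size q by rewrite index_mem.
have [ns [uns nsq le_phi]] := h _ iq phi_gt0.
apply: leq_trans le_phi _; rewrite sumnE big_map.
have -> : \sum_(u <- ns) phi u = \sum_(x <- [seq nth x0 q u | u <- ns]) delta x.
  rewrite big_map big_seq [RHS]big_seq; apply: eq_bigr => u /nsq[uq' _].
  by rewrite /delta mem_nth // index_uniq.
set l := map _ _; have ul : uniq l.
  rewrite map_inj_in_uniq // => u u' /nsq[hu _] /nsq[hu' _] /eqP.
  by rewrite nth_uniq // => /eqP.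
rewrite [leqRHS](bigID (mem l)) /=; apply: leq_trans (leq_addr _ _).
have /(perm_big _)/= -> : perm_eq l [seq u <- index_enum V | u \in l].
  apply: uniq_perm => //; first by rewrite filter_uniq // index_enum_uniq.
  by move=> u; rewrite mem_filter mem_index_enum andbT.
rewrite big_filter; apply: leq_sum => u /mapP[u' /nsq[_]].
by rewrite nth_index // => h' ->; rewrite leq_pmull // lt0n.
Qed.

(** Two parallel edges form the extended diagram of type A_1, with weights 1 and 1. *)
Let no_double x y : a x y <= 1.
Proof.
rewrite leqNgt; apply/negP => axy.
have xy : x != y by apply: contraTneq axy => ->; rewrite a_irr.
pose delta v := (v == x) + (v == y) : nat.
suff /no_subadditive/(_ x) : forall v, 2 * delta v <= \sum_u a v u * delta u.
  by rewrite /delta eqxx.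
move=> v; rewrite /delta; have [->|vx] := eqVneq v x.
  rewrite (negPf xy) (bigD1 y) //= eqxx eq_sym (negPf xy) addn0.
  by apply: leq_trans (leq_addr _ _); rewrite !muln1.
have [->|vy] := eqVneq v y; last by [].
rewrite (bigD1 x) //= eqxx (negPf xy); apply: leq_trans (leq_addr _ _).
by rewrite a_sym !muln1.
Qed.

Let boundary (q : seq V) u v : u \in q -> v \notin q ->
  exists x y, [/\ x \in q, y \notin q & e x y].
Proof.
move=> uq vq; have /connectP[p] := a_conn u v.
elim: p u uq => [|w p IH] u uq /=; first by move=> _ vE; rewrite vE uq in vq.
move=> /andP[euw ep] vE; have [wq|wq] := boolP (w \in q); first exact: IH ep vE.
by exists u, w.
Qed.

Definition simple_path (s : seq V) : bool := sorted e s && uniq s.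

(** * Longest simple paths *)

Section LongestPath.
Variable s : seq V.
Hypothesis s_path : simple_path s.
Hypothesis s_max : forall t, simple_path t -> size t <= size s.
Local Notation "s_[ t ]" := (nth x0 s t) (at level 2, format "s_[ t ]").

Let s_uniq : uniq s. Proof. by case/andP: s_path. Qed.

Let s_edge t : t.+1 < size s -> e s_[t] s_[t.+1].
Proof.
case/andP: s_path => se _ ht.
by move: se => /(sortedP x0) /(_ t ht).
Qed.

Let s_edge' t : t.+1 < size s -> e s_[t.+1] s_[t].
Proof. by move=> h; rewrite e_sym; exact: s_edge. Qed.

(** A chord closes a cycle, on which the constant weight 1 is additive: the extended diagram of type
    A. *)
Let s_nochord b c : b.+1 < c -> c < size s -> ~~ e s_[b] s_[c].
Proof.
move=> bc cs; apply/negP => ebc.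
suff /(_ b (ltn_trans (ltnW bc) cs)) : forall t, t < size s -> (b <= t <= c) = 0 :> nat.
  by rewrite leqnn (ltnW (ltnW bc)).
apply: no_weighted_subgraph => // t ts.
case: (boolP (b <= t <= c)) => // /andP[bt tc] _.
have [tb|tb] := eqVneq t b.
  exists [:: b.+1; c]; split; rewrite /= ?inE ?andbT; first by index_lia.
    by move=> u; rewrite !inE => /orP[]/eqP->; subst t; split=> //; [index_lia|apply: s_edge; index_lia].
  by rewrite leqnSn leqnn /=; index_lia.
have [tc'|tc'] := eqVneq t c.
  exists [:: b; c.-1]; split; rewrite /= ?inE ?andbT; first by index_lia.
    move=> u; rewrite !inE => /orP[]/eqP->; subst t; split=> //; [index_lia|by rewrite e_sym|index_lia|].
    by have := @s_edge' c.-1; rewrite prednK; [apply; index_lia|index_lia].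
  by rewrite leqnn /=; index_lia.
exists [:: t.-1; t.+1]; split; rewrite /= ?inE ?andbT; first by index_lia.
  move=> u; rewrite !inE => /orP[]/eqP->; split; [index_lia| |index_lia|apply: s_edge; index_lia].
  by have := @s_edge' t.-1; rewrite prednK; [apply; index_lia|index_lia].
by index_lia.
Qed.

Lemma path_adjacency b c : b < size s -> c < size s -> a s_[b] s_[c] = (b.+1 == c) || (c.+1 == b).
Proof.
move=> bs cs; have := no_double s_[b] s_[c].
suff : e s_[b] s_[c] = (b.+1 == c) || (c.+1 == b).
  by rewrite /weight_adj; case: (a _ _) => [|[]] //= <-.
have [bc|bc|->] := ltngtP b c; last by rewrite /weight_adj a_irr; index_lia.
- have [<-|h] := eqVneq b.+1 c; first by rewrite s_edge // ; index_lia.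
  rewrite (negPf (s_nochord _ cs)) //; last by index_lia.
  by symmetry; apply/negbTE; index_lia.
- have [<-|h] := eqVneq c.+1 b; first by rewrite s_edge' ?orbT //; index_lia.
  rewrite e_sym (negPf (s_nochord _ bs)) //; last by index_lia.
  by symmetry; apply/negbTE; index_lia.
Qed.

Lemma dynkin_A_of_path : 0 < size s -> (forall v, v \in s) ->
  exists n (e' : rel nat) (f : V -> 'I_n),
    [/\ dynkin_diagram n e', bijective f & forall i j, a i j = e' (f i) (f j)].
Proof.
move=> s_gt0 sV; have h v : index v s < size s by rewrite index_mem.
exists (size s), (symrel (fun a b => a.+1 == b)), (fun v => Ordinal (h v)); split.
- exact: Dynkin_A.
- exists (fun i : 'I_(size s) => nth x0 s i) => [v|i]; first by rewrite /= nth_index.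
  by apply: val_inj; rewrite /= index_uniq.
- move=> i j; rewrite -{1}(nth_index x0 (sV i)) -{1}(nth_index x0 (sV j)).
  by rewrite path_adjacency.
Qed.

(** Two attachments of [w] close a cycle through [w], which has the last position in [rcons s w]. *)
Let s_ncycle w b c : w \notin s -> b < c -> c < size s -> e s_[b] w -> ~~ e s_[c] w.
Proof.
move=> ws bc cs ebw; apply/negP => ecw; pose q := rcons s w.
have qs t : t < size s -> nth x0 q t = s_[t] by move=> h; rewrite nth_rcons h.
have qw : nth x0 q (size s) = w by rewrite nth_rcons ltnn eqxx.
have sq : size q = (size s).+1 by rewrite size_rcons.
suff : forall t, t < size q -> ((b <= t <= c) || (t == size s)) = 0 :> nat.
  by move=> /(_ (size s)); rewrite sq eqxx orbT => /(_ (leqnn _)).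
apply: no_weighted_subgraph; first by rewrite /q rcons_uniq ws.
rewrite sq => t ts; rewrite lt0b => ht.
have [tL|tL] := eqVneq t (size s).
  exists [:: b; c]; rewrite tL qw; split; rewrite /= ?inE ?andbT; first by index_lia.
    move=> u; rewrite !inE => /orP[]/eqP->; rewrite qs; try index_lia;
      by split; [index_lia|rewrite e_sym].
  by index_lia.
have {}ht : b <= t <= c by index_lia.
have {tL}ts : t < size s by index_lia.
have [tb|tb] := eqVneq t b.
  exists [:: b.+1; size s]; rewrite qs //; split; rewrite /= ?inE ?andbT; first by index_lia.
    move=> u; rewrite !inE => /orP[]/eqP->; subst t; rewrite ?qw ?qs; try index_lia;
      split=> //; by [index_lia|apply: s_edge; index_lia].
  by rewrite eqxx orbT leqnSn bc; index_lia.
have [tc|tc] := eqVneq t c.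
  exists [:: c.-1; size s]; rewrite qs //; split; rewrite /= ?inE ?andbT; first by index_lia.
    move=> u; rewrite !inE => /orP[]/eqP->; subst t; rewrite ?qw ?qs; try index_lia;
      split=> //; first by index_lia.
    by have := @s_edge' c.-1; rewrite prednK; [apply; index_lia|index_lia].
  by rewrite eqxx orbT; index_lia.
exists [:: t.-1; t.+1]; rewrite qs //; split; rewrite /= ?inE ?andbT; first by index_lia.
  move=> u; rewrite !inE => /orP[]/eqP->; rewrite qs; try index_lia; split; try index_lia.
    by have := @s_edge' t.-1; rewrite prednK; [apply; index_lia|index_lia].
  by apply: s_edge; index_lia.
by index_lia.
Qed.

Lemma path_neighbour_unique w b c : w \notin s -> b < size s -> c < size s ->
  e s_[b] w -> e s_[c] w -> b = c.
Proof.
move=> ws bs cs eb ec; have [bc|cb|//] := ltngtP b c.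
  by have := s_ncycle ws bc cs eb; rewrite ec.
by have := s_ncycle ws cb bs ec; rewrite eb.
Qed.

(** Replacing the m vertices before [s_[m]] by [r] yields a simple path, which cannot be longer than
    [s]. Applied to [rev s], the bound controls the other side of [s_[m]]. *)
Lemma arm_size r m : m < size s -> sorted e (rcons r s_[m]) -> uniq r ->
  (forall v, v \in r -> v \notin s) -> size r <= m.
Proof.
move=> ms re ru rs; have : simple_path (r ++ drop m s).
  rewrite /simple_path (drop_nth x0) // sorted_cat_cons re /=.
  rewrite -(drop_nth x0) // cat_uniq ru drop_uniq // andbT.
  apply/andP; split.
    case/andP: s_path => se _; have := drop_sorted m se.
    by rewrite (drop_nth x0).
  apply/hasPn => v /mem_drop vs; apply/negP => /rs; by rewrite vs.
by move=> /s_max; rewrite size_cat size_drop; index_lia.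
Qed.

Lemma simple_path_rev : simple_path (rev s).
Proof.
rewrite /simple_path rev_uniq s_uniq andbT rev_sorted.
by case/andP: s_path => se _; rewrite (eq_sorted (e' := e)).
Qed.

End LongestPath.

(** For explicit [wt] and [edges] the subadditivity condition is a closed boolean that evaluates;
    what remains for each diagram is that its vertices are distinct and its edges present. *)
Lemma finite_subgraph (q : seq V) (wt : seq nat) (edges : seq (nat * nat)) :
  uniq q -> (forall p, p \in edges -> e (nth x0 q p.1) (nth x0 q p.2)) ->
  all (fun p => (p.1 < size q) && (p.2 < size q)) edges ->
  all (fun t => 2 * nth 0 wt t <=
     sumn [seq nth 0 wt u | u <- iota 0 (size q) &
            ((t, u) \in edges) || ((u, t) \in edges)]) (iota 0 (size q)) ->
  0 < size q -> nth 0 wt 0 != 0 -> False.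
Proof.
move=> uq eE szE /allP chk q0 /eqP; apply.
apply: (no_weighted_subgraph (phi := nth 0 wt)) uq _ _ q0 => t tq _.
exists [seq u <- iota 0 (size q) | ((t, u) \in edges) || ((u, t) \in edges)]; split.
- by rewrite filter_uniq // iota_uniq.
- move=> u; rewrite mem_filter mem_iota => /andP[/orP[] h uq']; split=> //.
    exact: eE h.
  by rewrite e_sym; exact: eE h.
- by apply: chk; rewrite mem_iota.
Qed.

(** * Vertices attached to a longest path *)

Section Branch.
Variable s : seq V.
Hypotheses (s_path : simple_path s).
Hypothesis s_max : forall t, simple_path t -> size t <= size s.
Local Notation "s_[ t ]" := (nth x0 s t) (at level 2, format "s_[ t ]").

Let s_uniq : uniq s. Proof. by case/andP: s_path. Qed.

Let r_max t : simple_path t -> size t <= size (rev s).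
Proof. by rewrite size_rev; exact: s_max. Qed.

Let s_edge t : t.+1 < size s -> e s_[t] s_[t.+1].
Proof.
case/andP: s_path => se _ ht.
by move: se => /(sortedP x0) /(_ t ht).
Qed.

Let arm1 w m : w \notin s -> m < size s -> e s_[m] w -> 0 < m /\ m.+1 < size s.
Proof.
move=> ws ms ew; split.
  apply: (@arm_size s s_path s_max [:: w] m) => //=; first by rewrite e_sym ew.
  by move=> v; rewrite inE => /eqP->.
have : 0 < size s - m.+1; last by index_lia.
apply: (@arm_size (rev s) (simple_path_rev s_path) r_max [:: w]) => //=.
- by rewrite size_rev; index_lia.
- rewrite nth_rev; last by index_lia.
  have -> : size s - (size s - m.+1).+1 = m by index_lia.
  by rewrite andbT e_sym.
- by move=> v; rewrite inE mem_rev => /eqP->.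
Qed.

Let arm2 w w' m : w \notin s -> w' \notin s -> w' != w -> m < size s ->
  e s_[m] w -> e w w' -> 1 < m /\ m.+2 < size s.
Proof.
move=> ws ws' ww ms ew ew'; have h v : v \in [:: w'; w] -> v \notin s.
  by rewrite !inE => /orP[]/eqP->.
split.
  apply: (@arm_size s s_path s_max [:: w'; w] m) => //=.
    by rewrite (e_sym w' w) (e_sym w s_[m]) ew ew'.
  by rewrite inE ww.
have : 1 < size s - m.+1; last by index_lia.
apply: (@arm_size (rev s) (simple_path_rev s_path) r_max [:: w'; w]) => //=.
- by rewrite size_rev; index_lia.
- rewrite nth_rev; last by index_lia.
  have -> : size s - (size s - m.+1).+1 = m by index_lia.
  by rewrite andbT (e_sym w' w) (e_sym w s_[m]) ew ew'.
- by rewrite inE ww.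
- by move=> v /h; rewrite mem_rev.
Qed.

Let uniq_branch p b cs r : uniq (s ++ r) -> all (fun c => c <= b) cs ->
  b + p < size s -> uniq cs -> uniq ([seq s_[c + p] | c <- cs] ++ r).
Proof.
move=> usr /allP csb bp ucs; have csp c : c \in cs -> c + p < size s.
  by move=> /csb h; apply: leq_ltn_trans bp; rewrite leq_add2r.
move: usr; rewrite !cat_uniq => /and3P[_ sr ->]; rewrite andbT.
rewrite map_inj_in_uniq ?ucs => [|c c' /csp hc /csp hc' /eqP]; last first.
  by rewrite nth_uniq // eqn_add2r => /eqP.
apply: contra sr => /hasP[x xr /= /mapP[c /csp hc xE]]; apply/hasP; exists x => //=.
by rewrite xE mem_nth.
Qed.

Section Vertex.
Variables (w : V) (m : nat).
Hypotheses (w_out : w \notin s) (ms : m < size s) (e_w : e s_[m] w).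

Let uniq_w : uniq (s ++ [:: w]).
Proof. by rewrite cat_uniq s_uniq /= orbF w_out. Qed.

Let uniq_ww w' : w' \notin s -> w' != w -> uniq (s ++ [:: w; w']).
Proof.
by move=> w's w'w; rewrite cat_uniq s_uniq /= (negPf w_out) (negPf w's) inE eq_sym w'w.
Qed.

(** By maximality of [s], both sides of [s_[m]] are at least as long as an arm [w], [w']. Three arms
    of length two form the extended diagram of type E_6, with weight 3 at the centre. *)
Lemma branch_vertex_leaf w' : w' \notin s -> w' != w -> ~~ e w w'.
Proof.
move=> w's w'w; apply/negP => ew'.
have [] := arm2 w_out w's w'w ms e_w ew'.
case: m ms e_w => [|[|p]] // ps epw _ pL.
apply: (@finite_subgraph [:: s_[p.+2]; s_[p.+1]; s_[p.+3]; s_[p]; s_[p.+4]; w; w']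
  [:: 3; 2; 2; 1; 1; 2; 1] [:: (1, 0); (0, 2); (3, 1); (2, 4); (0, 5); (5, 6)]) => //.
  exact: (@uniq_branch p 4 [:: 2; 1; 3; 0; 4]) (uniq_ww _ _) _ _ _.
by move=> u; rewrite !inE => /or4P[| | |/or3P[]] /eqP-> //=; apply: s_edge; index_lia.
Qed.

(** Four neighbours of one vertex form the extended diagram of type D_4. *)
Lemma branch_degree w' : w' \notin s -> w' != w -> ~~ e s_[m] w'.
Proof.
move=> w's w'w; apply/negP => ew'.
have [m0 mL] := arm1 w_out ms e_w.
case: m ms e_w ew' m0 mL => [|p] // _ epw epw' _ pL.
apply: (@finite_subgraph [:: s_[p.+1]; s_[p]; s_[p.+2]; w; w']
  [:: 2; 1; 1; 1; 1] [:: (1, 0); (0, 2); (0, 3); (0, 4)]) => //.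
  exact: (@uniq_branch p 2 [:: 1; 0; 2]) (uniq_ww _ _) _ _ _.
by move=> u; rewrite !inE => /or4P[]/eqP-> //=; apply: s_edge; index_lia.
Qed.

(** The extended diagram of type E_7: two arms of length three, the leaf [w], and weight 4 at the
    centre. *)
Lemma branch_exceptional_E7 : 2 < m -> m.+3 < size s -> False.
Proof.
case: m ms e_w => [|[|[|p]]] // _ ep _ pL.
apply: (@finite_subgraph [:: s_[p.+3]; s_[p.+2]; s_[p.+1]; s_[p]; s_[p.+4];
    s_[p.+4.+1]; s_[p.+4.+2]; w] [:: 4; 3; 2; 1; 3; 2; 1; 2]
  [:: (1, 0); (2, 1); (3, 2); (0, 4); (4, 5); (5, 6); (0, 7)]) => //.
  exact: (@uniq_branch p 6 [:: 3; 2; 1; 0; 4; 5; 6]) uniq_w _ _ _.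
by move=> u; rewrite !inE => /or4P[| | |/or4P[]] /eqP-> //=; apply: s_edge; index_lia.
Qed.

(** The extended diagram of type E_8: arms of lengths two, five and one, and weight 6 at the
    centre. *)
Lemma branch_exceptional_E8 : m = 2 -> 7 < size s -> False.
Proof.
move=> m2 sL; move: e_w; rewrite m2 => e2w.
apply: (@finite_subgraph [:: s_[2]; s_[1]; s_[0]; s_[3]; s_[4]; s_[5]; s_[6];
    s_[7]; w] [:: 6; 4; 2; 5; 4; 3; 2; 1; 3]
  [:: (1, 0); (2, 1); (0, 3); (3, 4); (4, 5); (5, 6); (6, 7); (0, 8)]) => //.
  exact: (@uniq_branch 0 7 [:: 2; 1; 0; 3; 4; 5; 6; 7]) uniq_w _ _ _.
by move=> u; rewrite !inE => /or4P[| | |/or4P[| | |/orP[]]] /eqP-> //=; apply: s_edge; index_lia.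
Qed.
End Vertex.

(** Two branch vertices give an extended diagram of type D: weight 2 on the segment from m to m',
    weight 1 on its four outer neighbours, of which [w] and [w'] have positions L and L + 1 in
    [q]. *)
Let branch_vertex_lt w m w' m' : w \notin s -> w' \notin s -> w' != w ->
  m < m' -> m' < size s -> e s_[m] w -> e s_[m'] w' -> False.
Proof.
move=> ws w's w'w mm' ms' ew ew'; have ms := ltn_trans mm' ms'.
have [m0 mL] := arm1 ws ms ew; have [m0' mL'] := arm1 w's ms' ew'.
pose q := s ++ [:: w; w']; pose L := size s.
have qs t : t < L -> nth x0 q t = s_[t] by move=> h; rewrite nth_cat h.
have qw : nth x0 q L = w by rewrite nth_cat ltnn subnn.
have qw' : nth x0 q L.+1 = w' by rewrite nth_cat ltnNge leqnSn subSnn.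
have qL : size q = L.+2 by rewrite size_cat addn2.
have s_edge' t : t.+1 < L -> e s_[t.+1] s_[t] by move=> h; rewrite e_sym s_edge.
pose phi t := if m <= t <= m' then 2 else
  ((t == m.-1) || (t == m'.+1) || (t == L) || (t == L.+1) : nat).
suff : forall t, t < size q -> phi t = 0.
  move=> /(_ m); rewrite qL /phi leqnn (ltnW mm') /= => h.
  by have : 2 = 0 by apply: h; rewrite /L; index_lia.
apply: no_weighted_subgraph.
  by rewrite cat_uniq s_uniq /= (negPf ws) (negPf w's) inE eq_sym w'w.
rewrite qL => t tL phit.
have one u : u < size q -> e (nth x0 q t) (nth x0 q u) -> phi t = 1 -> phi u = 2 ->
  exists ns : seq nat, [/\ uniq ns,
    forall u', u' \in ns -> u' < L.+2 /\ e (nth x0 q t) (nth x0 q u') &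
    2 * phi t <= sumn [seq phi u' | u' <- ns]].
  move=> us eu h1 h2; exists [:: u]; rewrite /= h1 h2; split=> // u'.
  by rewrite inE => /eqP->; rewrite -qL.
have phi1 u : ~~ (m <= u <= m') ->
    (u == m.-1) || (u == m'.+1) || (u == L) || (u == L.+1) -> phi u = 1.
  by rewrite /phi => /negPf-> ->.
have phi2 u : m <= u <= m' -> phi u = 2 by rewrite /phi => ->.
have [tm|tm] := eqVneq t m.-1.
  apply: (one m); [index_lia| |apply: phi1; index_lia|apply: phi2; index_lia].
  rewrite !qs; try (rewrite /L; index_lia).
  by have := @s_edge t; rewrite tm prednK //; apply; rewrite /L; index_lia.
have [tm'|tm'] := eqVneq t m'.+1.
  apply: (one m'); [index_lia| |apply: phi1; index_lia|apply: phi2; index_lia].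
  by rewrite tm' !qs ?s_edge' //; rewrite /L; index_lia.
have [tw|tw] := eqVneq t L.
  apply: (one m); [index_lia| |apply: phi1; index_lia|apply: phi2; index_lia].
  by rewrite tw qw qs // e_sym.
have [tw'|tw'] := eqVneq t L.+1.
  apply: (one m'); [index_lia| |apply: phi1; index_lia|apply: phi2; index_lia].
  by rewrite tw' qw' qs // e_sym.
have ht : m <= t <= m' by move: phit; rewrite /phi; case: ifP => //; index_lia.
have {tL}tL : t < L by index_lia.
have [tm1|tm1] := eqVneq t m.
  subst t; exists [:: m.+1; m.-1; L]; split; rewrite /= ?inE ?andbT; first by index_lia.
    move=> u; rewrite !inE => /or3P[]/eqP->; rewrite ?qw ?qs; try (rewrite /L; index_lia);
      split=> //; try (rewrite /L; index_lia); first by apply: s_edge; rewrite /L; index_lia.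
    by have := @s_edge' m.-1; rewrite prednK //; apply; rewrite /L; index_lia.
  by rewrite (phi2 m) ?(phi2 m.+1) ?(phi1 m.-1) ?(phi1 L); index_lia.
have [tm1'|tm1'] := eqVneq t m'.
  subst t; exists [:: m'.-1; m'.+1; L.+1]; split; rewrite /= ?inE ?andbT; first by index_lia.
    move=> u; rewrite !inE => /or3P[]/eqP->; rewrite ?qw' ?qs; try (rewrite /L; index_lia);
      split=> //; try (rewrite /L; index_lia); last by apply: s_edge; rewrite /L; index_lia.
    by have := @s_edge' m'.-1; rewrite prednK //; apply; rewrite /L; index_lia.
  by rewrite (phi2 m') ?(phi2 m'.-1) ?(phi1 m'.+1) ?(phi1 L.+1); index_lia.
exists [:: t.-1; t.+1]; split; rewrite /= ?inE ?andbT; first by index_lia.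
  move=> u; rewrite !inE => /orP[]/eqP->; rewrite !qs; try (rewrite /L; index_lia);
    split; try (rewrite /L; index_lia); last by apply: s_edge; rewrite /L; index_lia.
  by have := @s_edge' t.-1; rewrite prednK; [apply|]; rewrite /L; index_lia.
by rewrite !phi2; index_lia.
Qed.

Variables (w : V) (m : nat).
Hypotheses (w_out : w \notin s) (ms : m < size s) (e_w : e s_[m] w).

Lemma branch_covers v : v \in rcons s w.
Proof.
rewrite -[_ \in _]negbK; apply/negP => vq.
have wq : w \in rcons s w by rewrite mem_rcons mem_head.
have [x [y [xq yq exy]]] := boundary wq vq.
move: yq; rewrite mem_rcons inE negb_or => /andP[yw ys].
move: xq exy; rewrite mem_rcons inE => /orP[/eqP->|xs].
  by apply/negP; exact: branch_vertex_leaf e_w _ ys yw.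
rewrite -(nth_index x0 xs); have is' : index x s < size s by rewrite index_mem.
move=> ey; have [lt|lt|mE] := ltngtP m (index x s).
- exact: branch_vertex_lt w_out ys yw lt is' e_w ey.
- by apply: branch_vertex_lt ys w_out _ lt ms ey e_w; rewrite eq_sym.
- by move: ey; rewrite -mE; apply/negP; exact: branch_degree w_out ms e_w _ ys yw.
Qed.

(** The positions along [s], followed by [w], are the numbering of [branched], whose last vertex
    hangs on the vertex m. *)
Lemma branched_of_path n : n = (size s).+1 ->
  exists f : V -> 'I_n, bijective f /\ forall i j, a i j = branched n m (f i) (f j).
Proof.
move=> ->; pose q := rcons s w.
have uq : uniq q by rewrite rcons_uniq w_out.
have h v : index v q < (size s).+1 by rewrite -(size_rcons s w) index_mem branch_covers.
exists (fun v => Ordinal (h v)); split.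
  exists (fun i : 'I_(size s).+1 => nth x0 q i) => [v|i].
    by rewrite /= nth_index // branch_covers.
  by apply: val_inj; rewrite /= index_uniq // size_rcons.
have adj_s := path_adjacency s_path.
have adj_w t : t < size s -> a s_[t] w = (t == m) :> nat.
  move=> ts; have := no_double s_[t] w; suff : e s_[t] w = (t == m).
    by rewrite /weight_adj; case: (a _ _) => [|[]] //= <-.
  have [->//|tm] := eqVneq t m; apply/negbTE/negP => et.
  by move: tm; rewrite (path_neighbour_unique s_path w_out ts ms et e_w) eqxx.
move=> i j; rewrite -{1}(nth_index x0 (branch_covers i)).
rewrite -{1}(nth_index x0 (branch_covers j)) /=.
move: (index i _) (index j _) (h i) (h j) => b c bL cL; rewrite !nth_rcons.
rewrite /branched /symrel.
have [bs|bs] := ltnP b (size s); have [cs|cs] := ltnP c (size s).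
- by rewrite adj_s //; index_lia.
- have -> : c = size s by index_lia.
  by rewrite eqxx adj_w //; index_lia.
- have -> : b = size s by index_lia.
  by rewrite eqxx a_sym adj_w //; index_lia.
- have -> : c = size s by index_lia.
  have -> : b = size s by index_lia.
  by rewrite eqxx a_irr; index_lia.
Qed.

Let is_dynkin := exists n (e' : rel nat) (f : V -> 'I_n),
    [/\ dynkin_diagram n e', bijective f & forall i j, a i j = e' (f i) (f j)].

Let dynkin_D_of_path : m.+2 = size s -> is_dynkin.
Proof.
move=> mL; have [m0 _] := arm1 w_out ms e_w.
have [f [bf fE]] := branched_of_path erefl.
exists (size s).+1, (branched (size s).+1 ((size s).+1 - 3)), f; split=> //.
  by apply: Dynkin_D; index_lia.
by move=> i j; rewrite fE (_ : m = (size s).+1 - 3) //; index_lia.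
Qed.

Let dynkin_E_of_path : m = 2 -> m.+2 < size s -> is_dynkin.
Proof.
move=> m2 mL; have [f [bf fE]] := branched_of_path erefl.
exists (size s).+1, (branched (size s).+1 2), f; split=> //.
  apply/Dynkin_E/andP; split; first by index_lia.
  rewrite leqNgt; apply/negP => sL.
  by apply: (branch_exceptional_E8 (m := m) w_out) => //; index_lia.
by move=> i j; rewrite fE m2.
Qed.

(** [branched] fixes a direction of the chain. The second and third alternatives are types D and E
    read from the other end; they are settled by applying the lemma to the reversed path as well. *)
Lemma dynkin_of_branch_aux :
  [\/ is_dynkin, m = 1 /\ m.+2 != size s | 2 < m /\ m.+3 = size s].
Proof.
have [m0 mL] := arm1 w_out ms e_w.
have [mL2|mL2] := eqVneq m.+2 (size s); first by constructor 1; exact: dynkin_D_of_path.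
have [m1|m1] := eqVneq m 1; first by constructor 2.
have [m2|m2] := eqVneq m 2; first by constructor 1; apply: dynkin_E_of_path => //; index_lia.
have [mL3|mL3] := eqVneq m.+3 (size s); first by constructor 3; split; index_lia.
by case: (@branch_exceptional_E7 w m) => //; index_lia.
Qed.
End Branch.

Lemma dynkin_of_no_subadditive : exists n (e' : rel nat) (f : V -> 'I_n),
  [/\ dynkin_diagram n e', bijective f & forall i j, a i j = e' (f i) (f j)].
Proof.
have ex : exists L, [exists t : L.-tuple V, simple_path t].
  by exists 1; apply/existsP; exists [tuple x0].
have bd L : [exists t : L.-tuple V, simple_path t] -> L <= #|V|.
  move=> /existsP[t /andP[_ ut]]; rewrite -(size_tuple t).
  by rewrite -(card_uniqP ut); exact: max_card.
have [L /existsP[t tp] Lmax] := ex_maxnP ex bd.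
have t_max r : simple_path r -> size r <= size t.
  move=> rp; rewrite size_tuple; apply: Lmax; apply/existsP.
  by exists (in_tuple r).
have t0 : 0 < size t.
  by rewrite size_tuple; apply: Lmax; apply/existsP; exists [tuple x0].
have [tV|] := pselect (forall v, v \in tval t); first exact: dynkin_A_of_path tp t0 tV.
move=> /existsNP[v /negP vt].
have [x [w [xt wt exw]]] := boundary (mem_nth x0 t0) vt.
have xi : index x t < size t by rewrite index_mem.
move: exw; rewrite -(nth_index x0 xt); move: (index x t) xi => m mt exw.
have rp := simple_path_rev tp.
have r_max r : simple_path r -> size r <= size (rev t) by rewrite size_rev; exact: t_max.
have wr : w \notin rev t by rewrite mem_rev.
have mr : size t - m.+1 < size (rev t) by rewrite size_rev; lia.
have mE : size t - (size t - m.+1).+1 = m by lia.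
have er : e (nth x0 (rev t) (size t - m.+1)) w by rewrite nth_rev ?mE //; lia.
have := dynkin_of_branch_aux rp r_max wr mr er; rewrite size_rev.
have [//|[m1 mL]|[m2 mL]] := dynkin_of_branch_aux tp t_max wt mt exw.
  by case=> [//|[h /eqP h']|[h h']]; lia.
by case=> [//|[h /eqP h']|[h h']]; lia.
Qed.
End DynkinClassification.

(** Contraposition of the classification, for the multiplicities [#|edges x y|]; they vanish on the
    diagonal because an acyclic quiver has no loops. *)
Lemma nondynkin_subadditive (Q : quiver) :
  quiver_connected Q -> quiver_acyclic Q -> ~ dynkin_type Q ->
  exists2 delta : vert Q -> nat, (exists v, delta v != 0%N) &
    forall v, (2 * delta v <= \sum_u #|edges v u| * delta u)%N.
Proof.
move=> Qc Qa Qd; apply: contrapT => no; apply: Qd.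
have /card_gt0P[x0 _] := vert_gt0 Q.
apply: (@dynkin_of_no_subadditive (vert Q) (fun x y => #|edges x y|) x0).
- by move=> x y; apply: eq_card => h; rewrite !inE orbC.
- move=> x; apply: eq_card0 => h; rewrite !inE orbb; apply/negP => /andP[sh th].
  have := Qa x [:: h]; rewrite /= sh /endpoint /= (eqP th) => /(_ isT erefl).
  by [].
- move=> x y; have := Qc x y; congr is_true; apply: eq_connect => u v.
  by rewrite /weight_adj cards_eq0.
- move=> delta hd v; apply/eqP; apply: contrapT => dv; apply: no.
  by exists delta => //; exists v; apply/negP.
Qed.

Import GRing.Theory Num.Theory.
Local Open Scope ring_scope.

(** * Linear algebra *)

Section LinearAlgebra.
Variable k : fieldType.

Section GeneralizedInverse.
Variables (V V' : lmodType k) (d : {linear V -> V'}).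

(** The origin is adjoined so that the empty set, the union of the empty chain, counts as the graph
    of the zero map on the zero space. *)
Let total_graph (G : set (V' * V)) (p : V' * V) : Prop := p = 0 \/ G p.

(** Graphs of linear maps on subspaces of V' that invert [d] wherever the argument lies in its
    image. Values at other arguments are free, which lets the domain grow by any vector. *)
Let partial_inverse (G : set (V' * V)) : Prop :=
  [/\ forall a p q, total_graph G p -> total_graph G q -> total_graph G (a *: p + q),
      forall v, total_graph G (0, v) -> v = 0 &
      forall y v, total_graph G (y, v) -> (exists u, d u = y) -> d v = y].

Let partial_inverse_chain (F : set (set (V' * V))) :
  (F `<=` partial_inverse)%classic -> total_on F subset ->
  partial_inverse (\bigcup_(X in F) X)%classic.
Proof.
move=> FP Ftot.
have lift p : total_graph (\bigcup_(X in F) X)%classic p ->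
    p = 0 \/ exists2 G, F G & total_graph G p.
  by case=> [->|[G FG Gp]]; [left|right; exists G => //; right].
have back G p : F G -> total_graph G p -> total_graph (\bigcup_(X in F) X)%classic p.
  by move=> FG [->|Gp]; [left|right; exists G].
split=> [a p q /lift hp /lift hq|v /lift|y v /lift].
- case: hp hq => [->|[G FG Gp]] [->|[H FH Hq]].
  + by left; rewrite scaler0 addr0.
  + by rewrite scaler0 add0r; exact: back FH Hq.
  + have [cl _ _] := FP _ FG; apply: back (FG) _.
    by apply: cl => //; left.
  + case: (Ftot _ _ FG FH) => [GH|HG].
      have [cl _ _] := FP _ FH; apply: back (FH) _; apply: cl => //.
      by case: Gp => [->|/GH]; [left|right].
    have [cl _ _] := FP _ FG; apply: back (FG) _; apply: cl => //.
    by case: Hq => [->|/HG]; [left|right].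
- by case=> [[]//|[G FG Gv]]; have [_ fn _] := FP _ FG; exact: fn.
- case=> [[-> ->] _|[G FG Gv]]; first by rewrite linear0.
  by have [_ _ sec] := FP _ FG; exact: sec.
Qed.

Let partial_inverse_extend G y0 : partial_inverse G ->
  (forall v, ~ total_graph G (y0, v)) ->
  exists2 G', partial_inverse G' & (G `<` G')%classic.
Proof.
move=> [cl fn sec] y0G.
have cl0 : total_graph G 0 by left.
have clZ a p : total_graph G p -> total_graph G (a *: p).
  by move=> h; rewrite -[_ *: _]addr0; exact: cl.
(* If y0 + y1 = d u for some y1 in the domain, with value v1, then v0 is determined modulo the
   kernel of d as u - v1. Otherwise y + c y0 lies in the image only for c = 0, and v0 = 0 serves. *)
have [v0 v0P] : exists v0, forall y v c, total_graph G (y, v) ->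
    (exists u, d u = y + c *: y0) -> d (v + c *: v0) = y + c *: y0.
  have [[u [y1 [v1 [Gy1 du]]]]|no] :=
    pselect (exists u y1 v1, total_graph G (y1, v1) /\ d u = y0 + y1).
    exists (u - v1) => y v c Gyv [w dw].
    have /sec : total_graph G (y - c *: y1, v - c *: v1).
      have -> : (y - c *: y1, v - c *: v1) = - c *: (y1, v1) + (y, v).
        by rewrite scaleNr [RHS]addrC.
      exact: cl.
    have -> : v + c *: (u - v1) = (v - c *: v1) + c *: u.
      by rewrite scalerBr addrCA addrC -addrA [- _ + _]addrC.
    have yE : y + c *: y0 = (y - c *: y1) + c *: (y0 + y1).
      by rewrite scalerDr [c *: y0 + _]addrC addrA subrK.
    move=> h; rewrite linearD [d (c *: u)]linearZ /= du yE h //.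
    by exists (w - c *: u); rewrite linearB [d (c *: u)]linearZ /= dw du yE addrK.
  exists 0 => y v c Gyv [u du]; rewrite scaler0 addr0.
  have [c0|c0] := eqVneq c 0.
    by move: du; rewrite c0 scale0r addr0 => du; apply: sec => //; exists u.
  case: no; exists (c^-1 *: u), (c^-1 *: y), (c^-1 *: v); split; first exact: (clZ _ (_, _)).
  by rewrite linearZ /= du scalerDr scalerA mulVf // scale1r addrC.
pose G' := [set p | exists q c, total_graph G q /\ p = q + c *: (y0, v0)]%classic.
have G'E p : total_graph G' p -> exists q c, total_graph G q /\ p = q + c *: (y0, v0).
  by case=> [->|//]; exists 0, 0; split=> //; rewrite scale0r addr0.
exists G'; last first.
  split=> [p Gp|sub]; first by exists p, 0; split; [right|rewrite scale0r addr0].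
  apply: (y0G v0); right; apply: sub; exists 0, 1; split=> //.
  by rewrite scale1r add0r.
split=> [a p q /G'E[p' [c [hp ->]]] /G'E[q' [c' [hq ->]]]|v /G'E|y v /G'E].
- right; exists (a *: p' + q'), (a * c + c'); split; first exact: cl.
  by rewrite scalerDr addrACA scalerA -scalerDl.
- move=> [[y w] [c [Gyw [yE ->]]]]; move/esym/eqP: yE.
  rewrite addr_eq0 => /eqP yE.
  have [c0|c0] := eqVneq c 0.
    rewrite c0 scale0r addr0; apply: fn; move: Gyw.
    by rewrite yE c0 scale0r oppr0.
  case: (y0G (- c^-1 *: w)).
  have -> : (y0, - c^-1 *: w) = - c^-1 *: (y, w).
    apply: injective_projections => //=.
    by rewrite yE scaleNr scalerN opprK scalerA mulVf // scale1r.
  exact: clZ.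
- by move=> [[y' w] [c [Gyw [-> ->]]]]; exact: v0P.
Qed.

Lemma generalized_inverse :
  exists r : {linear V' -> V},
    (forall x, d (r (d x)) = d x) /\ (forall y, r (d (r y)) = r y).
Proof.
have [G [Gp Gmax]] := Zorn_bigcup partial_inverse_chain.
have dom y : exists v, total_graph G (y, v).
  apply: contrapT => /forallNP h.
  by have [G' G'p /Gmax] := partial_inverse_extend Gp h.
have [cl fn sec] := Gp; pose f y := projT1 (cid (dom y)).
have fP y : total_graph G (y, f y) by exact: projT2 (cid (dom y)).
have uni y v : total_graph G (y, v) -> v = f y.
  move=> h; apply/eqP; rewrite -subr_eq0; apply/eqP/fn.
  have := cl (- 1) _ _ (fP y) h; congr total_graph.
  by apply: injective_projections => /=; rewrite scaleN1r addrC ?subrr.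
have flin : linear f by move=> a x y; symmetry; apply: uni; exact: (cl a _ _ (fP x) (fP y)).
pose r : {linear V' -> V} := lin_of flin.
have rP x : d (r (d x)) = d x by apply: sec (fP _) _; exists x.
(* Passing from r to r d r adds the second identity and keeps the first. *)
have r'lin : linear (fun y => r (d (r y))) by move=> a x y; rewrite !linearP.
by exists (lin_of r'lin); split=> x /=; rewrite !rP.
Qed.
End GeneralizedInverse.

Section Dimension.
Variable V : lmodType k.

Definition independent (I : finType) (v : I -> V) : Prop :=
  forall c : I -> k, \sum_i c i *: v i = 0 -> forall i, c i = 0.

Lemma independent_card (I J : finType) (v : I -> V) (w : J -> V) :
  independent v -> (forall i, exists c : J -> k, v i = \sum_j c j *: w j) ->
  (#|I| <= #|J|)%N.
Proof.
move=> vI /fin_all_exists[c vE]; rewrite leqNgt; apply/negP => JI.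
pose M : 'M[k]_(#|I|, #|J|) := \matrix_(a, b) c (enum_val a) (enum_val b).
have /rowV0Pn[u /sub_kermxP uM u0] : kermx M != 0.
  rewrite -mxrank_eq0 mxrank_ker subn_eq0 -ltnNge.
  exact: leq_ltn_trans (rank_leq_col _) JI.
case/negP: u0; apply/eqP/rowP => a; rewrite mxE.
rewrite -[a]enum_valK; apply: (vI (fun i => u 0 (enum_rank i))).
under eq_bigr => i _ do rewrite vE scaler_sumr.
rewrite exchange_big big1 //= => j _.
under eq_bigr => i _ do rewrite scalerA.
rewrite -scaler_suml; have := congr1 (fun m : 'rV_ _ => m 0 (enum_rank j)) uM.
rewrite mxE [RHS]mxE => uMj; rewrite (reindex (@enum_val _ I)) /=.
  rewrite -[X in X *: _ = _]/(\sum_a _) -[X in _ = X](scale0r (w j)) -{}[in RHS]uMj.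
  by congr (_ *: _); apply: eq_bigr => b _; rewrite enum_valK mxE enum_rankK.
by exists enum_rank => b _; rewrite ?enum_valK ?enum_rankK.
Qed.

(* A maximal independent family in U is a basis; Steinitz bounds its size. *)
Lemma finite_basis (U : V -> Prop) (J : finType) (w : J -> V) :
  (forall x, exists c : J -> k, x = \sum_j c j *: w j) ->
  exists n (v : 'I_n -> V), [/\ independent v, forall i, U (v i) &
    forall x, U x -> exists c : 'I_n -> k, x = \sum_i c i *: v i].
Proof.
move=> wV; pose A n := `[< exists v : 'I_n -> V, independent v /\ forall i, U (v i) >].
have A0 : exists n, A n.
  by exists 0%N; apply/asboolP; exists (fun=> 0); split=> [c _ []|[]].
have Ab n : A n -> (n <= #|J|)%N.
  by move=> /asboolP[v [vI _]]; rewrite -{1}[n]card_ord; exact: independent_card vI _.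
case: (ex_maxnP A0 Ab) => n /asboolP[v [vI vU]] nmax.
exists n, v; split=> // x Ux; apply: contrapT => xn.
suff /nmax : A n.+1 by rewrite ltnn.
pose v' (i : 'I_n.+1) := oapp v x (unlift ord0 i).
apply/asboolP; exists v'; split=> [c|i]; last first.
  by rewrite /v'; case: unliftP => [j _|_] /=.
rewrite big_ord_recl /v' unlift_none /=.
under eq_bigr => i _ do rewrite liftK /=.
have [c0|c0] := eqVneq (c ord0) 0.
  rewrite c0 scale0r add0r => /vI c0' i.
  by case: (unliftP ord0 i) => [j ->|-> //]; exact: c0'.
move=> /eqP; rewrite addr_eq0 => /eqP h; case: xn.
exists (fun i => - (c ord0)^-1 * c (lift ord0 i)).
rewrite -[LHS]scale1r -(mulVf c0) -scalerA h scalerN scaler_sumr -sumrN.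
by apply: eq_bigr => i _; rewrite scalerA mulNr scaleNr.
Qed.
End Dimension.
End LinearAlgebra.

(** * Path algebra and preprojective relations *)

Section PathAlgebraTheory.
Variables (k : fieldType) (Q : quiver).
Local Notation kQ := (path_algebra k Q).
Local Notation ev j := (path_vertex j : kQ).
Local Notation ar b := (path_arrow b : kQ).
Implicit Types (f g : kQ) (i j : vert Q) (s : seq (arr Q)) (b : arr Q).

Lemma path_coefD f g x : (f + g) x = f x + g x. Proof. by []. Qed.
Lemma path_coefZ (a : k) f x : (a *: f) x = a * f x. Proof. by []. Qed.
Lemma path_coefN f x : (- f) x = - f x. Proof. by []. Qed.
Lemma path_coef0 x : (0 : kQ) x = 0. Proof. by []. Qed.

Lemma path_coef_sum (I : Type) (r : seq I) (P : pred I) (F : I -> kQ) x :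
  (\sum_(b <- r | P b) F b) x = \sum_(b <- r | P b) F b x.
Proof. by elim/big_rec2: _ => // b f y _ <-. Qed.

Lemma path_coefM f g i s : (f * g) (i, s) =
  \sum_(m < (size s).+1) f (endpoint i (take m s), drop m s) * g (i, take m s).
Proof. by []. Qed.

Let path_delta_coef i s x :
  (path_delta k i s) x = ((x == (i, s)) && is_path i s)%:R.
Proof. by []. Qed.
Let path_delta_funE i s x :
  path_delta_fun k i s x = ((x == (i, s)) && is_path i s)%:R.
Proof. by []. Qed.
Let path_deltaE := (path_delta_coef, path_delta_funE).

Lemma mul_path_vertex f j i s : (f * ev j) (i, s) = if i == j then f (i, s) else 0.
Proof.
rewrite path_coefM big_ord_recl /= take0 drop0 path_deltaE xpair_eqE eqxx !andbT /=.
rewrite big1 ?addr0 => [|m _]; first by case: eqP => _; rewrite ?mulr1 ?mulr0.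
rewrite path_deltaE xpair_eqE; case: s m => [[]//|h s m] /=.
by rewrite /bump /= andbF mulr0.
Qed.

Lemma path_vertex_mul j f i s :
  (ev j * f) (i, s) = if endpoint i s == j then f (i, s) else 0.
Proof.
rewrite path_coefM big_ord_recr /= take_size drop_size path_deltaE xpair_eqE eqxx !andbT /=.
rewrite big1 ?add0r => [|m _]; first by case: eqP => _; rewrite ?mul1r ?mul0r.
rewrite path_deltaE xpair_eqE -size_eq0 size_drop subn_eq0 leqNgt ltn_ord.
by rewrite andbF mul0r.
Qed.

Lemma mul_path_arrow f b i s : (f * ar b) (i, s) =
  if s is h :: s' then if (h == b) && (i == src b) then f (tgt b, s') else 0 else 0.
Proof.
rewrite path_coefM big_ord_recl /= take0 path_deltaE xpair_eqE /= andbF mulr0 add0r.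
case: s => [|h s]; first by rewrite big_ord0.
rewrite big_ord_recl /= take0 drop0 path_deltaE xpair_eqE /= eqxx !andbT /= eqseq_cons eqxx andbT.
rewrite big1 ?addr0 => [|m _]; last first.
  rewrite path_deltaE xpair_eqE; case: s m => [[]//|h' s m] /=.
  by rewrite eqseq_cons /= !andbF mulr0.
by rewrite andbC; case: eqP => [->|_]; case: eqP; rewrite /= ?mulr1 ?mulr0.
Qed.

Lemma path_arrow_mul_delta b i s : is_path i (rcons s b) ->
  ar b * path_delta k i s = path_delta k i (rcons s b).
Proof.
move=> p; have /andP[ps /eqP sb] : is_path i s && (src b == endpoint i s).
  by move: p; rewrite -cats1 is_path_cat /= andbT.
apply: path_algebraP => i' s'; rewrite path_coefM [RHS]path_deltaE p andbT xpair_eqE.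
have [ss|ss] := leqP (size s') (size s).
  have /negPf-> : s' != rcons s b.
    by apply: contraTneq ss => ->; rewrite size_rcons ltnn.
  rewrite andbF big1 // => m _; rewrite !path_deltaE ps andbT !xpair_eqE.
  have [dr|] := eqVneq (drop m s') [:: b]; last by rewrite andbF mul0r.
  have [tk|] := eqVneq (take m s') s; last by rewrite !andbF mulr0.
  by move: ss; rewrite -{1}(cat_take_drop m s') dr tk size_cat addn1 ltnn.
have hm : (size s < (size s').+1)%N by rewrite ltnS ltnW.
rewrite (bigD1 (Ordinal hm)) //= big1 ?addr0 => [|m /eqP mn].
  rewrite !path_deltaE ps /= eqxx andbT !xpair_eqE.
  have [->|ii] := eqVneq i' i; last by rewrite /= mulr0.
  rewrite /=; have [tk|tk] := eqVneq (take (size s) s') s; last first.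
    rewrite mulr0; suff /negPf-> : s' != rcons s b by [].
    by apply: contraNneq tk => ->; rewrite -cats1 take_size_cat.
  rewrite mulr1 tk sb eqxx /= -cats1 -{2}(cat_take_drop (size s) s') tk.
  by rewrite andbT eqseq_cat // eqxx.
rewrite !path_deltaE ps andbT !xpair_eqE; have [tk|] := eqVneq (take m s') s.
  case: mn; apply: val_inj => /=; rewrite -tk size_takel //; exact: ltn_ord m.
by rewrite andbF mulr0.
Qed.

Lemma path_delta_cat i s t : is_path i (s ++ t) -> path_delta k i (s ++ t) =
  path_delta k (endpoint i s) t * path_delta k i s.
Proof.
elim/last_ind: t => [|t b IH] p.
  rewrite cats0; apply: path_algebraP => i' s'.
  rewrite -[path_delta k _ [::]]/(ev (endpoint i s)) path_vertex_mul path_deltaE.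
  by rewrite xpair_eqE; case: (eqVneq i' i) => [->|]; case: (eqVneq s' s) => [->|] /=;
    rewrite ?eqxx // if_same.
move: p; rewrite -rcons_cat => p; rewrite -path_arrow_mul_delta // IH; last first.
  by move: p; rewrite -cats1 is_path_cat => /andP[].
rewrite mulrA path_arrow_mul_delta //.
by move: p; rewrite rcons_cat is_path_cat => /andP[].
Qed.

Lemma path_arrow_srcK b : ar b * ev (src b) = ar b.
Proof.
apply: path_algebraP => i s; rewrite mul_path_vertex path_deltaE xpair_eqE.
by case: eqP.
Qed.

Lemma path_arrow_tgtK b : ev (tgt b) * ar b = ar b.
Proof.
apply: path_algebraP => i s; rewrite path_vertex_mul path_deltaE xpair_eqE.
by case: (eqVneq s [:: b]) => [->|]; rewrite ?andbF ?if_same // /endpoint /= eqxx.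
Qed.

Lemma path_vertex_idem j : ev j * ev j = ev j.
Proof.
apply: path_algebraP => i s; rewrite mul_path_vertex path_deltaE xpair_eqE.
by case: eqP.
Qed.

Lemma path_arrow_vertex b j : ar b * ev j = if src b == j then ar b else 0.
Proof.
case: (src b =P j) => [<-|bj]; first exact: path_arrow_srcK.
apply: path_algebraP => i s; rewrite mul_path_vertex path_coef0 path_deltaE xpair_eqE.
by case: (i =P j) => // ->; case: (j =P src b) => // h; case: bj.
Qed.

Lemma path_vertex_sum : \sum_j ev j = 1.
Proof.
apply: path_algebraP => i s; rewrite path_coef_sum (bigD1 i) //= big1 ?addr0 => [|j ji].
  by rewrite path_deltaE xpair_eqE eqxx andbT.
by rewrite path_deltaE xpair_eqE eq_sym (negPf ji).
Qed.

(** Right division by an arrow. Products read from right to left, so a path with first arrow b is p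
    * b, and p receives the coefficient of that path. *)
Definition path_rdiv_fun b f (x : vert Q * seq (arr Q)) : k :=
  if x.1 == tgt b then f (src b, b :: x.2) else 0.

Lemma path_rdiv_subproof b f : path_rdiv_fun b f \in @path_supported k Q.
Proof.
apply/path_supportedP; split=> [i s|]; rewrite /path_rdiv_fun /=.
  case: (i =P tgt b) => [->|_]; last by rewrite eqxx.
  by case/path_supportedP: (path_coefP f) => h _ /h /= /andP[].
have [N fN] := path_algebra_bound f; exists N => i s hs.
by case: eqP => // _; rewrite fN //= ltnW.
Qed.

Definition path_rdiv b f : kQ := PathAlgebra (path_rdiv_subproof b f).

Lemma path_rdivK b f : path_rdiv b f * ev (tgt b) = path_rdiv b f.
Proof.
apply: path_algebraP => i s; rewrite mul_path_vertex /= /path_rdiv_fun /=.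
by case: eqP.
Qed.

(** A nontrivial path from j is p * b for a unique arrow b leaving j, so the part of positive degree
    of kQ e_j is the direct sum of the kQ e_(tgt b) b; [path_rdiv_unique] is the directness. *)
Lemma path_rdivE f j : f * ev j =
  path_char j f *: ev j + \sum_(b | src b == j) path_rdiv b f * ar b.
Proof.
apply: path_algebraP => i s; rewrite mul_path_vertex path_coefD path_coefZ.
rewrite path_coef_sum path_deltaE xpair_eqE andbT /path_char.
under eq_bigr => b _ do rewrite mul_path_arrow.
case: s => [|h s].
  by rewrite big1_eq addr0 eqxx andbT; case: eqP => [->|]; rewrite ?mulr1 ?mulr0.
rewrite andbF mulr0 add0r; have [->|ij] := eqVneq i j; last first.
  by rewrite big1 // => b /eqP->; rewrite (negPf ij) andbF.
have [hj|hj] := eqVneq (src h) j; last first.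
  rewrite path_algebra_path /= ?(negPf hj) // big1 // => b /eqP bj.
  by case: eqP => // hb; rewrite -hb (negbTE hj) in bj * || (move: hj; rewrite hb bj eqxx).
rewrite (bigD1 h) ?hj //= big1 => [|b /andP[_ bh]]; last by rewrite eq_sym (negPf bh).
by rewrite !eqxx /= addr0 /path_rdiv_fun /= eqxx hj.
Qed.

Lemma path_rdiv_unique j (F : arr Q -> kQ) :
  (forall b, src b = j -> F b * ev (tgt b) = F b) ->
  \sum_(b | src b == j) F b * ar b = 0 -> forall b, src b = j -> F b = 0.
Proof.
move=> Fb F0 b bj; rewrite -Fb //; apply: path_algebraP => i s.
rewrite mul_path_vertex path_coef0; case: eqP => // ->.
have := congr1 (fun f : kQ => f (j, b :: s)) F0; rewrite path_coef_sum path_coef0.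
rewrite (bigD1 b) ?bj ?eqxx // mul_path_arrow !eqxx bj eqxx big1 => [|c /andP[_ cb]].
  by rewrite /= addr0.
by rewrite mul_path_arrow eq_sym (negPf cb).
Qed.

Definition path_homog_fun (n : nat) f (x : vert Q * seq (arr Q)) : k :=
  if size x.2 == n then f x else 0.

Lemma path_homog_subproof n f : path_homog_fun n f \in @path_supported k Q.
Proof.
apply/path_supportedP; split=> [i s|]; rewrite /path_homog_fun /=.
  case: (size s =P n) => [_|_]; last by rewrite eqxx.
  by case/path_supportedP: (path_coefP f) => h _; exact: h.
have [N fN] := path_algebra_bound f; exists N => i s hs.
by case: eqP => // _; rewrite fN.
Qed.

Definition path_homog n f : kQ := PathAlgebra (path_homog_subproof n f).

Lemma path_homog_coef n f i s :
  path_homog n f (i, s) = if size s == n then f (i, s) else 0.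
Proof. by []. Qed.
Let path_homog_funE n f i s :
  path_homog_fun n f (i, s) = if size s == n then f (i, s) else 0.
Proof. by []. Qed.
Let path_homogE := (path_homog_coef, path_homog_funE).

Lemma path_homogD n f g : path_homog n (f + g) = path_homog n f + path_homog n g.
Proof.
apply: path_algebraP => i s; rewrite path_coefD !path_homogE path_coefD.
by case: eqP; rewrite ?addr0.
Qed.

Lemma path_homogZ n (a : k) f : path_homog n (a *: f) = a *: path_homog n f.
Proof.
apply: path_algebraP => i s; rewrite path_coefZ !path_homogE path_coefZ.
by case: eqP; rewrite ?mulr0.
Qed.

Lemma path_homog_homog m n f :
  path_homog m (path_homog n f) = if m == n then path_homog n f else 0.
Proof.
apply: path_algebraP => i s; rewrite !path_homogE.
case: (m =P n) => [->|mn]; first by rewrite path_homogE; case: eqP.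
by rewrite path_coef0; case: (size s =P m) => // ->; case: eqP.
Qed.

Lemma path_homog_vertex n f j : path_homog n (f * ev j) = path_homog n f * ev j.
Proof.
apply: path_algebraP => i s; rewrite mul_path_vertex !path_homogE mul_path_vertex.
by case: (i == j); rewrite ?if_same.
Qed.

Lemma path_homog_arrowS n f b : path_homog n.+1 (f * ar b) = path_homog n f * ar b.
Proof.
apply: path_algebraP => i s; rewrite mul_path_arrow path_homogE mul_path_arrow.
case: s => [|h s]; first by [].
rewrite path_homogE -[size (h :: s)]/(size s).+1 eqSS.
by case: (size s == n); case: (_ && _).
Qed.

Lemma path_homog_arrow0 f b : path_homog 0 (f * ar b) = 0.
Proof.
by apply: path_algebraP => i s; rewrite path_homogE mul_path_arrow; case: s.
Qed.

Lemma path_homogM n f g : path_homog n (f * g) =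
  \sum_(m < n.+1) path_homog (n - m) f * path_homog m g.
Proof.
apply: path_algebraP => i s; rewrite path_coef_sum path_homogE path_coefM.
have E (m : 'I_n.+1) : (path_homog (n - m) f * path_homog m g) (i, s) =
    if (size s == n) then f (endpoint i (take m s), drop m s) * g (i, take m s) else 0.
  rewrite path_coefM; have mn : (m <= n)%N by rewrite -ltnS.
  case: eqP => [sn|sn].
    have hm : (m < (size s).+1)%N by rewrite sn.
    rewrite (bigD1 (Ordinal hm)) //= big1 ?addr0 => [|j /eqP jm].
      by rewrite !path_homogE size_drop sn size_takel ?sn // !eqxx.
    rewrite [X in _ * X]path_homogE size_takel; last by rewrite -ltnS.
    case: eqP => [jm'|_]; last by rewrite mulr0.
    by case: jm; exact: val_inj.
  rewrite big1 // => j _; have := ltn_ord j; rewrite ltnS => js.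
  rewrite !path_homogE size_drop size_takel //.
  case: eqP => [h|_]; last by rewrite mul0r.
  case: eqP => [h'|_]; last by rewrite mulr0.
  by case: sn; rewrite -(subnK js) h h' subnK.
under [RHS]eq_bigr => m _ do rewrite E.
case: (eqVneq (size s) n) => [<-|]; last by rewrite big1_eq.
by apply: eq_bigr.
Qed.

Lemma path_homog_expand n f : path_homog n f =
  \sum_i \sum_(t : n.-tuple (arr Q)) f (i, val t) *: path_delta k i t.
Proof.
apply: path_algebraP => i s; rewrite path_homogE path_coef_sum (bigD1 i) //=.
rewrite [X in _ + X]big1 ?addr0 => [|j ji]; last first.
  rewrite path_coef_sum big1 // => t _; rewrite path_coefZ path_deltaE xpair_eqE.
  by rewrite eq_sym (negPf ji) mulr0.
rewrite path_coef_sum; case: (eqVneq (size s) n) => [sn|sn]; last first.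
  rewrite big1 // => t _; rewrite path_coefZ path_deltaE xpair_eqE.
  suff /negPf-> : s != t by rewrite andbF mulr0.
  by apply: contraNneq sn => ->; rewrite size_tuple.
have sn' : size s == n by apply/eqP.
rewrite (bigD1 (Tuple sn')) // big1 => [|t /eqP ts]; last first.
  rewrite path_coefZ path_deltaE xpair_eqE; case: (eqVneq s t) => [st|_].
    by case: ts; apply: val_inj.
  by rewrite andbF mulr0.
rewrite [RHS]addr0 path_coefZ path_deltaE eqxx /=; have [p|p] := boolP (is_path i s).
  by rewrite mulr1.
by rewrite (path_algebra_path f p) mul0r.
Qed.

Lemma path_homog_sum f : exists N, (forall n, (N <= n)%N -> path_homog n f = 0) /\
  f = \sum_(n < N) path_homog n f.
Proof.
have [N fN] := path_algebra_bound f; exists N; split=> [n Nn|].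
  apply: path_algebraP => i s; rewrite path_homogE.
  by case: eqP => // sn; rewrite fN // sn.
apply: path_algebraP => i s; rewrite path_coef_sum.
have [sN|sN] := ltnP (size s) N; last first.
  rewrite fN // big1 // => n _; rewrite path_homogE; case: eqP => // sn.
  by have := ltn_ord n; rewrite -sn ltnNge sN.
rewrite (bigD1 (Ordinal sN)) //= path_homogE eqxx big1 ?addr0 // => n /eqP nn.
by rewrite path_homogE; case: eqP => // sn; case: nn; apply: val_inj.
Qed.

End PathAlgebraTheory.

(** * Exactness of the mesh sequence at its middle term *)

Section PreprojectiveTheory.
Variables (k : fieldType) (Q : quiver).
Local Notation DQ := (double_quiver Q).
Local Notation kQQ := (path_algebra k DQ).
Local Notation Lambda := (preprojective k Q).
Local Notation pi := (@preproj_pi k Q).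
Local Notation pv j := (@path_vertex k DQ j).
Local Notation pa b := (@path_arrow k DQ b).
Implicit Types (x y : Lambda) (f g : kQQ) (j l : vert Q) (b c : arr DQ).

Lemma preproj_piB f g : pi (f - g) = pi f - pi g.
Proof. by apply/eqP; rewrite eq_sym subr_eq -preproj_piD subrK. Qed.

HB.instance Definition _ := GRing.isZmodMorphism.Build kQQ Lambda pi preproj_piB.

Lemma preproj_pi_monoid : monoid_morphism pi.
Proof. by split=> // f g; exact: preproj_piM. Qed.

HB.instance Definition _ := GRing.isMonoidMorphism.Build kQQ Lambda pi preproj_pi_monoid.

Lemma preproj_pi_scale (a : k) f : pi (a *: f) = a *: pi f.
Proof. exact: preproj_piZ. Qed.

Lemma preproj_pi_eq0 f : pi f = 0 <-> f \in @preprojective_ideal k Q.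
Proof. by rewrite -[0](raddf0 pi) preproj_piE subr0. Qed.

Definition lvertex j : Lambda := pi (pv j).
Local Notation ev := lvertex.
Local Notation ar b := (preproj_arrow b : Lambda).

Definition opp_arrow b : arr DQ := match b with inl h => inr h | inr h => inl h end.
(* The sign with which b occurs first in the relation sum_b sign(b) opp(b) b. *)
Definition arrow_sign b : Lambda := if b is inl _ then -1 else 1.

Lemma opp_arrowK : involutive opp_arrow. Proof. by case. Qed.
Lemma src_opp_arrow b : src (opp_arrow b) = tgt b. Proof. by case: b. Qed.
Lemma tgt_opp_arrow b : tgt (opp_arrow b) = src b. Proof. by case: b. Qed.
Lemma arrow_sign_sqr b : arrow_sign b * arrow_sign b = 1.
Proof. by case: b => h; rewrite /= ?mulrNN mulr1. Qed.
Lemma arrow_sign_comm b x : arrow_sign b * x = x * arrow_sign b.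
Proof. by case: b => h; rewrite /= ?mulNr ?mulrN ?mul1r ?mulr1. Qed.

Lemma lvertex_idem j : ev j * ev j = ev j.
Proof. by rewrite -rmorphM path_vertex_idem. Qed.
Lemma lvertex_orth i j : i != j -> ev i * ev j = 0.
Proof.
move=> ij; rewrite -rmorphM; apply/preproj_pi_eq0.
rewrite (_ : _ * _ = 0) ?rpred0 //; apply: path_algebraP => i' s.
rewrite mul_path_vertex path_coef0 /= /path_delta_fun xpair_eqE.
by case: (i' =P j) => // ->; rewrite eq_sym (negPf ij).
Qed.
Lemma lvertex_sum : \sum_j ev j = 1.
Proof. by rewrite -rmorph_sum (path_vertex_sum k DQ) rmorph1. Qed.
Lemma arrow_srcK b : ar b * ev (src b) = ar b.
Proof. by rewrite -rmorphM path_arrow_srcK. Qed.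
Lemma arrow_tgtK b : ev (tgt b) * ar b = ar b.
Proof. by rewrite -rmorphM path_arrow_tgtK. Qed.
Lemma lvertex_char j l : preproj_char l (ev j) = (j == l)%:R.
Proof.
by rewrite preproj_char_pi /path_char /= /path_delta_fun xpair_eqE eqxx !andbT eq_sym.
Qed.
Lemma arrow_char b l : preproj_char l (ar b) = 0.
Proof.
by rewrite preproj_char_pi /path_char /= /path_delta_fun xpair_eqE andbF.
Qed.

(** The relation as one sum over the arrows of the double quiver, each of them being the right
    factor once; multiplying by e_j on the right then selects the arrows leaving j. *)
Definition mesh_path : kQQ :=
  \sum_b (if b is inl _ then -1 else 1) * (pa (opp_arrow b) * pa b).

Lemma preprojective_relationE : preprojective_relation k Q = mesh_path.
Proof.
rewrite /mesh_path big_sumType /= /preprojective_relation sumrB addrC -sumrN.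
by congr (_ + _); apply: eq_bigr => h _; rewrite ?mulN1r ?mul1r.

Qed.

Lemma preproj_rdiv x j : x * ev j = x -> exists F : arr DQ -> Lambda,
  (forall b, F b * ev (tgt b) = F b) /\
  x = preproj_char j x *: ev j + \sum_(b : arr DQ | src b == j) F b * ar b.
Proof.
elim/preproj_ind: x => f fj; exists (fun b => pi (path_rdiv b f)); split=> [b|].
  by rewrite -rmorphM path_rdivK.
rewrite -[LHS]fj -rmorphM (path_rdivE f) rmorphD /= preproj_pi_scale preproj_char_pi.
congr (_ + _); rewrite rmorph_sum; apply: eq_bigr => b _; exact: rmorphM.
Qed.

(* A tail relation sum_b F_b b = 0 comes from an element p rho q of the ideal;
   split off the last arrow of q, and what remains is a multiple of rho e_j. *)
Lemma ideal_vertex j f : f \in @preprojective_ideal k Q ->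
  exists (g : kQQ) (F : arr DQ -> kQQ),
  [/\ forall b, F b \in @preprojective_ideal k Q,
      forall b, F b * pv (tgt b) = F b &
      f * pv j = g * mesh_path * pv j +
        \sum_(b : arr DQ | src b == j) F b * pa b].
Proof.
move=> /asboolP[s ->]; elim: s => [|[p q] s [g [F [FI Ft E]]]].
  exists 0, (fun=> 0); split=> [b|b|]; rewrite ?rpred0 ?mul0r //.
  by rewrite big_nil !mul0r big1 ?addr0 // => b _; rewrite mul0r.
exists (path_char (Q := DQ) j q *: p + g).
exists (fun b => p * mesh_path * path_rdiv b q + F b); split=> [b|b|].
- apply: rpredD => //; apply: preprojective_idealMr; apply: preprojective_idealMl.
  rewrite -preprojective_relationE; apply/asboolP; exists [:: (1, 1)].
  by rewrite big_seq1 mul1r mulr1.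
- by rewrite mulrDl Ft -mulrA path_rdivK.
rewrite big_cons /= mulrDl E preprojective_relationE -mulrA (path_rdivE q) mulrDr.
rewrite -scalerAr !mulrDl -!scalerAl addrACA; congr (_ + _).
rewrite mulr_sumr -big_split; apply: eq_bigr => b _ /=.
by rewrite mulrDl !mulrA.
Qed.

Lemma mesh_path_vertex j : mesh_path * pv j =
  \sum_(b : arr DQ | src b == j) (if b is inl _ then -1 else 1) *
    (pa (opp_arrow b) * pa b).
Proof.
rewrite /mesh_path mulr_suml [RHS]big_mkcond; apply: eq_bigr => b _.
by rewrite -!mulrA (@path_arrow_vertex _ DQ); case: (_ == j); rewrite ?mulr0.
Qed.

Lemma mesh_relation j :
  \sum_(b : arr DQ | src b == j) arrow_sign b * (ar (opp_arrow b) * ar b) = 0.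
Proof.
have h : pi (mesh_path * pv j) = 0.
  apply/preproj_pi_eq0/preprojective_idealMr; rewrite -preprojective_relationE.
  by apply/asboolP; exists [:: (1, 1)]; rewrite big_seq1 mul1r mulr1.
rewrite mesh_path_vertex rmorph_sum /= in h; rewrite -[RHS]h.
apply: eq_bigr => b _; rewrite !rmorphM /arrow_sign.
by case: b => ?; rewrite ?rmorphN rmorph1.
Qed.

(** Lifted to the path algebra, the relation becomes g rho e_j plus a sum of H_b b with H_b in the
    ideal. Uniqueness of right division identifies the coefficients: the lift of F_b is H_b plus g
    times the opposite of b, up to sign. *)
Lemma preproj_exact_middle j (F : arr DQ -> Lambda) :
  (forall b, src b = j -> F b * ev (tgt b) = F b) ->
  \sum_(b : arr DQ | src b == j) F b * ar b = 0 ->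
  exists2 y, y * ev j = y &
    forall b, src b = j -> F b = arrow_sign b * (y * ar (opp_arrow b)).
Proof.
move=> Fb F0; pose G b := preproj_repr (F b) * pv (tgt b).
have GF b : src b = j -> pi (G b) = F b.
  by move=> bj; rewrite rmorphM /= preproj_reprK Fb.
have /preproj_pi_eq0/(ideal_vertex j) :
    pi (\sum_(b : arr DQ | src b == j) G b * pa b) = 0.
  rewrite rmorph_sum -[RHS]F0; apply: eq_bigr => b /eqP bj.
  by rewrite rmorphM /= GF.
case=> g [H [HI Ht E]]; pose sg b : kQQ := if b is inl _ then -1 else 1.
exists (pi (g * pv j)); first by rewrite -rmorphM -mulrA path_vertex_idem.
pose D b := G b - (sg b * (g * pa (opp_arrow b)) + H b).
have sgC b f : sg b * f = f * sg b.
  by case: b => h; rewrite /sg ?mulN1r ?mulrN1 ?mul1r ?mulr1.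
have Dt b : src b = j -> D b * pv (tgt b) = D b.
  have Gt : G b * pv (tgt b) = G b by rewrite /G -mulrA path_vertex_idem.
  have ot : pa (opp_arrow b) * pv (tgt b) = pa (opp_arrow b).
    by rewrite -[X in pv X](src_opp_arrow b) path_arrow_srcK.
  by move=> bj; rewrite /D mulrBl mulrDl Ht Gt -[_ * _ * pv _]mulrA -[_ * _ * pv _]mulrA ot.
have : \sum_(b : arr DQ | src b == j) D b * pa b = 0.
  under eq_bigr => b _ do rewrite /D mulrBl mulrDl.
  rewrite sumrB big_split /=; apply/eqP; rewrite subr_eq0; apply/eqP.
  have -> : \sum_(b : arr DQ | src b == j) G b * pa b =
      (\sum_(b : arr DQ | src b == j) G b * pa b) * pv j.
    rewrite mulr_suml; apply: eq_bigr => b /eqP <-.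
    by rewrite -mulrA path_arrow_srcK.
  rewrite E; congr (_ + _); rewrite -mulrA mesh_path_vertex mulr_sumr.
  by apply: eq_bigr => b _; rewrite !mulrA -/(sg b) sgC.
move=> /(path_rdiv_unique Dt) D0 b bj; have /eqP := D0 b bj.
rewrite /D subr_eq0 => /eqP GE; rewrite -GF // GE preproj_piD.
have -> : pi (H b) = 0 by apply/preproj_pi_eq0.
rewrite addr0 rmorphM /=; congr (_ * _).
  by rewrite /sg; case: (b) => ?; rewrite ?rmorphN rmorph1.
rewrite !rmorphM /= -mulrA -[pi (pa _)]/(ar _).
by rewrite -[pi (pv j)]/(ev j) -bj -[src b]tgt_opp_arrow arrow_tgtK.
Qed.

End PreprojectiveTheory.

(** * Elements annihilated by all arrows *)

Section Injectivity.
Variables (k : fieldType) (Q : quiver).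
Local Notation DQ := (double_quiver Q).
Local Notation kQQ := (path_algebra k DQ).
Local Notation Lambda := (preprojective k Q).
Local Notation pi := (@preproj_pi k Q).
Local Notation pv j := (@path_vertex k DQ j).
Local Notation pa b := (@path_arrow k DQ b).
Local Notation ev j := (@lvertex k Q j).
Local Notation ar b := (@preproj_arrow k Q b).
Implicit Types (x y z : Lambda) (f g : kQQ) (j l : vert Q) (b c : arr DQ).

Lemma mesh_path_homog n :
  path_homog n (mesh_path k Q) = if n == 2 then mesh_path k Q else 0.
Proof.
have E f : path_homog 2 f = f -> path_homog n f = if n == 2 then f else 0.
  by move=> <-; rewrite path_homog_homog; case: eqP.
apply: E; apply: path_algebraP => i s; rewrite path_homog_coef.
case: eqP => // sn; rewrite path_coef_sum big1 // => b _.
suff : (pa (opp_arrow b) * pa b) (i, s) = 0.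
  by case: (b) => h; rewrite ?mulN1r ?mul1r // path_coefN => ->; rewrite oppr0.
rewrite mul_path_arrow; case: s sn => // h s sn; case: ifP => // _.
rewrite /= /path_delta_fun xpair_eqE; case: s sn => [|h' [|h'' s]] //= _.
  by rewrite andbF.
by rewrite !eqseq_cons !andbF.
Qed.

(** The relation is homogeneous of degree 2, so path length descends to a grading of the
    quotient. *)
Lemma preprojective_ideal_homog n f : f \in @preprojective_ideal k Q ->
  path_homog n f \in @preprojective_ideal k Q.
Proof.
move=> /asboolP[s ->]; elim: s => [|[p q] s IH].
  rewrite big_nil; have -> : path_homog n (0 : kQQ) = 0; last exact: rpred0.
  by rewrite -(scale0r (0 : kQQ)) path_homogZ !scale0r.
rewrite big_cons path_homogD; apply: rpredD => //.
rewrite preprojective_relationE path_homogM; apply: rpred_sum => m _.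
apply: preprojective_idealMr; rewrite path_homogM; apply: rpred_sum => m' _.
apply: preprojective_idealMl; rewrite mesh_path_homog; case: ifP => _; last exact: rpred0.
rewrite -preprojective_relationE; apply/asboolP; exists [:: (1, 1)].
by rewrite big_seq1 mul1r mulr1.
Qed.

Definition preproj_homog n x : Lambda := pi (path_homog n (preproj_repr x)).
Local Notation hom := preproj_homog.

Lemma path_homogB n f g : path_homog n (f - g) = path_homog n f - path_homog n g.
Proof. by rewrite path_homogD -scaleN1r path_homogZ scaleN1r. Qed.

Lemma preproj_homog_pi n f : hom n (pi f) = pi (path_homog n f).
Proof.
apply/eqP; rewrite -subr_eq0 -preproj_piB; apply/eqP/preproj_pi_eq0.
rewrite -path_homogB -opprB -scaleN1r path_homogZ scaleN1r rpredN.
exact/preprojective_ideal_homog/preproj_repr_pi.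
Qed.

Lemma preproj_homogD n x y : hom n (x + y) = hom n x + hom n y.
Proof.
elim/preproj_ind: x => f; elim/preproj_ind: y => g.
by rewrite -preproj_piD !preproj_homog_pi path_homogD preproj_piD.
Qed.

Lemma preproj_homogB n x y : hom n (x - y) = hom n x - hom n y.
Proof.
elim/preproj_ind: x => f; elim/preproj_ind: y => g.
by rewrite -preproj_piB !preproj_homog_pi path_homogB preproj_piB.
Qed.

Lemma preproj_homogZ n (a : k) x : hom n (a *: x) = a *: hom n x.
Proof.
elim/preproj_ind: x => f.
by rewrite -preproj_pi_scale !preproj_homog_pi path_homogZ preproj_pi_scale.
Qed.

Lemma preproj_homog0 n : hom n 0 = 0.
Proof. by rewrite -[X in hom n X](subrr 0) preproj_homogB subrr. Qed.

Lemma preproj_homog_homog m n x : hom m (hom n x) = if m == n then hom n x else 0.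
Proof.
elim/preproj_ind: x => f; rewrite !preproj_homog_pi path_homog_homog.
by case: ifP => // _; exact: raddf0.
Qed.

Lemma preproj_homog_vertex n x j : hom n (x * ev j) = hom n x * ev j.
Proof.
elim/preproj_ind: x => f; rewrite -rmorphM !preproj_homog_pi path_homog_vertex.
exact: rmorphM.
Qed.

Lemma preproj_homog_arrowS n x b : hom n.+1 (x * ar b) = hom n x * ar b.
Proof.
elim/preproj_ind: x => f; rewrite -rmorphM !preproj_homog_pi path_homog_arrowS.
exact: rmorphM.
Qed.

Lemma preproj_homog_arrow0 x b : hom 0 (x * ar b) = 0.
Proof.
by elim/preproj_ind: x => f; rewrite -rmorphM preproj_homog_pi path_homog_arrow0 raddf0.
Qed.

Lemma preproj_homog_sum x : exists N, (forall n, (N <= n)%N -> hom n x = 0) /\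
  x = \sum_(n < N) hom n x.
Proof.
elim/preproj_ind: x => f; have [N [fN fE]] := path_homog_sum f.
exists N; split=> [n Nn|]; first by rewrite preproj_homog_pi fN // raddf0.
rewrite [in LHS]fE raddf_sum; apply: eq_bigr => n _.
by rewrite preproj_homog_pi.
Qed.

Lemma preproj_homog_neq0 x : x <> 0 -> exists n, hom n x <> 0.
Proof.
move=> x0; apply: contrapT => /forallNP h; apply: x0.
have [N [_ ->]] := preproj_homog_sum x; apply: big1 => n _.
exact: contrapT (h n).
Qed.

Definition lpath l s : Lambda := pi (path_delta k (Q := DQ) l s).

Definition path_annihilated x := forall b, x * ar b = 0.

(** * Duality from an annihilated element of least degree *)

Section SocleDegree.
Variables (N : nat) (l : vert Q) (x0 : Lambda).
Hypotheses (x0_ann : path_annihilated x0) (x0_end : x0 * ev l = x0).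
Hypothesis x0_homog : hom N x0 = x0.
Hypothesis N_min : forall n x, (n < N)%N -> path_annihilated x -> hom n x = 0.

(** Codegree relative to N. The case p > N is separate because N - p would be truncated to 0. *)
Definition codeg p y : Prop := if (p <= N)%N then hom (N - p) y = y else y = 0.

(* Injectivity of the graded dual of Lambda e_l: comult p phi j y says that y
   is the image of the functional phi on e_j Lambda_p e_l under the map of
   right modules that sends the functional dual to e_l to x0. *)
Fixpoint comult p (phi : Lambda -> k) j y : Prop :=
  if p is p'.+1 then
    [/\ y * ev j = y, codeg p y &
        forall b, tgt b = j -> comult p' (fun z => phi (ar b * z)) (src b) (y * ar b)]
  else y = if j == l then phi (ev l) *: x0 else 0.

(** Minimality of N: two solutions differ by an element of degree below N which, by induction, all
    arrows kill. *)
Lemma comult_unique p phi j y y' : comult p phi j y -> comult p phi j y' -> y = y'.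
Proof.
elim: p phi j y y' => [|p IH] phi j y y' /=; first by move=> -> ->.
move=> [yj yN yb] [y'j y'N y'b]; apply/eqP; rewrite -subr_eq0; apply/eqP.
move: yN y'N; rewrite /codeg; case: ifP => [pN yN y'N|_ -> ->]; last by rewrite subrr.
have := N_min (n := N - p.+1) (x := y - y'); rewrite preproj_homogB yN y'N; apply.
  by rewrite ltn_subrL /= (leq_trans _ pN).
move=> b; rewrite -yj -y'j -mulrBl -mulrA; have [bj|bj] := eqVneq (tgt b) j.
  rewrite -bj arrow_tgtK mulrBl; apply/eqP; rewrite subr_eq0; apply/eqP.
  by apply: IH (yb b bj) (y'b b bj).
rewrite -arrow_tgtK [ev j * _]mulrA; have -> : ev j * ev (tgt b) = 0.
  by rewrite lvertex_orth // eq_sym.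
by rewrite mul0r mulr0.
Qed.

Lemma comultD p phi psi j y y' : comult p phi j y -> comult p psi j y' ->
  comult p (fun z => phi z + psi z) j (y + y').
Proof.
elim: p phi psi j y y' => [|p IH] phi psi j y y' /=.
  by move=> -> ->; case: ifP; rewrite ?scalerDl ?addr0.
move=> [yj yN yb] [y'j y'N y'b]; split=> [||b bj].
- by rewrite mulrDl yj y'j.
- move: yN y'N; rewrite /codeg; case: ifP => _; last by move=> -> ->; rewrite addr0.
  by rewrite preproj_homogD => -> ->.
- by rewrite mulrDl; exact: IH (yb b bj) (y'b b bj).
Qed.

Lemma comult0 p j : comult p (fun _ => 0) j 0.
Proof.
elim: p j => [|p IH] j /=; first by rewrite scale0r if_same.
split=> [||b bj]; rewrite ?mul0r //; first by rewrite /codeg preproj_homog0 if_same.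
Qed.

Lemma comult_sum p j (I : finType) (P : pred I) (phi : I -> Lambda -> k) (Y : I -> Lambda) :
  (forall i, P i -> comult p (phi i) j (Y i)) ->
  comult p (fun z => \sum_(i | P i) phi i z) j (\sum_(i | P i) Y i).
Proof.
move=> h.
suff : forall r : seq I, comult p (fun z => \sum_(i <- r | P i) phi i z) j
    (\sum_(i <- r | P i) Y i) by apply.
elim=> [|i r IH].
  rewrite big_nil; have -> : (fun z => \sum_(i <- [::] | P i) phi i z) = (fun=> 0).
    by apply/funext => z; rewrite big_nil.
  exact: comult0.
rewrite big_cons; case: ifP => Pi.
  have -> : (fun z => \sum_(i <- i :: r | P i) phi i z) =
      (fun z => phi i z + \sum_(i <- r | P i) phi i z).
    by apply/funext => z; rewrite big_cons Pi.
  by apply: comultD => //; exact: h.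
have -> // : (fun z => \sum_(i <- i :: r | P i) phi i z) =
    (fun z => \sum_(i <- r | P i) phi i z).
by apply/funext => z; rewrite big_cons Pi.
Qed.

Lemma comult_codeg p phi j y : comult p phi j y -> codeg p y.
Proof.
case: p => [|p] /=; last by case.
move=> ->; rewrite /codeg subn0 leq0n; case: ifP => _; last exact: preproj_homog0.
by rewrite preproj_homogZ x0_homog.
Qed.

Lemma comult_vertex p phi j y : comult p phi j y -> y * ev j = y.
Proof.
case: p => [|p] /=; last by case.
by move=> ->; case: eqP => [->|_]; rewrite ?mul0r // -scalerAl x0_end.
Qed.

Lemma comultN p phi j y : comult p phi j y -> comult p (fun z => - phi z) j (- y).
Proof.
elim: p phi j y => [|p IH] phi j y /=.
  by move=> ->; case: ifP; rewrite ?scaleNr ?oppr0.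
move=> [yj yN yb]; split=> [||b bj]; rewrite ?mulNr ?yj //; last exact: IH (yb b bj).
move: yN; rewrite /codeg; case: ifP => _; last by move=> ->; rewrite oppr0.
by rewrite -sub0r preproj_homogB preproj_homog0 => ->.
Qed.

Lemma comult_sign p phi j y c : comult p phi j y ->
  comult p (fun z => if c is inl _ then - phi z else phi z) j (arrow_sign k c * y).
Proof. by case: c => h; rewrite /= ?mulN1r ?mul1r //; exact: comultN. Qed.

(** The values Y_b required of y b come from the functionals z |-> phi (b z). The signed combination
    of them that must vanish solves the problem for z |-> phi (r z), where r is the mesh relation at
    j; this functional is zero, so uniqueness applies. Exactness of the mesh sequence then supplies
    y. *)
Lemma comult_exists p phi j :
  (forall z z', phi (z + z') = phi z + phi z') -> exists y, comult p phi j y.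
Proof.
elim: p phi j => [|p IH] phi j phiD; first by exists (if j == l then phi (ev l) *: x0 else 0).
have phi0 : phi 0 = 0 by apply: (addrI (phi 0)); rewrite -phiD !addr0.
have phiN z : phi (- z) = - phi z.
  by apply: (addrI (phi z)); rewrite -phiD !addrN phi0.
have phi_sum (I : finType) (P : pred I) F :
    phi (\sum_(i | P i) F i) = \sum_(i | P i) phi (F i).
  exact: (big_morph phi phiD phi0).
have /choice[Y YP] b : exists y, comult p (fun z => phi (ar b * z)) (src b) y.
  by apply: IH => z z'; rewrite mulrDr phiD.
pose F c := arrow_sign k c * Y (opp_arrow c).
have FT c : src c = j -> F c * ev (tgt c) = F c.
  by move=> cj; rewrite /F -mulrA -[tgt c]src_opp_arrow (comult_vertex (YP _)).
have F0 : \sum_(c : arr DQ | src c == j) F c * ar c = 0.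
  (* For p = 0 the recursion of [comult] has no arrow to offer, but the Y_b are multiples of x0,
     which every arrow kills. *)
  case: p YP {IH} => [|p] YP.
    apply: big1 => c _; rewrite /F -mulrA; have /= -> := YP (opp_arrow c).
    by case: ifP => _; rewrite ?mul0r ?mulr0 // -scalerAl x0_ann scaler0 mulr0.
  apply: (@comult_unique p (fun=> 0) j); last exact: comult0.
  have : comult p (fun z => \sum_(c : arr DQ | src c == j)
      (if c is inl _ then - phi (ar (opp_arrow c) * (ar c * z))
       else phi (ar (opp_arrow c) * (ar c * z)))) j
      (\sum_(c : arr DQ | src c == j) F c * ar c).
    apply: comult_sum => c /eqP cj; rewrite /F -mulrA.
    have [_ _ h] := YP (opp_arrow c).
    by have := comult_sign c (h c (esym (src_opp_arrow c))); rewrite cj.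
  congr (comult _ _ _ _); apply/funext => z.
  transitivity (phi (\sum_(c : arr DQ | src c == j)
      arrow_sign k c * (ar (opp_arrow c) * ar c) * z)).
    rewrite phi_sum; apply: eq_bigr => c _; rewrite -!mulrA.
    by case: (c) => h; rewrite /= ?mulN1r ?mul1r ?phiN.
  by rewrite -mulr_suml mesh_relation mul0r phi0.
have [y yj yF] := preproj_exact_middle FT F0.
have yb b : tgt b = j -> y * ar b = Y b.
  move=> bj; have := yF (opp_arrow b); rewrite src_opp_arrow opp_arrowK => /(_ bj).
  rewrite /F opp_arrowK => /(congr1 (fun z => arrow_sign k (opp_arrow b) * z)).
  by rewrite !mulrA arrow_sign_sqr !mul1r.
(* The y found need not be homogeneous: its component of degree N - (p + 1) is kept. For p >= N no
   such degree is left, and 0 solves the problem. *)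
exists (if (p < N)%N then hom (N - p.+1) y else 0); rewrite /=; split.
- by case: ifP; rewrite ?mul0r // -preproj_homog_vertex yj.
- by rewrite /codeg; case: (p < N)%N; rewrite // preproj_homog_homog eqxx.
- move=> b bj; suff -> : (if (p < N)%N then hom (N - p.+1) y else 0) * ar b = Y b by [].
  have := comult_codeg (YP b); rewrite /codeg; case: (ltngtP p N) => [pN|pN|pN].
  + by rewrite -yb // -preproj_homog_arrowS -subSn // subSS.
  + by rewrite mul0r.
  + by rewrite pN subnn -yb // preproj_homog_arrow0 mul0r.
Qed.

(** Removing the last arrow of the path unwinds the recursion down to phi (e_l) x0 at the trivial
    path. *)
Lemma comult_path p phi j y s : comult p phi j y -> size s = p ->
  is_path (Q := DQ) l s -> @endpoint DQ l s = j -> y * lpath l s = phi (lpath l s) *: x0.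
Proof.
elim: p phi j y s => [|p IH] phi j y s.
  by move=> /= -> /size0nil-> _ /= <-; rewrite eqxx -scalerAl x0_end.
case/lastP: s => [//|s b]; rewrite size_rcons => -[yj _ yb] [sp] ps.
rewrite -cats1 endpoint_cat /endpoint /= => bj.
have -> : lpath l (s ++ [:: b]) = ar b * lpath l s.
  by rewrite cats1 -rmorphM path_arrow_mul_delta.
rewrite mulrA; move: ps; rewrite -cats1 is_path_cat /= andbT => /andP[ps /eqP sb].
exact: (IH _ _ _ s (yb b bj)).
Qed.

(** On a nonzero path some functional would not vanish, although its representative has codegree N +
    1 and is therefore 0. *)
Lemma socle_degree_path s : size s = N.+1 -> x0 <> 0 -> lpath l s = 0.
Proof.
move=> sN x0n; have [ps|ps] := boolP (is_path (Q := DQ) l s); last first.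
  rewrite /lpath; have -> : @path_delta k DQ l s = 0; last exact: raddf0.
  apply: path_algebraP => i t; rewrite /= /path_delta_fun (negPf ps) andbF.
  by [].
apply: contrapT => w0; have wP : linear (fun a : k^o => (a : k) *: lpath l s : Lambda).
  by move=> a b c; rewrite scalerDl scalerA.
pose w : {linear k^o -> Lambda} := lin_of wP.
(* A generalized inverse of the map from k with image spanned by the path is a functional that does
   not vanish on it. *)
have [r [wr _]] := generalized_inverse w.
have rD z z' : (r (z + z') : k) = r z + r z' by exact: linearD.
have [y yP] := comult_exists N.+1 (@endpoint DQ l s) rD.
have := comult_codeg yP; rewrite /codeg ltnn => y0.
have := comult_path yP sN ps erefl; rewrite y0 mul0r => /esym r0.
have rw : (r (lpath l s) : k) != 0.
  apply: contra_notN w0 => /eqP rw; have := wr 1; rewrite /= scale1r rw.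
  by rewrite scale0r.
by apply: x0n; rewrite -[x0]scale1r -(mulVf rw) -scalerA r0 scaler0.
Qed.
End SocleDegree.
End Injectivity.

(** Without loops, exactly one of h and its opposite leads from j to r when h is an edge between
    them. *)
Lemma double_arrow_count (Q : quiver) (j r : vert Q) : quiver_acyclic Q ->
  #|[set b : arr (double_quiver Q) | (src b == j) && (tgt b == r)]| = #|edges j r|.
Proof.
move=> Qa; pose f (b : arr (double_quiver Q)) : arr Q := match b with inl h => h | inr h => h end.
have noloop (h : arr Q) : src h != tgt h.
  apply/negP => /eqP hl; have := Qa (src h) [:: h].
  by rewrite /endpoint /= eqxx hl => /(_ isT erefl).
rewrite -(card_in_imset (f := f)).
  apply: eq_card => h; rewrite !inE; apply/imsetP/orP => [[[h'|h'] + ->]|[hh|hh]].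
  - by rewrite !inE /=; left.
  - by rewrite !inE /= andbC; right.
  - by exists (inl h); rewrite ?inE.
  - by exists (inr h); rewrite ?inE //= andbC.
move=> [h|h] [h'|h']; rewrite !inE /f /= => /andP[/eqP h1 /eqP h2] /andP[/eqP h3 /eqP h4] hE.
- by rewrite hE.
- by move: (noloop h); rewrite h1 hE h3 eqxx.
- by move: (noloop h); rewrite h1 hE h3 eqxx.
- by rewrite hE.
Qed.

Lemma double_arrow_sum (Q : quiver) (G : vert Q -> nat) (j : vert Q) : quiver_acyclic Q ->
  (\sum_(b : arr (double_quiver Q) | src b == j) G (tgt b) = \sum_r #|edges j r| * G r)%N.
Proof.
move=> Qa; rewrite (partition_big (fun b : arr (double_quiver Q) => tgt b : vert Q) xpredT) //=.
apply: eq_bigr => r _; rewrite -double_arrow_count // -sum_nat_const.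
by apply: eq_big => b; rewrite ?inE // => /andP[_ /eqP->].
Qed.

(** * Finite dimensionality and the contradiction with non-Dynkin type *)

Section Injectivity.
Variables (k : fieldType) (Q : quiver).
Hypotheses (Q_connected : quiver_connected Q) (Q_acyclic : quiver_acyclic Q).
Hypothesis Q_not_dynkin : ~ dynkin_type Q.
Local Notation DQ := (double_quiver Q).
Local Notation kQQ := (path_algebra k DQ).
Local Notation Lambda := (preprojective k Q).
Local Notation pi := (@preproj_pi k Q).
Local Notation pv j := (@path_vertex k DQ j).
Local Notation pa b := (@path_arrow k DQ b).
Local Notation ev j := (@lvertex k Q j).
Local Notation ar b := (@preproj_arrow k Q b).
Local Notation hom := (@preproj_homog k Q).
Implicit Types (x y z : Lambda) (f g : kQQ) (j l : vert Q) (b c : arr DQ).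

Definition dies_at l := exists n0, forall n x, (n0 <= n)%N -> hom n (x * ev l) = 0.

Lemma lpath_dies N l : (forall s, size s = N -> @lpath k Q l s = 0) -> dies_at l.
Proof.
move=> lN; exists N => n x Nn; elim/preproj_ind: x => f.
rewrite -rmorphM preproj_homog_pi path_homog_expand raddf_sum big1 // => i _.
rewrite raddf_sum big1 // => t _; rewrite -[LHS]/(pi (_ *: _)) preproj_pi_scale mul_path_vertex.
case: (i =P l) => [->|_]; last by rewrite scale0r.
rewrite -[pi _]/(@lpath k Q l t) -(cat_take_drop N t).
have [p|p] := boolP (@is_path DQ l (take N t ++ drop N t)); last first.
  rewrite /lpath (_ : path_delta _ _ _ = 0) ?raddf0 ?scaler0 //.
  by apply: path_algebraP => i' t'; rewrite /= /path_delta_fun (negPf p) andbF.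
rewrite /lpath path_delta_cat // rmorphM /= -[pi (@path_delta k DQ l _)]/(@lpath k Q l (take N t)).
by rewrite lN ?mulr0 ?scaler0 // size_takel // size_tuple.
Qed.

(** For y of large degree in Lambda e_(tgt b), the product y b lies in Lambda e_(src b) and
    vanishes. So the family with y at b and 0 elsewhere is a relation; by exactness y is, up to
    sign, z times the opposite of b with z in Lambda e_(src b), and in that degree z is 0. *)
Lemma dies_at_next b : dies_at (src b) -> dies_at (tgt b).
Proof.
move=> [n0 h0]; exists n0.+1 => n x; case: n => // n hn; set y := hom _ _.
have yE : y = hom n.+1 x * ev (tgt b) by rewrite /y preproj_homog_vertex.
have yt : y * ev (tgt b) = y by rewrite yE -mulrA lvertex_idem.
have yb : y * ar b = 0.
  by rewrite -preproj_homog_arrowS -(arrow_srcK k b) mulrA h0 // ltnW // ltnW.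
pose F c := if c == b then y else 0.
have [||z zl zF] := @preproj_exact_middle k Q (src b) F.
- by move=> c _; rewrite /F; case: eqP => [->//|_]; rewrite mul0r.
- rewrite (bigD1 b) //= big1 /= ?addr0 => [|c /andP[_ /negPf cb]]; rewrite /F ?eqxx //.
  by rewrite cb mul0r.
have := zF b erefl; rewrite /F eqxx => yz.
have yh : hom n.+1 y = y by rewrite /y preproj_homog_homog eqxx.
have : hom n.+1 (z * ar (opp_arrow b)) = 0.
  by rewrite preproj_homog_arrowS -zl h0 // mul0r.
rewrite -yh yz; case: (b) => h /=; rewrite ?mul1r // mulN1r => e.
by rewrite -sub0r preproj_homogB e preproj_homog0 subr0.
Qed.

Lemma dies_everywhere l : dies_at l -> exists n0, forall n x, (n0 <= n)%N -> hom n x = 0.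
Proof.
move=> dl; have dj j : dies_at j.
  have /connectP[p] := Q_connected l j.
  elim: p l dl => [|r p IH] l' dl' /=; first by move=> _ ->.
  move=> /andP[/set0Pn[h]]; rewrite inE => /orP[]/andP[/eqP h1 /eqP h2] rp jE.
    by apply: IH rp jE; rewrite -h2; apply: (@dies_at_next (inl h)); rewrite /= h1.
  by apply: IH rp jE; rewrite -h1; apply: (@dies_at_next (inr h)); rewrite /= h2.
have /choice[n0 n0P] := dj; exists (\max_j n0 j)%N => n x hn.
rewrite -[x]mulr1 -(lvertex_sum k Q) mulr_sumr.
rewrite (big_morph _ (preproj_homogD n) (preproj_homog0 k Q n)) big1 // => j _.
by apply: n0P; apply: leq_trans hn; exact: leq_bigmax.
Qed.

Lemma preproj_span n0 : (forall n x, (n0 <= n)%N -> hom n x = 0) ->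
  exists (J : finType) (w : J -> Lambda), forall x, exists c : J -> k, x = \sum_j c j *: w j.
Proof.
move=> h0; pose J := {n : 'I_n0 & (vert Q * n.-tuple (arr DQ))%type}.
exists J, (fun p : J => @lpath k Q (tagged p).1 (tagged p).2) => x.
elim/preproj_ind: x => f; exists (fun p : J => f ((tagged p).1, val (tagged p).2)).
have -> : pi f = \sum_(n < n0) hom n (pi f).
  have [N [fN fE]] := preproj_homog_sum (pi f).
  have E m M : (forall n, (m <= n)%N -> hom n (pi f) = 0) -> (m <= M)%N ->
      \sum_(n < m) hom n (pi f) = \sum_(n < M) hom n (pi f).
    move=> hm mM; rewrite (@big_ord_widen _ _ _ m M (fun n => hom n (pi f)) mM).
    rewrite [RHS](bigID (fun n : 'I_M => (n < m)%N)) /= [X in _ + X]big1 ?addr0 //.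
    by move=> n; rewrite -leqNgt => /hm.
  rewrite (E n0 (N + n0)%N) ?leq_addl // => [|n /h0 //].
  by rewrite -(E N) ?leq_addr.
transitivity (\sum_(n < n0) \sum_(p : vert Q * n.-tuple (arr DQ))
    f (p.1, val p.2) *: @lpath k Q p.1 p.2); last by rewrite sig_big_dep.
apply: eq_bigr => n _; rewrite preproj_homog_pi path_homog_expand raddf_sum.
rewrite -(pair_big xpredT xpredT (fun i (t : n.-tuple (arr DQ)) =>
  f (i, val t) *: @lpath k Q i t)) /=; apply: eq_bigr => i _.
by rewrite raddf_sum; apply: eq_bigr => t _; exact: preproj_pi_scale.
Qed.

Section FiniteDimensional.
Variables (J : finType) (w : J -> Lambda).
Hypothesis w_span : forall x, exists c : J -> k, x = \sum_j c j *: w j.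

Let radical j x := x * ev j = x /\ preproj_char j x = 0.

Let radical_dim_exists : exists (g : vert Q -> nat) (v : vert Q -> nat -> Lambda), forall j,
  [/\ forall c : 'I_(g j) -> k, \sum_i c i *: v j i = 0 -> forall i, c i = 0,
      forall i : 'I_(g j), radical j (v j i) &
      forall x, radical j x -> exists c : 'I_(g j) -> k, x = \sum_i c i *: v j i].
Proof.
suff /choice[gv gvP] : forall j, exists gv : nat * (nat -> Lambda),
  [/\ forall c : 'I_gv.1 -> k, \sum_i c i *: gv.2 i = 0 -> forall i, c i = 0,
      forall i : 'I_gv.1, radical j (gv.2 i) &
      forall x, radical j x -> exists c : 'I_gv.1 -> k, x = \sum_i c i *: gv.2 i].
  by exists (fun j => (gv j).1), (fun j => (gv j).2).
move=> j; have [n [v [vI vU vs]]] := finite_basis (radical j) w_span.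
exists (n, fun i => oapp v 0 (insub i)) => /=.
have E (i : 'I_n) : oapp v 0 (insub (val i)) = v i by rewrite valK.
split=> [c|i|x /vs[c ->]]; last by exists c; apply: eq_bigr => i _; rewrite E.
  by under eq_bigr => i _ do rewrite E; exact: vI.
by rewrite E.
Qed.

(* From 0 -> K_j -> Lambda e_j -> (+)_b Lambda e_(tgt b) -> Lambda e_j -> S_j -> 0. *)
Lemma mesh_dimension : exists G : vert Q -> nat,
  forall j, ((\sum_(b : arr DQ | src b == j) G (tgt b)) < 2 * G j)%N.
Proof.
(* Here g j is the dimension of the kernel of Lambda e_j -> S_j, so G_j = g j + 1 is that of Lambda
   e_j. The middle term will be spanned by G_j + g j = 2 G_j - 1 elements, whence the strict
   inequality. *)
have [g [v vP]] := radical_dim_exists; exists (fun j => (g j).+1) => j.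
pose u j m := if m is m'.+1 then v j m' else ev j.
have charZ (a : k) x r : preproj_char r (a *: x) = a * preproj_char r x.
  by elim/preproj_ind: x => f; rewrite -preproj_pi_scale !preproj_char_pi.
have char_sum r (I : finType) (F : I -> Lambda) :
    preproj_char r (\sum_i F i) = \sum_i preproj_char r (F i) by exact: raddf_sum.
have u_end r (m : 'I_(g r).+1) : u r m * ev r = u r m.
  case: (unliftP ord0 m) => [i ->|->] /=; last exact: lvertex_idem.
  by have [_ /(_ i)[] ] := vP r.
have u_free r n : n = (g r).+1 \/ n = 0%N -> forall c : 'I_n -> k,
    \sum_i c i *: u r i = 0 -> forall i, c i = 0.
  case=> -> c; last by move=> _ [].
  rewrite big_ord_recl /= => E; have c0 : c ord0 = 0.
    have := congr1 (preproj_char r) E; rewrite [preproj_char r _]raddfD /= charZ.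
    rewrite lvertex_char eqxx mulr1 char_sum big1 => [|i _]; last first.
      by rewrite charZ; have [_ /(_ i)[_ ->] _] := vP r; rewrite mulr0.
    by rewrite addr0 => ->; exact: raddf0.
  move=> i; case: (unliftP ord0 i) => [i' ->|-> //].
  have [vI _ _] := vP r; apply: (vI (fun i => c (lift ord0 i))).
  by move: E; rewrite c0 scale0r add0r.
have u_span r x : x * ev r = x -> exists c : 'I_(g r).+1 -> k, x = \sum_i c i *: u r i.
  move=> xr; have [_ _ vs] := vP r; pose a := preproj_char r x.
  have /vs[c xE] : radical r (x - a *: ev r).
    split; first by rewrite mulrBl xr -scalerAl lvertex_idem.
    by rewrite [LHS]raddfB /= charZ lvertex_char eqxx mulr1 subrr.
  exists (fun m => oapp c a (unlift ord0 m)).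
  rewrite big_ord_recl unlift_none /=; under eq_bigr => i _ do rewrite liftK /=.
  by rewrite -xE addrC subrK.
have /choice[F FP] (i : 'I_(g j)) : exists F : arr DQ -> Lambda,
    (forall b, F b * ev (tgt b) = F b) /\
    v j i = \sum_(b : arr DQ | src b == j) F b * ar b.
  have [_ /(_ i)[vj v0] _] := vP j; have [F [Ft FE]] := preproj_rdiv vj.
  by exists F; split=> //; rewrite FE v0 scale0r add0r.
pose n b := if src b == j then (g (tgt b)).+1 else 0%N.
pose fam (p : {b : arr DQ & 'I_(n b)}) : {ffun arr DQ -> Lambda} :=
  [ffun b : arr DQ => if b == tag p then u (tgt b) (tagged p) else 0].
(* A spanning family of the middle term: the image of a basis of Lambda e_j under the second map of
   the mesh sequence, and preimages of a basis of the kernel of Lambda e_j -> S_j under (h_b) |->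
   sum of the h_b b. *)
pose gen (m : 'I_(g j).+1 + 'I_(g j)) : {ffun arr DQ -> Lambda} :=
  [ffun b : arr DQ => if src b == j then
     match m with inl m => @arrow_sign k Q b * (u j m * ar (@opp_arrow Q b))
                | inr i => F i b end else 0].
have famI : independent fam.
  move=> c E [b0 i0] /=.
  have hn : n b0 = (g (tgt b0)).+1 \/ n b0 = 0%N by rewrite /n; case: ifP; [left|right].
  pose tg b (i : 'I_(n b)) : {b : arr DQ & 'I_(n b)} := Tagged (fun b => 'I_(n b)) i.
  apply: (u_free _ _ hn (fun i => c (tg b0 i))).
  have := congr1 (fun h : {ffun arr DQ -> Lambda} => h b0) E; rewrite sum_ffunE ffunE => E0.
  rewrite -[RHS]E0.
  transitivity (\sum_(b : arr DQ) \sum_(i : 'I_(n b)) (c (tg b i) *: fam (tg b i)) b0).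
    rewrite (bigD1 b0) //= [X in _ = _ + X]big1 ?addr0 => [|b bb]; last first.
      by apply: big1 => i _; rewrite !ffunE /= eq_sym (negPf bb) scaler0.
    by apply: eq_bigr => i _; rewrite !ffunE /= eqxx.
  by rewrite sig_big_dep; apply: eq_bigr => -[b i].
have gen_span (h : {ffun arr DQ -> Lambda}) : (forall b, h b * ev (tgt b) = h b) ->
    (forall b, src b != j -> h b = 0) -> exists a : _ -> k, h = \sum_m a m *: gen m.
  move=> ht hj; pose z := \sum_(b : arr DQ | src b == j) h b * ar b.
  have [_ _ /(_ z)[|d zE]] := vP j.
    split; first by rewrite mulr_suml; apply: eq_bigr => b /eqP <-; rewrite -mulrA arrow_srcK.
    rewrite [LHS]raddf_sum big1 // => b _; rewrite [LHS]rmorphM /= arrow_char mulr0 //.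
  (* Subtracting the chosen preimages turns h into a relation, which comes from Lambda e_j by
     exactness. *)
  pose h' b := h b - \sum_i d i *: F i b.
  have [b bj||y yj yE] := @preproj_exact_middle k Q j h'.
  - rewrite mulrBl ht mulr_suml; congr (_ - _); apply: eq_bigr => i _.
    by rewrite -scalerAl (FP i).1.
  - under eq_bigr => b _ do rewrite mulrBl mulr_suml.
    rewrite sumrB -/z exchange_big /= zE -sumrB big1 // => i _.
    rewrite (FP i).2 scaler_sumr -sumrB big1 // => b _.
    by rewrite scalerAl subrr.
  have [e yu] := u_span _ _ yj.
  exists (fun m => match m with inl m => e m | inr i => d i end).
  apply/ffunP => b; rewrite sum_ffunE big_sumType /=.
  have [bj|bj] := boolP (src b == j); last first.
    rewrite hj // !big1 ?addr0 // => m _; rewrite !ffunE (negPf bj) scaler0 //.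
  have -> : h b = h' b + \sum_i d i *: F i b by rewrite subrK.
  rewrite yE ?(eqP bj) // {1}yu mulr_suml mulr_sumr; congr (_ + _).
    by apply: eq_bigr => m _; rewrite !ffunE bj -scalerAl -scalerAr.
  by apply: eq_bigr => i _; rewrite !ffunE bj.
have := independent_card famI (w := gen); rewrite card_sum !card_ord card_tagged.
have -> : sumn [seq #|'I_(n b)| | b <- enum (arr DQ)] =
    (\sum_(b : arr DQ | src b == j) (g (tgt b)).+1)%N.
  rewrite sumnE big_map big_enum /= [RHS]big_mkcond; apply: eq_bigr => b _.
  by rewrite card_ord.
suff h p : exists a : _ -> k, fam p = \sum_m a m *: gen m by move=> /(_ h); lia.
case: p => b i; have bj : src b == j by move: i; rewrite /n; case: ifP => // _ [].
apply: gen_span => [b'|b' b'j]; rewrite ffunE /=; last first.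
  by case: eqP => // bb; move: b'j; rewrite bb bj.
case: eqP => [->|_]; last by rewrite mul0r.
by move: i; rewrite /n bj => i; exact: u_end.
Qed.
End FiniteDimensional.

Theorem preproj_mul_arrow_inj x : (forall b, x * ar b = 0) -> x = 0.
Proof.
move=> x_ann; apply: contrapT => x_neq0.
have [N [[y [y_ann yN]] Nmin]] : exists N, (exists y, path_annihilated y /\ hom N y <> 0) /\
    forall n y, (n < N)%N -> path_annihilated y -> hom n y = 0.
  pose A n := `[< exists y, path_annihilated y /\ hom n y <> 0 >].
  have exA : exists n, A n.
    by have [n xn] := preproj_homog_neq0 x_neq0; exists n; apply/asboolP; exists x.
  case: (ex_minnP exA) => N /asboolP AN minN; exists N; split=> // n z nN z_ann.
  apply: contrapT => zn; have := minN n; rewrite leqNgt nN => /(_ _)/negP; apply=> //.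
  by apply/asboolP; exists z.
(* The duality needs an element whose paths all start at one vertex. *)
have [l yl] : exists l, hom N y * ev l <> 0.
  apply: contrapT => /forallNP h; apply: yN.
  rewrite -[LHS]mulr1 -(lvertex_sum k Q) mulr_sumr big1 // => l _; exact: contrapT (h l).
have [n0 h0] : exists n0, forall n x, (n0 <= n)%N -> hom n x = 0.
  apply: (@dies_everywhere l); apply: (@lpath_dies N.+1) => s sN.
  apply: (@socle_degree_path k Q N l (hom N y * ev l)) => //.
  - move=> b; rewrite -mulrA; have [bl|bl] := eqVneq (tgt b) l.
      by rewrite -bl arrow_tgtK -preproj_homog_arrowS y_ann preproj_homog0.
    by rewrite -(arrow_tgtK k b) [ev l * _]mulrA lvertex_orth ?mul0r ?mulr0 // eq_sym.
  - by rewrite -mulrA lvertex_idem.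
  - by rewrite preproj_homog_vertex preproj_homog_homog eqxx.
have [J [w w_span]] := preproj_span h0.
have [G GP] := mesh_dimension w_span.
have [delta [v0 dv0] dP] := nondynkin_subadditive Q_connected Q_acyclic Q_not_dynkin.
(* Pairing with delta keeps the inequality strict because it is strict at v0, where delta is
   positive. *)
have H1 : (\sum_j delta j * (\sum_r #|edges j r| * G r) < \sum_j delta j * (2 * G j))%N.
  rewrite [ltnLHS](bigD1 v0) // [ltnRHS](bigD1 v0) //= -addSn leq_add //.
    by rewrite ltn_pmul2l ?lt0n // -double_arrow_sum.
  apply: leq_sum => j _; rewrite leq_mul2l -double_arrow_sum // ltnW ?orbT //.
have : (\sum_j delta j * (2 * G j) <= \sum_j delta j * (\sum_r #|edges j r| * G r))%N.
  have -> : (\sum_j delta j * (\sum_r #|edges j r| * G r) =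
      \sum_r G r * (\sum_j #|edges r j| * delta j))%N.
    under eq_bigr => j _ do rewrite big_distrr /=.
    rewrite exchange_big; apply: eq_bigr => r _; rewrite big_distrr /=.
    apply: eq_bigr => j _; rewrite mulnC [(#|_| * G r)%N]mulnC -mulnA.
    by congr (_ * (_ * _))%N; apply: eq_card => h; rewrite !inE orbC.
  apply: leq_sum => j _; rewrite [(delta j * _)%N]mulnC -mulnA mulnCA leq_mul2l.
  by rewrite dP orbT.
by rewrite leqNgt H1.
Qed.
End Injectivity.

(** * Projective resolutions of the simple modules *)

Lemma subquot_dim_ext (k : fieldType) (V : lmodType k) (Z Z' B B' : V -> Prop) n :
  (forall v, Z v <-> Z' v) -> (forall v, B v <-> B' v) ->
  subquot_dim Z B n -> subquot_dim Z' B' n.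
Proof.
move=> ZZ BB [b [bZ bu]]; exists b; split=> [i|z /ZZ/bu[c [cB cu]]]; first exact/ZZ.
by exists c; split=> [|c' /BB/cu]; first exact/BB.
Qed.

Lemma homk_sumE (k : fieldType) (L : algType k) (U M : lmodType L) (I : Type)
    (s : seq I) (P : pred I) (F : I -> homk U M) x :
  homk_fun (\sum_(i <- s | P i) F i) x = \sum_(i <- s | P i) homk_fun (F i) x.
Proof. by elim/big_rec2: _ => // i f y _ <-. Qed.

(** * Direct sums of left ideals generated by idempotents *)

Section IdempotentModule.
Variables (k : fieldType) (L : algType k) (I : finType) (r : I -> L).

Definition pmod_pred : {pred {ffun I -> L^o}} :=
  fun x => [forall b, x b * r b == x b].

Lemma pmod_submod_closed : submod_closed pmod_pred.
Proof.
split=> [|a x y /forallP hx /forallP hy]; apply/forallP => b.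
  by rewrite ffunE mul0r.
by rewrite !ffunE mulrDl -[_ *: _]/(_ * _) -mulrA (eqP (hx b)) (eqP (hy b)).
Qed.

HB.instance Definition _ := GRing.isSubmodClosed.Build L {ffun I -> L^o} pmod_pred
  pmod_submod_closed.

(* The direct sum of the left ideals L r_b; the r_b will be idempotent. *)
Record pmod := Pmod { pmod_val :> {ffun I -> L^o}; pmod_valP : pmod_val \in pmod_pred }.

HB.instance Definition _ := [isSub for pmod_val].
HB.instance Definition _ := [Choice of pmod by <:].
HB.instance Definition _ := [SubChoice_isSubLmodule of pmod by <:].

Lemma pmodK (x : pmod) b : (x b : L) * r b = x b.
Proof. by have /forallP/(_ b)/eqP := pmod_valP x. Qed.

Lemma pmod_ext (x y : pmod) : (forall b, x b = y b) -> x = y.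
Proof. by move=> h; apply/val_inj/ffunP. Qed.

Lemma pmodD (x y : pmod) b : (x + y : pmod) b = x b + y b.
Proof. exact: ffunE. Qed.
Lemma pmodZ (a : L) (x : pmod) b : (a *: x : pmod) b = a * x b.
Proof. exact: ffunE. Qed.
Lemma pmod0 b : (0 : pmod) b = 0.
Proof. exact: ffunE. Qed.
Lemma pmod_sum (J : finType) (F : J -> pmod) b : (\sum_j F j : pmod) b = \sum_j F j b.
Proof. by rewrite (big_morph (fun x : pmod => x b) (fun x y => pmodD x y b) (pmod0 b)). Qed.

Definition pmod_of (F : I -> L) (FP : forall b, F b * r b = F b) : pmod.
Proof. by exists [ffun b => F b]; apply/forallP => b; rewrite ffunE FP. Defined.

Lemma pmod_ofE F FP b : @pmod_of F FP b = F b.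
Proof. exact: ffunE. Qed.

Lemma pmod_map_linear (M : lmodType L) (u : I -> M) :
  linear (fun x : pmod => \sum_b (x b : L) *: u b).
Proof.
move=> a x y.
transitivity (\sum_b (a *: ((x b : L) *: u b) + (y b : L) *: u b)); last first.
  by rewrite big_split scaler_sumr.
by apply: eq_bigr => b _; rewrite pmodD pmodZ scalerDl scalerA.
Qed.

Definition pmod_map (M : lmodType L) (u : I -> M) : {linear pmod -> M} :=
  lin_of (pmod_map_linear u).

Lemma pmod_mapE (M : lmodType L) (u : I -> M) x : pmod_map u x = \sum_b (x b : L) *: u b.
Proof. by []. Qed.

Hypothesis r_idem : forall b, r b * r b = r b.

Lemma pmod_gen_subproof b c : (if c == b then r b else 0) * r c = if c == b then r b else 0.
Proof. by case: eqP => [->|_]; rewrite ?mul0r ?r_idem. Qed.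

Definition pmod_gen b : pmod := pmod_of (pmod_gen_subproof b).

Lemma pmod_expand (x : pmod) : x = \sum_b (x b : L) *: pmod_gen b.
Proof.
apply: pmod_ext => c; rewrite pmod_sum (bigD1 c) // big1 => [|b bc].
  by rewrite [RHS]addr0 pmodZ pmod_ofE eqxx pmodK.
by rewrite pmodZ pmod_ofE eq_sym (negPf bc) mulr0.
Qed.

Lemma pmod_linearE (M : lmodType L) (f : {linear pmod -> M}) x :
  f x = \sum_b (x b : L) *: f (pmod_gen b).
Proof. by rewrite [in LHS](pmod_expand x) linear_sum; apply: eq_bigr => b _; rewrite linearZ. Qed.

Lemma pmod_genK b : r b *: pmod_gen b = pmod_gen b.
Proof. by apply: pmod_ext => c; rewrite pmodZ pmod_ofE; case: eqP; rewrite ?r_idem ?mulr0. Qed.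

Lemma pmod_map_gen (M : lmodType L) (u : I -> M) b :
  r b *: u b = u b -> pmod_map u (pmod_gen b) = u b.
Proof.
move=> ub; rewrite pmod_mapE (bigD1 b) // big1 => [|c cb].
  by rewrite [LHS]addr0 pmod_ofE eqxx.
by rewrite pmod_ofE (negPf cb) scale0r.
Qed.

Lemma pmod_projective : projective pmod.
Proof.
move=> M N p f p_surj; have /choice[m mE] b : exists m, p m = f (pmod_gen b).
  by have [m] := p_surj (f (pmod_gen b)); exists m.
exists (pmod_map (fun b => r b *: m b)) => x.
rewrite [RHS]pmod_linearE /= linear_sum; apply: eq_bigr => b _.
by rewrite !linearZ /= mE -linearZ /= pmod_genK.
Qed.

Lemma pmod_fg_projective : fg_projective pmod.
Proof.
split; last exact: pmod_projective.
exists #|I|, (fun a => pmod_gen (enum_val a)) => x; exists (fun a => x (enum_val a)).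
rewrite {1}(pmod_expand x) (reindex (@enum_val _ I)) //.
by exists enum_rank => b _; rewrite ?enum_valK ?enum_rankK.
Qed.

Lemma pmod_hom_ext (M : lmodType L) (f g : {linear pmod -> M}) :
  (forall b, f (pmod_gen b) = g (pmod_gen b)) -> f =1 g.
Proof. by move=> fg x; rewrite !pmod_linearE; apply: eq_bigr => b _; rewrite fg. Qed.

(** A map out of L r_b is its value at r_b, any element of r_b S; this space is k or 0 according to
    [P b]. As only 0 counts as a boundary, [subquot_dim] is an ordinary dimension here. *)
Lemma pmod_hom_dim (chi : {rmorphism L -> k}) (P : pred I) :
  (forall a : k, chi a%:A = a) -> (forall b, chi (r b) = (P b)%:R) ->
  subquot_dim (V := homk pmod (char_module chi)) (fun _ => True) (fun f => f = 0) #|P|.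
Proof.
move=> chiA chiP; pose e (a : 'I_#|P|) : I := enum_val a.
have eP a : P (e a) by exact: enum_valP.
pose dual a : homk pmod (char_module chi) :=
  pmod_map (M := char_module chi) (fun b => (b == e a)%:R : k).
have dualE a b : homk_fun (dual a) (pmod_gen b) = ((b == e a)%:R : k) :> k.
  rewrite [LHS]pmod_map_gen //; case: eqP => [->|_]; last by rewrite scaler0.
  by rewrite -[LHS]/(chi _ * 1 : k) chiP eP mulr1.
have sumE (c : 'I_#|P| -> k) b : homk_fun (\sum_a c a *: dual a) (pmod_gen b) =
    \sum_a c a * (b == e a)%:R :> k.
  rewrite homk_sumE; apply: eq_bigr => a _.
  by rewrite -[LHS]/(chi (c a)%:A * homk_fun (dual a) (pmod_gen b) : k) chiA dualE.
have sum_e (c : 'I_#|P| -> k) a : \sum_a' c a' * (e a == e a')%:R = c a.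
  rewrite (bigD1 a) //= eqxx mulr1 big1 ?addr0 // => a' aa.
  by rewrite (inj_eq enum_val_inj) eq_sym (negPf aa) mulr0.
exists dual; split=> // f _; exists (\row_a (homk_fun f (pmod_gen (e a)) : k)); split.
  apply/eqP; rewrite subr_eq0; apply/eqP/homk_ext/pmod_hom_ext => b.
  under eq_bigr => a _ do rewrite mxE.
  rewrite [RHS](sumE (fun a => homk_fun f (pmod_gen (e a)))).
  have [Pb|Pb] := boolP (P b).
    by rewrite -(enum_rankK_in (A := P) Pb Pb) -/(e _) sum_e.
  rewrite big1 => [|a _]; last first.
    by case: eqP => [be|_]; [rewrite be eP in Pb|rewrite mulr0].
  rewrite -pmod_genK linearZ; rewrite -[LHS]/(chi (r b) * _ : k) chiP (negPf Pb).
  exact: mul0r.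
move=> c /eqP; rewrite subr_eq0 => /eqP ->; apply/rowP => a; rewrite mxE.
by rewrite sumE sum_e.
Qed.
End IdempotentModule.

(** * Complexes in degrees -2 to 0 *)

Section ThreeTerm.
Variables (R : pzRingType) (X2 X1 X0 M : lmodType R).
Variables (p2 : {linear X2 -> X1}) (p1 : {linear X1 -> X0}).
Hypothesis p12 : forall x, p1 (p2 x) = 0.

(** [Negz 0] is degree -1 and [Negz 1] is degree -2. *)
Definition three_obj (n : int) : lmodType R :=
  match n with
  | Posz 0 => X0 | Negz 0 => X1 | Negz 1 => X2 | _ => 'rV[R]_0
  end.

Definition three_diff (i j : int) : {linear three_obj i -> three_obj j} :=
  match i, j return {linear three_obj i -> three_obj j} with
  | Negz 1, Negz 0 => p2
  | Negz 0, Posz 0 => p1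
  | i, j => zero_map (three_obj i) (three_obj j)
  end.

Lemma three_diff0 i j : j != i + 1 -> forall x, three_diff i j x = 0.
Proof. by case: i => [i|[|[|i]]]; case: j => [[|j]|[|j]]. Qed.

Lemma three_diffK i j l x : three_diff j l (three_diff i j x) = 0.
Proof.
by case: i x => [i|[|[|i]]] x; case: j => [[|j]|[|[|j]]]; case: l => [[|l]|[|[|l]]] //=;
  rewrite ?linear0.
Qed.

Definition three_term : cplx R := Cplx three_diff0 three_diffK.

Lemma three_term_resolution (q : {linear X0 -> M}) :
  fg_projective X2 -> fg_projective X1 -> fg_projective X0 ->
  (forall y, exists x, q x = y) -> (forall x, q (p1 x) = 0) ->
  (forall x, q x = 0 -> exists y, x = p1 y) ->
  (forall x, p1 x = 0 -> exists y, x = p2 y) ->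
  (forall x, p2 x = 0 -> x = 0) -> projective_resolution three_term (stalk M).
Proof.
move=> fg2 fg1 fg0 q_surj qp1 ex0 ex1 ex2.
have rV0 (x : 'rV[R]_0) : x = 0 by exact: thinmx0.
split.
- exists 2%N => -[[|n]|[|[|n]]] //= _; exact: rV0.
- have fg_rV : fg_projective 'rV[R]_0.
    split=> [|U N p f _]; last by exists (zero_map _ _) => x; rewrite /= (rV0 x) !linear0.
    by exists 0%N, (fun=> 0) => x; exists (fun=> 0); rewrite big_ord0; exact: rV0.
  by move=> [[|n]|[|[|n]]].
pose qn (n : int) : {linear three_obj n -> stalk_obj M n} :=
  match n return {linear three_obj n -> stalk_obj M n} with
  | Posz 0 => q | n => zero_map (three_obj n) (stalk_obj M n)
  end.
have qnP i j x : qn j (three_diff i j x) = cdiff (stalk M) i j (qn i x).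
  by case: i x => [i|[|[|i]]] x; case: j => [[|j]|[|j]] //=; rewrite ?linear0 ?qp1.
exists (@CMap R three_term (stalk M) qn qnP).
move=> [[|n]|[|[|n]]]; split => /=.
- move=> z _ [_ /ex0[y ->]]; by exists y.
- move=> x _; have [z <-] := q_surj x; exists z; split=> //; exists 0.
  by rewrite subrr.
- by move=> z _ _; exists 0; rewrite (rV0 z).
- by move=> x _; exists 0; split=> //; exists 0; rewrite (rV0 x) subr0.
- by move=> z /ex1[y ->] _; exists y.
- by move=> x _; exists 0; split; [exact: linear0|exists 0; rewrite (rV0 x) subr0].
- by move=> z /ex2-> _; exists 0; rewrite ?linear0.
- by move=> x _; exists 0; split; [exact: linear0|exists 0; rewrite (rV0 x) subr0].
- by move=> z _ _; exists 0; rewrite (rV0 z).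
- by move=> x _; exists 0; split=> //; exists 0; rewrite (rV0 x) subr0.
Qed.
End ThreeTerm.

Lemma subquot_dim0 (k : fieldType) (V : lmodType k) (Z B : V -> Prop) :
  (forall v, Z v -> B v) -> subquot_dim Z B 0.
Proof.
move=> ZB; exists (fun=> 0); split=> [[]//|z /ZB Bz].
exists 0; split=> [|c _]; first by rewrite big_ord0 subr0.
by apply/rowP; case.
Qed.

Lemma sum_unit (V : nmodType) (F : unit -> V) : \sum_u F u = F tt.
Proof. by rewrite (big_pred1 tt) // => -[]. Qed.

(** * Simple modules over kQ and the Euler form *)

Section PathAlgebraSimples.
Variables (k : fieldType) (Q : quiver).
Local Notation A := (path_algebra k Q).
Local Notation pv j := (@path_vertex k Q j).
Local Notation pa b := (@path_arrow k Q b).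
Implicit Types (i j : vert Q) (b : arr Q).

Definition path_simple i : lmodType A := char_module (@path_char k Q i).

Lemma path_char_scalar i (a : k) : path_char i (a%:A : A) = a.
Proof. by rewrite /path_char path_coefZ /= /path_one_fun mulr1. Qed.

Lemma path_char_vertex i j : path_char i (pv j) = (i == j)%:R.
Proof. by rewrite /path_char /= /path_delta_fun xpair_eqE eqxx !andbT. Qed.

Lemma path_char_arrow i b : path_char i (pa b) = 0.
Proof. by rewrite /path_char /= /path_delta_fun xpair_eqE andbF. Qed.

Lemma path_simple_scale i (a : A) (x : path_simple i) :
  a *: x = (path_char i a * (x : k) : k).
Proof. by []. Qed.

Lemma path_simple_fin_dim i : fin_dim (path_simple i).
Proof.
exists 1%N, (fun _ => (1 : k) : resk (path_simple i)) => x.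
exists (fun=> (x : k)); rewrite big_ord1.
by rewrite -[RHS]/(path_char i ((x : k)%:A : A) * 1) path_char_scalar mulr1.
Qed.

Lemma path_simple_dim_vector i : dim_vector (path_simple i) (simple_root i).
Proof.
move=> j; exists (j == i : nat); first by rewrite ffunE; case: eqP.
case: (eqVneq j i) => [->|ji] /=; last first.
  apply: subquot_dim0 => x <-; rewrite path_simple_scale path_char_vertex.
  by rewrite eq_sym (negPf ji) mul0r.
have sE (c : 'rV[k]_1) : \sum_(a < 1) c 0 a *: ((1 : k) : resk (path_simple i)) = c 0 0.
  by rewrite big_ord1 -[LHS]/(path_char i ((c 0 0)%:A : A) * 1) path_char_scalar mulr1.
exists (fun=> (1 : k)); split=> [_|x _].
  by rewrite path_simple_scale path_char_vertex eqxx mul1r.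
exists (\row__ (x : k)); split=> [|c]; rewrite sE; first by rewrite mxE subrr.
by move/eqP; rewrite subr_eq0 => /eqP ->; apply/rowP => a; rewrite mxE ord1.
Qed.

Section Resolution.
Variable i : vert Q.

Definition path_r0 (_ : unit) : A := pv i.
(** Arrows that do not leave i receive the idempotent 0, so that the sum can be indexed by all
    arrows. *)
Definition path_r1 b : A := if src b == i then pv (tgt b) else 0.

Lemma path_r0_idem u : path_r0 u * path_r0 u = path_r0 u.
Proof. exact: path_vertex_idem. Qed.
Lemma path_r1_idem b : path_r1 b * path_r1 b = path_r1 b.
Proof. by rewrite /path_r1; case: ifP => _; rewrite ?mul0r ?path_vertex_idem. Qed.

Lemma path_u1_subproof b (_ : unit) :
  (if src b == i then pa b else 0) * pv i = if src b == i then pa b else 0.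
Proof. by case: eqP => [<-|_]; rewrite ?mul0r ?path_arrow_srcK. Qed.

Definition path_u1 b : pmod path_r0 := @pmod_of k A unit path_r0 _ (path_u1_subproof b).
Definition path_p1 : {linear pmod path_r1 -> pmod path_r0} := pmod_map path_r1 path_u1.
Definition path_q : {linear pmod path_r0 -> path_simple i} :=
  pmod_map (M := path_simple i) path_r0 (fun _ => 1 : k).

Lemma path_u1E b : path_u1 b = (if src b == i then pa b else 0) *: pmod_gen path_r0_idem tt.
Proof.
apply: pmod_ext => -[]; rewrite pmodZ !pmod_ofE eqxx.
by rewrite [RHS]path_u1_subproof.
Qed.

Lemma path_p1E x : (path_p1 x tt : A) = \sum_(b | src b == i) x b * pa b.
Proof.
rewrite pmod_sum [RHS]big_mkcond; apply: eq_bigr => b _.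
by rewrite pmodZ pmod_ofE; case: ifP; rewrite ?mulr0.
Qed.

(** The differential has arrows as coefficients, and these act as zero on simple modules. Hom into a
    simple module thus kills it, and Ext is read off the terms. *)
Lemma path_p1_char j (f : {linear pmod path_r0 -> path_simple j}) x : f (path_p1 x) = 0.
Proof.
rewrite linear_sum big1 // => b _; rewrite linearZ path_u1E linearZ /=.
rewrite !path_simple_scale; case: ifP => _; rewrite ?path_char_arrow ?mul0r ?mulr0 //.
Qed.

Definition path_complex : cplx A :=
  three_term (p2 := zero_map 'rV[A]_0 (pmod path_r1)) (p1 := path_p1)
    (fun=> linear0 _).

(** The standard resolution of length one: its exactness is existence and uniqueness of right
    division. *)
Lemma path_resolution : projective_resolution path_complex (stalk (path_simple i)).
Proof.
apply: (@three_term_resolution _ _ _ _ _ _ _ _ path_q).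
- split=> [|U N p f _].
    by exists 0%N, (fun=> 0) => x; exists (fun=> 0); rewrite big_ord0; exact: thinmx0.
  by exists (zero_map _ _) => x; rewrite [x]thinmx0 /= !linear0.
- exact: pmod_fg_projective path_r1_idem.
- exact: pmod_fg_projective path_r0_idem.
- move=> y; exists ((y : k)%:A *: pmod_gen path_r0_idem tt).
  have g1 : path_q (pmod_gen path_r0_idem tt) = (1 : k).
    apply: pmod_map_gen.
    by rewrite -[LHS]/(path_char i (pv i) * 1 : k) path_char_vertex eqxx mulr1.
  by rewrite linearZ g1 -[LHS]/(path_char i ((y : k)%:A : A) * 1 : k) path_char_scalar mulr1.
- by move=> x; exact: path_p1_char.
- move=> x; rewrite pmod_mapE sum_unit path_simple_scale mulr1 => x0.
  have FP b : (if src b == i then path_rdiv b (x tt) else 0) * path_r1 b =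
      if src b == i then path_rdiv b (x tt) else 0.
    by rewrite /path_r1; case: ifP; rewrite ?mul0r ?path_rdivK.
  exists (pmod_of FP); apply: pmod_ext => -[]; rewrite path_p1E.
  rewrite -{1}(pmodK x tt) (path_rdivE (x tt)) x0 scale0r add0r.
  by apply: eq_bigr => b bi; rewrite pmod_ofE bi.
- move=> x xp; exists 0; rewrite linear0; apply: pmod_ext => b; rewrite pmod0.
  have [/eqP bi|bi] := boolP (src b == i); last first.
    by rewrite -pmodK /path_r1 (negPf bi) mulr0.
  apply: (@path_rdiv_unique k Q i (fun b => x b)) bi => [c ci|].
    by rewrite -[RHS]pmodK /path_r1 ci eqxx.
  by rewrite -path_p1E xp pmod0.
- by move=> x _; exact: thinmx0.
Qed.

Definition path_ext_dim j (n : int) : nat :=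
  match n with
  | Posz 0 => i == j
  | Posz 1 => #|[pred b : arr Q | (src b == i) && (tgt b == j)]|
  | _ => 0
  end.

Lemma path_derived_hom_dim j n :
  derived_hom_dim path_complex (path_simple j) n (path_ext_dim j n).
Proof.
have z0 (U : lmodType A) (f : homk ('rV[A]_0) U) : f = 0.
  by apply: homk_ext => x; rewrite [x]thinmx0 linear0.
case: n => [[|[|n]]|n].
- have -> : path_ext_dim j 0 = #|(fun=> i == j) : pred unit|.
    by rewrite /= -[LHS]mul1n -card_unit; case: (i == j); rewrite ?muln1 ?muln0 ?card0.
  apply: subquot_dim_ext (pmod_hom_dim path_r0_idem (chi := path_char j)
    (P := fun=> i == j) _ _) => [f|f|a|b].
  + by split=> // _ x; exact: path_p1_char.
  + split=> [->|[g fg]]; first by exists 0.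
    by apply: homk_ext => x; rewrite fg /= linear0.
  + exact: path_char_scalar.
  + by rewrite [LHS]path_char_vertex eq_sym.
- apply: subquot_dim_ext (pmod_hom_dim path_r1_idem (chi := path_char j)
    (P := [pred b : arr Q | (src b == i) && (tgt b == j)]) _ _) => [f|f|a|b].
  + by split=> // _ x; rewrite /= linear0.
  + split=> [->|[g fg]]; first by exists 0.
    by apply: homk_ext => x; rewrite fg; exact: path_p1_char.
  + exact: path_char_scalar.
  + rewrite /path_r1 /=; case: ifP => _; last exact: raddf0.
    by rewrite path_char_vertex eq_sym.
- by apply: subquot_dim0 => f _; exists 0 => x; case: n f x => [|n] f x; rewrite (z0 _ f).
- have e0 : path_ext_dim j (Negz n) = 0%N by case: n.
  rewrite e0; apply: subquot_dim0 => f _; exists 0 => x /=.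
  by have -> : f = 0 by exact: z0.
Qed.

Lemma euler_simple_roots (B : root_lattice Q -> root_lattice Q -> int) j :
  euler_form k B -> B (simple_root i) (simple_root j) =
    (i == j)%:Z - #|[pred b : arr Q | (src b == i) && (tgt b == j)]|%:Z.
Proof.
move=> [_ _ /(_ _ _ _ _ path_complex 1%N (path_ext_dim j)) h].
rewrite (h (path_simple i) (path_simple j)) {h}.
(* With the bound 1 the degrees are -1, 0, 1, with signs -, +, -; the first contributes nothing. *)
- rewrite !big_ord_recl big_ord0 /= !addr0 /=.
  by rewrite mulr0 add0r mul1r mulN1r.
- exact: path_simple_fin_dim.
- exact: path_simple_fin_dim.
- exact: path_simple_dim_vector.
- exact: path_simple_dim_vector.
- exact: path_resolution.
- by move=> [[|[|n]]|[|[|n]]] //= _ x; exact: thinmx0.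
- exact: path_derived_hom_dim.
Qed.
End Resolution.
End PathAlgebraSimples.

(** * The mesh resolution of a simple module *)

Section PreprojectiveSimples.
Variables (k : fieldType) (Q : quiver).
Local Notation DQ := (double_quiver Q).
Local Notation Lambda := (preprojective k Q).
Local Notation ev j := (@lvertex k Q j).
Local Notation ar b := (@preproj_arrow k Q b).
Local Notation sg b := (@arrow_sign k Q b).
Local Notation op b := (@opp_arrow Q b).
Implicit Types (i j : vert Q) (b : arr DQ).

Lemma preproj_char_scalar i (a : k) : preproj_char i (a%:A : Lambda) = a.
Proof.
rewrite -(rmorph1 (@preproj_pi k Q)) -preproj_pi_scale preproj_char_pi.
by rewrite /path_char /= /path_one_fun mulr1.
Qed.

Variable i : vert Q.

Definition mesh_r0 (_ : unit) : Lambda := ev i.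
Definition mesh_r1 b : Lambda := if src b == i then ev (tgt b) else 0.

Lemma mesh_r0_idem u : mesh_r0 u * mesh_r0 u = mesh_r0 u.
Proof. exact: lvertex_idem. Qed.
Lemma mesh_r1_idem b : mesh_r1 b * mesh_r1 b = mesh_r1 b.
Proof. by rewrite /mesh_r1; case: ifP => _; rewrite ?mul0r ?lvertex_idem. Qed.

Lemma mesh_u1_subproof b (_ : unit) :
  (if src b == i then ar b else 0) * ev i = if src b == i then ar b else 0.
Proof. by case: eqP => [<-|_]; rewrite ?mul0r ?arrow_srcK. Qed.

Lemma mesh_u2_subproof (_ : unit) b :
  (if src b == i then sg b * ar (op b) else 0) * mesh_r1 b =
  if src b == i then sg b * ar (op b) else 0.
Proof.
rewrite /mesh_r1; case: ifP => _; rewrite ?mul0r //.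
by rewrite -mulrA -[X in ev X]src_opp_arrow arrow_srcK.
Qed.

Definition mesh_u1 b : pmod mesh_r0 := @pmod_of k Lambda unit mesh_r0 _ (mesh_u1_subproof b).
Definition mesh_u2 (u : unit) : pmod mesh_r1 :=
  @pmod_of k Lambda (arr DQ) mesh_r1 _ (mesh_u2_subproof u).
Definition mesh_p1 : {linear pmod mesh_r1 -> pmod mesh_r0} := pmod_map mesh_r1 mesh_u1.
Definition mesh_p2 : {linear pmod mesh_r0 -> pmod mesh_r1} := pmod_map mesh_r0 mesh_u2.
Definition mesh_q : {linear pmod mesh_r0 -> simple k i} :=
  pmod_map (M := simple k i) mesh_r0 (fun _ => 1 : k).

Lemma mesh_u1E b : mesh_u1 b = (if src b == i then ar b else 0) *: pmod_gen mesh_r0_idem tt.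
Proof.
apply: pmod_ext => -[]; rewrite pmodZ !pmod_ofE eqxx.
by rewrite [RHS]mesh_u1_subproof.
Qed.

Lemma mesh_p1E x : (mesh_p1 x tt : Lambda) = \sum_(b : arr DQ | src b == i) x b * ar b.
Proof.
rewrite pmod_sum [RHS]big_mkcond; apply: eq_bigr => b _.
by rewrite pmodZ pmod_ofE; case: ifP; rewrite ?mulr0.
Qed.

Lemma mesh_p2E x b : (mesh_p2 x b : Lambda) =
  if src b == i then x tt * (sg b * ar (op b)) else 0.
Proof.
rewrite pmod_mapE sum_unit pmodZ pmod_ofE.
by case: ifP; rewrite ?mulr0.
Qed.

Lemma mesh_p12 x : mesh_p1 (mesh_p2 x) = 0.
Proof.
apply: pmod_ext => -[]; rewrite mesh_p1E pmod0.
transitivity ((x tt : Lambda) * \sum_(b : arr DQ | src b == i) sg b * (ar (op b) * ar b)).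
  by rewrite mulr_sumr; apply: eq_bigr => b bi; rewrite mesh_p2E bi !mulrA.
by rewrite mesh_relation mulr0.
Qed.

Lemma mesh_p1_char j (f : {linear pmod mesh_r0 -> simple k j}) x : f (mesh_p1 x) = 0.
Proof.
rewrite linear_sum big1 // => b _; rewrite linearZ mesh_u1E linearZ /=.
by rewrite !simple_scale; case: ifP => _; rewrite ?arrow_char ?raddf0 ?mul0r ?mulr0.
Qed.

Lemma mesh_p2_char j (f : {linear pmod mesh_r1 -> simple k j}) x : f (mesh_p2 x) = 0.
Proof.
rewrite pmod_mapE sum_unit linearZ /= (pmod_linearE mesh_r1_idem) big1 ?scaler0 //.
move=> b _; rewrite pmod_ofE simple_scale; case: ifP => _; last by rewrite raddf0 mul0r.
by rewrite rmorphM /= arrow_char mulr0 mul0r.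
Qed.

Lemma mesh_q_surj y : exists x, mesh_q x = y.
Proof.
exists ((y : k)%:A *: pmod_gen mesh_r0_idem tt).
have g1 : mesh_q (pmod_gen mesh_r0_idem tt) = (1 : k).
  apply: pmod_map_gen.
  by rewrite -[LHS]/(preproj_char i (ev i) * 1 : k) lvertex_char eqxx mulr1.
by rewrite linearZ g1 -[LHS]/(preproj_char i ((y : k)%:A : Lambda) * 1 : k) preproj_char_scalar mulr1.
Qed.

Lemma mesh_q_exact x : mesh_q x = 0 -> exists y, x = mesh_p1 y.
Proof.
rewrite pmod_mapE sum_unit simple_scale mulr1 => x0.
have [F [Ft FE]] := preproj_rdiv (pmodK x tt).
have FP b : (if src b == i then F b else 0) * mesh_r1 b = if src b == i then F b else 0.
  by rewrite /mesh_r1; case: ifP; rewrite ?mul0r ?Ft.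
exists (pmod_of FP); apply: pmod_ext => -[]; rewrite mesh_p1E FE x0 scale0r add0r.
by apply: eq_bigr => b bi; rewrite pmod_ofE bi.
Qed.

Lemma mesh_p1_exact x : mesh_p1 x = 0 -> exists y, x = mesh_p2 y.
Proof.
move=> x0; have [b bi||y yi yE] := @preproj_exact_middle k Q i (fun b => x b).
- by rewrite -[RHS]pmodK /mesh_r1 bi eqxx.
- by rewrite -mesh_p1E x0 pmod0.
have yP (u : unit) : y * mesh_r0 u = y by [].
exists (pmod_of yP); apply: pmod_ext => b; rewrite mesh_p2E pmod_ofE.
case: eqP => bi; last by rewrite -pmodK /mesh_r1; case: eqP; rewrite ?mulr0.
by rewrite yE // !mulrA arrow_sign_comm.
Qed.

Hypotheses (Q_connected : quiver_connected Q) (Q_acyclic : quiver_acyclic Q).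
Hypothesis Q_not_dynkin : ~ dynkin_type Q.

(** Up to sign, the coordinates of [mesh_p2 x] are the products of x with the arrows ending at i;
    all other arrows kill x = x e_i. So x is killed by every arrow, and the non-Dynkin hypothesis
    makes it 0. *)
Lemma mesh_p2_inj x : mesh_p2 x = 0 -> x = 0.
Proof.
move=> x0; apply: pmod_ext => -[]; rewrite pmod0.
apply: preproj_mul_arrow_inj => // b; rewrite -pmodK /mesh_r0 -mulrA.
have [bi|bi] := eqVneq (tgt b) i; last first.
  by rewrite -(arrow_tgtK k b) [ev i * _]mulrA lvertex_orth ?mul0r ?mulr0 // eq_sym.
have := congr1 (fun z : pmod mesh_r1 => (z (op b) : Lambda)) x0.
rewrite mesh_p2E src_opp_arrow bi eqxx pmod0 opp_arrowK => xE.
have -> : ev i * ar b = ar b by rewrite -[X in ev X]bi arrow_tgtK.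
move: xE; move: (x tt : Lambda) => y yE.
rewrite -[LHS]mul1r -(arrow_sign_sqr k (op b)) -mulrA.
by rewrite [sg _ * (y * _)]mulrA [sg _ * y]arrow_sign_comm -[y * _ * _]mulrA yE mulr0.
Qed.

Definition mesh_complex : cplx Lambda := three_term mesh_p12.

Lemma mesh_resolution : projective_resolution mesh_complex (stalk (simple k i)).
Proof.
apply: (@three_term_resolution _ _ _ _ _ _ _ _ mesh_q).
- exact: pmod_fg_projective mesh_r0_idem.
- exact: pmod_fg_projective mesh_r1_idem.
- exact: pmod_fg_projective mesh_r0_idem.
- exact: mesh_q_surj.
- by move=> x; exact: mesh_p1_char.
- exact: mesh_q_exact.
- exact: mesh_p1_exact.
- exact: mesh_p2_inj.
Qed.
End PreprojectiveSimples.

(** * Classes of objects of the hull *)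

Section Cplx2.
Variable R : pzRingType.
Implicit Types X Y Z : cplx2 R.

Lemma lin_comp_linear (U V W : lmodType R) (g : {linear V -> W}) (f : {linear U -> V}) :
  linear (fun x => g (f x)).
Proof. by move=> a x y; rewrite !linearP. Qed.

Definition lin_comp (U V W : lmodType R) (g : {linear V -> W}) (f : {linear U -> V}) :
  {linear U -> W} := lin_of (lin_comp_linear g f).

Definition id_map2 X : cmap2 X X :=
  @CMap2 R X X idfun idfun (fun=> erefl) (fun=> erefl).

Lemma comp_map2_subproof X Y Z (g : cmap2 Y Z) (f : cmap2 X Y) :
  (forall x, m1 g (m1 f (d0 X x)) = d0 Z (m0 g (m0 f x))) /\
  (forall x, m0 g (m0 f (d1 X x)) = d1 Z (m1 g (m1 f x))).
Proof. by split=> x; rewrite ?m0P ?m1P. Qed.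

Definition comp_map2 X Y Z (g : cmap2 Y Z) (f : cmap2 X Y) : cmap2 X Z :=
  @CMap2 R X Z (lin_comp (m0 g) (m0 f)) (lin_comp (m1 g) (m1 f))
    (comp_map2_subproof g f).1 (comp_map2_subproof g f).2.

Lemma zero_map2_subproof X Y :
  (forall x : c0 X, zero_map (c1 X) (c1 Y) (d0 X x) = d0 Y (zero_map (c0 X) (c0 Y) x)) /\
  (forall x : c1 X, zero_map (c0 X) (c0 Y) (d1 X x) = d1 Y (zero_map (c1 X) (c1 Y) x)).
Proof. by split=> x; rewrite /= linear0. Qed.

Definition zero_map2 X Y : cmap2 X Y :=
  @CMap2 R X Y (zero_map _ _) (zero_map _ _)
    (zero_map2_subproof X Y).1 (zero_map2_subproof X Y).2.

Lemma homotopic_refl X Y (a0 : c0 X -> c0 Y) (a1 : c1 X -> c1 Y) :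
  homotopic a0 a0 a1 a1.
Proof.
by exists (zero_map _ _), (zero_map _ _); split=> x; rewrite /= linear0 addr0 subrr.
Qed.

Lemma homotopic_eq X Y (a0 b0 : c0 X -> c0 Y) (a1 b1 : c1 X -> c1 Y) :
  a0 =1 b0 -> a1 =1 b1 -> homotopic a0 b0 a1 b1.
Proof. by move=> /funext-> /funext->; exact: homotopic_refl. Qed.

Lemma homotopy_equiv_refl X : homotopy_equiv X X.
Proof. by exists (id_map2 X), (id_map2 X); split; apply: homotopic_eq. Qed.

(* Postcomposition with a homotopy inverse does not change the cone when the
   homotopy s vanishes on the image of e: no higher coherence is needed. *)
Lemma cone_retract X X' Y (e : cmap2 X X') (g : cmap2 X' X) (f : cmap2 X' Y)
    (s0 : {linear c0 X' -> c1 X'}) (s1 : {linear c1 X' -> c0 X'}) :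
  (forall x, m0 g (m0 e x) = x) -> (forall x, m1 g (m1 e x) = x) ->
  (forall x, x - m0 e (m0 g x) = d1 X' (s0 x) + s1 (d0 X' x)) ->
  (forall x, x - m1 e (m1 g x) = d0 X' (s1 x) + s0 (d1 X' x)) ->
  (forall x, s0 (m0 e x) = 0) -> (forall x, s1 (m1 e x) = 0) ->
  homotopy_equiv (cone (comp_map2 f e)) (cone f).
Proof.
move=> ge0 ge1 h0 h1 se0 se1.
have E0 x : m0 f x - m0 f (s1 (d0 X' x)) = d1 Y (m1 f (s0 x)) + m0 f (m0 e (m0 g x)).
  apply/eqP; rewrite subr_eq -addrA [m0 f (m0 e _) + _]addrC addrA.
  by rewrite -m1P -!linearD /= -h0 subrK.
have E1 x : m1 f x - m1 f (s0 (d1 X' x)) = d0 Y (m0 f (s1 x)) + m1 f (m1 e (m1 g x)).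
  apply/eqP; rewrite subr_eq -addrA [m1 f (m1 e _) + _]addrC addrA.
  by rewrite -m0P -!linearD /= -h1 subrK.
pose Phi0 : {linear c0 (cone (comp_map2 f e)) -> c0 (cone f)} :=
  lin_of (dsum2_linear idfun (m1 e)).
pose Phi1 : {linear c1 (cone (comp_map2 f e)) -> c1 (cone f)} :=
  lin_of (dsum2_linear idfun (m0 e)).
have [P0 P1] : (forall x, Phi1 (d0 (cone (comp_map2 f e)) x) = d0 (cone f) (Phi0 x)) /\
    (forall x, Phi0 (d1 (cone (comp_map2 f e)) x) = d1 (cone f) (Phi1 x)).
  by split=> -[y x]; apply: injective_projections; rewrite //= linearN ?m0P ?m1P.
have Psi_lin (Y0 U U' : lmodType R) (p : {linear U -> Y0}) (q : {linear U -> U'}) :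
    linear (fun z : Y0 * U => (z.1 + p z.2, q z.2) : Y0 * U').
  move=> a x y; apply: injective_projections; rewrite /= !linearP //.
  by rewrite scalerDr addrACA.
(* The inverse of id (+) e has g on the diagonal and f s off it, which compensates for e g being the
   identity only up to homotopy. Since s e = 0, one composite is the identity; the other is
   homotopic to it by 0 (+) s. *)
pose Psi0 : {linear c0 (cone f) -> c0 (cone (comp_map2 f e))} :=
  lin_of (Psi_lin _ _ _ (lin_comp (m0 f) s1) (m1 g)).
pose Psi1 : {linear c1 (cone f) -> c1 (cone (comp_map2 f e))} :=
  lin_of (Psi_lin _ _ _ (lin_comp (m1 f) s0) (m0 g)).
have [Q0 Q1] : (forall x, Psi1 (d0 (cone f) x) = d0 (cone (comp_map2 f e)) (Psi0 x)) /\
    (forall x, Psi0 (d1 (cone f) x) = d1 (cone (comp_map2 f e)) (Psi1 x)).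
  split=> -[y x]; apply: injective_projections; rewrite /= ?linearN ?m0P ?m1P //.
    by rewrite linearD -!addrA; congr (_ + _); rewrite E1.
  by rewrite linearD -!addrA; congr (_ + _); rewrite E0.
exists (CMap2 P0 P1), (CMap2 Q0 Q1); split.
  by apply: homotopic_eq => -[y x]; apply: injective_projections;
    rewrite /= ?se0 ?se1 ?ge0 ?ge1 ?linear0 ?addr0.
exists (lin_of (dsum2_linear (zero_map (c0 Y) (c1 Y)) s1)).
exists (lin_of (dsum2_linear (zero_map (c1 Y) (c0 Y)) s0)).
split=> -[y x]; apply: injective_projections; rewrite /=.
- by rewrite linear0 add0r addr0 addrC addKr.
- by rewrite linearN -opprD -h1 opprB.
- by rewrite linear0 add0r addr0 addrC addKr.
- by rewrite linearN -opprD -h0 opprB.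
Qed.

End Cplx2.

(** * Splitting off the cohomology over k *)

Section CohomologySplitting.
Variables (k : fieldType) (V0 V1 : lmodType k).
Variables (d0 : {linear V0 -> V1}) (d1 : {linear V1 -> V0}).
Variables (r0 : {linear V1 -> V0}) (r1 : {linear V0 -> V1}).
Hypotheses (d0d1 : forall x, d0 (d1 x) = 0).
Hypotheses (r0K : forall x, d0 (r0 (d0 x)) = d0 x).
Hypotheses (r1K : forall x, d1 (r1 (d1 x)) = d1 x) (r1r : forall x, r1 (d1 (r1 x)) = r1 x).

(** The c_t are the coordinates of the class of the cocycle x - r0 (d0 x), linear because they are
    unique. The representatives are the given ones moved by 1 - d1 r1: their classes stay the same
    and r1 kills them, so the homotopy r1 (1 - r0 d0) vanishes on them, as [cone_retract]
    demands. *)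
Lemma cohomology_split n :
  subquot_dim (fun x => d0 x = 0) (fun x => exists y, x = d1 y) n ->
  exists (v : 'I_n -> V0) (c : 'I_n -> {linear V0 -> k^o}),
  [/\ forall t, d0 (v t) = 0, forall t, r1 (v t) = 0, forall t y, c t (d1 y) = 0,
      forall s t, c s (v t) = (s == t)%:R &
      forall x, x - \sum_t (c t x : k) *: v t = d1 (r1 (x - r0 (d0 x))) + r0 (d0 x)].
Proof.
move=> [b [bZ bu]].
have Zx x : d0 (x - r0 (d0 x)) = 0 by rewrite linearB r0K subrr.
have /choice[C CP] x : exists c : 'rV[k]_n,
    exists y, x - r0 (d0 x) - \sum_t c 0 t *: b t = d1 y.
  by have [c [cB _]] := bu _ (Zx x); exists c.
have Cu x (c : 'rV[k]_n) y : x - r0 (d0 x) - \sum_t c 0 t *: b t = d1 y -> c = C x.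
  move=> h; have [c' [_ c'u]] := bu _ (Zx x).
  by rewrite -(c'u c) ?(c'u (C x)) //; exists y.
have C_linear t : linear (fun x => C x 0 t : k^o).
  move=> a x y; have [u ux] := CP x; have [w wy] := CP y.
  suff <- : a *: C x + C y = C (a *: x + y) by rewrite !mxE.
  apply: (Cu _ _ (a *: u + w)); rewrite [d1 _]linearP -ux -wy.
  have -> : \sum_t0 (a *: C x + C y) 0 t0 *: b t0 =
      a *: (\sum_t0 C x 0 t0 *: b t0) + \sum_t0 C y 0 t0 *: b t0.
    rewrite scaler_sumr -big_split; apply: eq_bigr => j _ /=.
    by rewrite !mxE scalerDl scalerA.
  have -> : r0 (d0 (a *: x + y)) = a *: r0 (d0 x) + r0 (d0 y) by rewrite !linearP.
  by rewrite !scalerBr !opprD [RHS]addrACA; congr (_ + _); exact: addrACA.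
pose c t : {linear V0 -> k^o} := lin_of (C_linear t).
have Cb x y : x = d1 y -> C x = 0.
  move=> xy; symmetry; apply: (Cu _ _ y); rewrite big1 => [|t _]; last first.
    by rewrite mxE scale0r.
  by rewrite xy d0d1 linear0 !subr0.
pose p x := x - d1 (r1 x).
have Cp x : C (p x) = C x.
  apply/rowP => t; rewrite -[LHS]/(c t (x - d1 (r1 x)) : k) linearB.
  have -> : c t (d1 (r1 x)) = 0 by rewrite /= (Cb _ _ erefl) mxE.
  by rewrite subr0.
have Cb_t s t : C (b s) 0 t = (s == t)%:R.
  suff <- : \row_t (s == t)%:R = C (b s) by rewrite mxE.
  apply: (Cu _ _ 0); rewrite bZ [r0 0]linear0 subr0 [d1 0]linear0 (bigD1 s) //= big1 => [|j js].
    by rewrite /= addr0 mxE eqxx scale1r subrr.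
  by rewrite mxE eq_sym (negPf js) scale0r.
exists (fun t => p (b t)), c; split=> [t|t|t y|s t|x].
- by rewrite linearB d0d1 bZ subrr.
- by rewrite linearB r1r subrr.
- by rewrite /= (Cb _ _ erefl) mxE.
- by rewrite /= Cp Cb_t eq_sym.
have [y xy] := CP x; have pd z : p (d1 z) = 0 by rewrite /p r1K subrr.
have pB z w : p (z - w) = p z - p w.
  rewrite /p [r1 _]linearB [d1 _]linearB !opprB addrACA [RHS]addrACA.
  by congr (_ + _); exact: addrC.
have p_lin : linear p.
  move=> a z w; rewrite /p [r1 _]linearP [d1 _]linearP scalerBr opprD.
  exact: addrACA.
have p_sum : \sum_t (c t x : k) *: p (b t) = p (\sum_t C x 0 t *: b t).
  rewrite -[RHS]/(lin_of p_lin _) linear_sum; apply: eq_bigr => t _.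
  by rewrite linearZ.
have -> : \sum_t (c t x : k) *: p (b t) = p (x - r0 (d0 x)).
  by rewrite p_sum; apply/eqP; rewrite eq_sym -subr_eq0 -pB xy pd.
by rewrite /p !opprB addrC -addrA subrK.
Qed.
End CohomologySplitting.

Section HullClasses.
Variables (k : fieldType) (Q : quiver).
Local Notation Lambda := (preprojective k Q).
Variable eta : K0 k Q -> root_lattice Q.
Hypothesis eta_add : forall x y, eta (K0_add x y) = eta x + eta y.
Implicit Types X Y Z W : hull k Q.

Definition hull_class X : root_lattice Q := eta (K0_class X).

Lemma hull_class_triangle X Y Z (f : cmap2 X Y) :
  homotopy_equiv Z (cone f) -> hull_class Y = hull_class X + hull_class Z.
Proof.
move=> h; rewrite /hull_class -eta_add K0_addE; congr eta.
by apply/K0_piE; exact: K0_triangle h.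
Qed.

Let zero_stalk_eq0 n (x : stalk_obj 'rV[Lambda]_0 n) : x = 0.
Proof. by move: x; rewrite /stalk_obj; case: ifP => _ x; exact: thinmx0. Qed.

Lemma zero_hull_exists : exists Z, (forall x : c0 Z, x = 0) /\ (forall x : c1 Z, x = 0).
Proof.
have rc : rep_complex (stalk ('rV[Lambda]_0 : lmodType Lambda)).
  split; first by exists 0%N => n _; exact: zero_stalk_eq0.
  move=> n; rewrite /= /stalk_obj if_same.
  by split; [exact: zero_fin_dim|exact: zero_nilpotent].
have res : projective_resolution (stalk ('rV[Lambda]_0 : lmodType Lambda)) (stalk 'rV[Lambda]_0).
  split; first by exists 0%N => n _; exact: zero_stalk_eq0.
    move=> n; split.
      by exists 0%N, (fun=> 0) => x; exists (fun=> 0); rewrite big_ord0; exact: zero_stalk_eq0.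
    by move=> U N p f _; exists (zero_map _ _) => x; rewrite [x]zero_stalk_eq0 /= !linear0.
  exists (@CMap _ (stalk 'rV[Lambda]_0) (stalk 'rV[Lambda]_0) (fun=> idfun)
    (fun i j x => erefl)) => n; split=> [z _ _|x _].
    by exists 0; exact: zero_stalk_eq0.
  exists 0; split=> //; exists 0; exact: zero_stalk_eq0.
exists (Hull (hull_orbit rc res)); split=> x; apply: dsum_ext => n; exact: zero_stalk_eq0.
Qed.

(** For a zero object, Z -> Z -> Z is a triangle, so the class is twice itself. *)
Lemma zero_hull_class Z : (forall x : c0 Z, x = 0) -> (forall x : c1 Z, x = 0) ->
  hull_class Z = 0.
Proof.
move=> z0 z1; apply: (addrI (hull_class Z)); rewrite addr0.
rewrite -(@hull_class_triangle Z Z Z (zero_map2 Z Z)) //.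
exists (zero_map2 _ _), (zero_map2 _ _); split; apply: homotopic_eq => x /=.
- by rewrite [x]z0.
- by rewrite [x]z1.
- by case: x => y x; rewrite [y]z0 [x]z1.
- by case: x => y x; rewrite [y]z1 [x]z0.
Qed.

Definition hull_shifted X : hull k Q := Hull (hull_shift (hullP X)).

(** From the triangle X -> 0 -> X[1]. *)
Lemma hull_class_shift X : hull_class (hull_shifted X) = - hull_class X.
Proof.
have [Z [z0 z1]] := zero_hull_exists.
apply/eqP; rewrite -addr_eq0 addrC; apply/eqP.
rewrite -(zero_hull_class z0 z1); symmetry.
apply: (@hull_class_triangle X Z (hull_shifted X) (zero_map2 X Z)).
have f_lin (U V : lmodType Lambda) : linear (fun x : V => (0, x) : U * V).
  by move=> a x y; apply: injective_projections; rewrite //= scaler0 addr0.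
have g_lin (U V : lmodType Lambda) : linear (fun x : U * V => x.2) by [].
pose F0 : {linear c0 (hull_shifted X) -> c0 (cone (zero_map2 X Z))} := lin_of (@f_lin _ _).
pose F1 : {linear c1 (hull_shifted X) -> c1 (cone (zero_map2 X Z))} := lin_of (@f_lin _ _).
pose G0 : {linear c0 (cone (zero_map2 X Z)) -> c0 (hull_shifted X)} := lin_of (@g_lin _ _).
pose G1 : {linear c1 (cone (zero_map2 X Z)) -> c1 (hull_shifted X)} := lin_of (@g_lin _ _).
have FP0 x : F1 (d0 (hull_shifted X) x) = d0 (cone (zero_map2 X Z)) (F0 x).
  by apply: injective_projections; rewrite //= linear0 addr0.
have FP1 x : F0 (d1 (hull_shifted X) x) = d1 (cone (zero_map2 X Z)) (F1 x).
  by apply: injective_projections; rewrite //= linear0 addr0.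
have GP0 x : G1 (d0 (cone (zero_map2 X Z)) x) = d0 (hull_shifted X) (G0 x) by [].
have GP1 x : G0 (d1 (cone (zero_map2 X Z)) x) = d1 (hull_shifted X) (G1 x) by [].
exists (CMap2 FP0 FP1), (CMap2 GP0 GP1); split; apply: homotopic_eq => x //=.
  by case: x => y x; rewrite [y]z0.
by case: x => y x; rewrite [y]z1.
Qed.

(* X (+) W, realised as the cone of the zero map W[1] -> X. *)
Definition hull_sum X W : hull k Q :=
  Hull (hull_cone (zero_map2 (hull_shifted W) X) (hullP (hull_shifted W)) (hullP X)).

Lemma hull_class_sum X W : hull_class (hull_sum X W) = hull_class X + hull_class W.
Proof.
have := @hull_class_triangle (hull_shifted W) X (hull_sum X W) (zero_map2 _ _)
  (homotopy_equiv_refl _).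
by rewrite hull_class_shift => ->; rewrite addrAC addNr add0r.
Qed.

(** * Biproducts inside the hull *)

Section Biproduct.
Variable T : cplx2 Lambda.

Record retract := Retract {
  retract_obj : hull k Q;
  retract_in : cmap2 retract_obj T;
  retract_out : cmap2 T retract_obj }.

Variable t : nat -> retract.
Local Notation inj s := (retract_in (t s)).
Local Notation proj s := (retract_out (t s)).

Definition identity_upto n := forall s, (s < n)%N ->
  (forall x, m0 (proj s) (m0 (inj s) x) = x) /\ (forall x, m1 (proj s) (m1 (inj s) x) = x).

Definition orthogonal_upto n := forall s s', (s < n)%N -> (s' < n)%N -> s != s' ->
  (forall x, m0 (proj s) (m0 (inj s') x) = 0) /\ (forall x, m1 (proj s) (m1 (inj s') x) = 0).

(** T is not known to lie in the hull; only the sum W has to. The clauses on F and z say that maps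
    out of W are tested on the summands and maps into W on the projections. The induction needs both
    for the cross terms, and the clauses on F later show that the homotopy vanishes on W. *)
Lemma hull_biproduct n : identity_upto n -> orthogonal_upto n ->
  exists W (E : cmap2 W T) (G : cmap2 T W),
  [/\ hull_class W = \sum_(s < n) hull_class (retract_obj (t s)),
      (forall x, m0 G (m0 E x) = x) /\ (forall x, m1 G (m1 E x) = x),
      (forall z, m0 E (m0 G z) = \sum_(s < n) m0 (inj s) (m0 (proj s) z)) /\
      (forall z, m1 E (m1 G z) = \sum_(s < n) m1 (inj s) (m1 (proj s) z)),
      (forall (Z : lmodType Lambda) (F : {linear c0 T -> Z}),
         (forall s x, (s < n)%N -> F (m0 (inj s) x) = 0) -> forall x, F (m0 E x) = 0) /\
      (forall (Z : lmodType Lambda) (F : {linear c1 T -> Z}),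
         (forall s x, (s < n)%N -> F (m1 (inj s) x) = 0) -> forall x, F (m1 E x) = 0) &
      (forall z, (forall s, (s < n)%N -> m0 (proj s) z = 0) -> m0 G z = 0) /\
      (forall z, (forall s, (s < n)%N -> m1 (proj s) z = 0) -> m1 G z = 0)].
Proof.
elim: n => [_ _|n IH t_id ortho].
  have [Z [z0 z1]] := zero_hull_exists.
  exists Z, (zero_map2 Z T), (zero_map2 T Z); split.
  - by rewrite big_ord0; exact: zero_hull_class.
  - by split=> x /=; rewrite ?[x]z0 ?[x]z1.
  - by split=> x; rewrite big_ord0.
  - by split=> U F _ x /=; rewrite linear0.
  - by [].
have [||W [E [G [clW [GE0 GE1] [EG0 EG1] [B0 B1] [A0 A1]]]]] := IH.
- by move=> s sn; apply: t_id; exact: ltnW.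
- by move=> s s' sn s'n; apply: ortho; exact: ltnW.
pose X := retract_obj (t n); pose W' := hull_sum X W.
have E_lin (U U' V : lmodType Lambda) (f : {linear U -> V}) (f' : {linear U' -> V}) :
    linear (fun x : U * U' => f x.1 + f' x.2 : V) by exact: sum_linear.
have G_lin (U U' V : lmodType Lambda) (f : {linear V -> U}) (f' : {linear V -> U'}) :
    linear (fun x : V => (f x, f' x) : U * U').
  by move=> a x y; apply: injective_projections; rewrite /= linearP.
pose E0 : {linear c0 W' -> c0 T} := lin_of (E_lin _ _ _ (m0 (inj n)) (m0 E)).
pose E1 : {linear c1 W' -> c1 T} := lin_of (E_lin _ _ _ (m1 (inj n)) (m1 E)).
pose G0 : {linear c0 T -> c0 W'} := lin_of (G_lin _ _ _ (m0 (proj n)) (m0 G)).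
pose G1 : {linear c1 T -> c1 W'} := lin_of (G_lin _ _ _ (m1 (proj n)) (m1 G)).
have EP0 x : E1 (d0 W' x) = d0 T (E0 x).
  by case: x => y x; rewrite /= addr0 opprK linearD !m0P.
have EP1 x : E0 (d1 W' x) = d1 T (E1 x).
  by case: x => y x; rewrite /= addr0 opprK linearD !m1P.
have GP0 x : G1 (d0 T x) = d0 W' (G0 x).
  by apply: injective_projections; rewrite /= ?addr0 ?opprK m0P.
have GP1 x : G0 (d1 T x) = d1 W' (G1 x).
  by apply: injective_projections; rewrite /= ?addr0 ?opprK m1P.
have orth s s' : (s <= n)%N -> (s' <= n)%N -> s != s' ->
    (forall x, m0 (proj s) (m0 (inj s') x) = 0) /\
    (forall x, m1 (proj s) (m1 (inj s') x) = 0) by exact: ortho.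
exists W', (CMap2 EP0 EP1), (CMap2 GP0 GP1); split.
- by rewrite big_ord_recr /= hull_class_sum clW addrC.
- split=> -[y x]; apply: injective_projections => /=; rewrite linearD.
  + rewrite (t_id n (leqnn _)).1 B0 ?addr0 // => s z sn.
    by apply: (orth _ _ _ _ _).1; rewrite ?(ltnW sn) // gtn_eqF.
  + rewrite GE0 A0 ?add0r // => s sn.
    by apply: (orth _ _ _ _ _).1; rewrite ?(ltnW sn) // ltn_eqF.
  + rewrite (t_id n (leqnn _)).2 B1 ?addr0 // => s z sn.
    by apply: (orth _ _ _ _ _).2; rewrite ?(ltnW sn) // gtn_eqF.
  + rewrite GE1 A1 ?add0r // => s sn.
    by apply: (orth _ _ _ _ _).2; rewrite ?(ltnW sn) // ltn_eqF.
- by split=> z; rewrite big_ord_recr /= -?EG0 -?EG1 addrC.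
- split=> Z F h -[y x]; rewrite /= linearD h // add0r.
    by apply: B0 => s z sn; apply: h; exact: ltnW.
  by apply: B1 => s z sn; apply: h; exact: ltnW.
- split=> z h; apply: injective_projections; rewrite /= ?h //.
    by apply: A0 => s sn; apply: h; exact: ltnW.
  by apply: A1 => s sn; apply: h; exact: ltnW.
Qed.
End Biproduct.
End HullClasses.

(** * The cone of the evaluation map *)

Section Contraction.
Variables (k : fieldType) (L : algType k) (V : lmodType k).
Variable c : {linear V -> k^o}.

Lemma contract_subproof (U : lmodType L) :
  bilinear_balanced (fun (v : V) (x : U) => ((c v : k)%:A : L) *: x).
Proof.
split=> [v v' x|v a x y|b v x].
- by rewrite linearD scalerDl scalerDl.
- by rewrite scalerDr !scalerA mulr_algl mulr_algr.
- have -> : (c (b *: v) : k) = b * c v by rewrite linearZ.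
  by rewrite [RHS]scalerA mulr_algl scalerA mulrC.
Qed.

Definition contract (U : lmodType L) : {linear tensor V U -> U} :=
  tensor_lift (contract_subproof U).

Lemma contractE (U : lmodType L) v (x : U) : contract U (pure v x) = ((c v : k)%:A : L) *: x.
Proof. exact: tensor_lift_pure. Qed.

Lemma contract_map (U U' : lmodType L) (f : {linear U -> U'}) z :
  contract U' (tensor_map idfun f z) = f (contract U z).
Proof.
elim/tensor_pure_ind: z => [v x|z z' h h']; last by rewrite !linearD h h'.
by rewrite tensor_mapE !contractE linearZ.
Qed.

Lemma contract_vanish (V' : lmodType k) (d : {linear V' -> V}) (U : lmodType L) z :
  (forall w, c (d w) = 0) -> contract U (tensor_map d idfun z) = 0.
Proof.
move=> cd; elim/tensor_pure_ind: z => [v x|z z' h h'].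
  by rewrite tensor_mapE contractE cd !scale0r.
by rewrite !linearD h h' addr0.
Qed.
End Contraction.

Lemma pure_linear (k : fieldType) (L : algType k) (V : lmodType k) (U : lmodType L) (v : V) :
  linear (fun x : U => pure v x).
Proof. by move=> a x y; rewrite pure_addr pure_scale. Qed.

Lemma pureN (k : fieldType) (L : algType k) (V : lmodType k) (U : lmodType L) (v : V) (x : U) :
  pure v (- x) = - pure v x.
Proof. exact: (linearN (lin_of (pure_linear v))). Qed.

Lemma pure_suml (k : fieldType) (L : algType k) (V : lmodType k) (U : lmodType L)
    (I : finType) (F : I -> V) (x : U) :
  pure (\sum_i F i) x = \sum_i pure (F i) x.
Proof.
by apply: (big_morph (fun v => pure v x)) => [v v'|]; [exact: pure_addl|exact: pure0l].
Qed.

Lemma sub_retract_linear (k : fieldType) (V0 V1 : lmodType k) (d : {linear V0 -> V1})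
    (r : {linear V1 -> V0}) (r' : {linear V0 -> V1}) :
  linear (fun x => r' (x - r (d x))).
Proof.
move=> a x y; rewrite -linearP [d _]linearP [r _]linearP scalerBr opprD.
by congr (r' _); exact: addrACA.
Qed.

(** * The twist as a cone between objects of the hull *)

Section TwistObject.
Variables (k : fieldType) (Q : quiver).
Local Notation Lambda := (preprojective k Q).
Variable eta : K0 k Q -> root_lattice Q.
Hypothesis eta_add : forall x y, eta (K0_add x y) = eta x + eta y.
Local Notation cl := (hull_class eta).
Variables (X M : hull k Q).
Local Notation V := (B2 X M).
Local Notation T := (tensor2 V X).

Section Even.
Variables (v : c0 V) (c : {linear c0 V -> k^o}).
Hypotheses (v_cocycle : d0 V v = 0) (c_vanish : forall w, c (d1 V w) = 0).

Lemma even_in_linear (U U' : lmodType Lambda) (Z : lmodType k) :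
  linear (fun x : U => (pure v x, 0) : tensor (c0 V) U * tensor Z U').
Proof.
by move=> a x y; apply: injective_projections; rewrite /= ?scaler0 ?addr0 // pure_linear.
Qed.

Lemma even_out_linear (U U' : lmodType Lambda) (Z : lmodType k) :
  linear (fun z : tensor (c0 V) U * tensor Z U' => contract c U z.1).
Proof. by move=> a x y; exact: (linearP (contract c U) a x.1 y.1). Qed.

(** That x |-> v (x) x commutes with the differentials needs v to be a cocycle; for the contraction
    back by c, in [even_out], c must vanish on boundaries. *)
Definition even_in : cmap2 X T.
Proof.
refine (@CMap2 _ X T (lin_of (@even_in_linear _ _ _)) (lin_of (@even_in_linear _ _ _)) _ _) => x.
- apply: injective_projections.
    change (pure v (d0 X x) =
      tensor_map idfun (d0 X) (pure v x) + tensor_map (d1 V) idfun 0).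
    by rewrite linear0 addr0 tensor_mapE.
  change (0 = tensor_map (d0 V) idfun (pure v x) - tensor_map idfun (d1 X) 0).
  by rewrite tensor_mapE v_cocycle pure0l linear0 subr0.
- apply: injective_projections.
    change (pure v (d1 X x) =
      tensor_map idfun (d1 X) (pure v x) + tensor_map (d1 V) idfun 0).
    by rewrite linear0 addr0 tensor_mapE.
  change (0 = tensor_map (d0 V) idfun (pure v x) - tensor_map idfun (d0 X) 0).
  by rewrite tensor_mapE v_cocycle pure0l linear0 subr0.
Defined.

Definition even_out : cmap2 T X.
Proof.
refine (@CMap2 _ T X (lin_of (@even_out_linear _ _ _)) (lin_of (@even_out_linear _ _ _)) _ _).
- move=> [a b]; change (contract c _ (tensor_map idfun (d0 X) a +
    tensor_map (d1 V) idfun b) = d0 X (contract c _ a)).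
  by rewrite linearD contract_map contract_vanish ?addr0.
- move=> [a b]; change (contract c _ (tensor_map idfun (d1 X) a +
    tensor_map (d1 V) idfun b) = d1 X (contract c _ a)).
  by rewrite linearD contract_map contract_vanish ?addr0.
Defined.
End Even.

Section Odd.
Variables (v : c1 V) (c : {linear c1 V -> k^o}).
Hypotheses (v_cocycle : d1 V v = 0) (c_vanish : forall w, c (d0 V w) = 0).

Lemma odd_in_linear (U U' : lmodType Lambda) (Z : lmodType k) :
  linear (fun x : U => (0, pure v x) : tensor Z U' * tensor (c1 V) U).
Proof.
by move=> a x y; apply: injective_projections; rewrite /= ?scaler0 ?addr0 // pure_linear.
Qed.

Lemma odd_out_linear (U U' : lmodType Lambda) (Z : lmodType k) :
  linear (fun z : tensor Z U' * tensor (c1 V) U => contract c U z.2).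
Proof. by move=> a x y; exact: (linearP (contract c U) a x.2 y.2). Qed.

(** For v of odd degree the sign in d(v (x) x) = - v (x) dx is that of the differential of X[1]. *)
Definition odd_in : cmap2 (hull_shifted X) T.
Proof.
refine (@CMap2 _ (hull_shifted X) T (lin_of (@odd_in_linear _ _ _))
  (lin_of (@odd_in_linear _ _ _)) _ _) => x.
- apply: injective_projections.
    change (0 = tensor_map idfun (d0 X) 0 + tensor_map (d1 V) idfun (pure v x)).
    by rewrite tensor_mapE v_cocycle pure0l linear0 addr0.
  change (pure v (- d1 X x) =
    tensor_map (d0 V) idfun 0 - tensor_map idfun (d1 X) (pure v x)).
  by rewrite tensor_mapE pureN linear0 add0r.
- apply: injective_projections.
    change (0 = tensor_map idfun (d1 X) 0 + tensor_map (d1 V) idfun (pure v x)).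
    by rewrite tensor_mapE v_cocycle pure0l linear0 addr0.
  change (pure v (- d0 X x) =
    tensor_map (d0 V) idfun 0 - tensor_map idfun (d0 X) (pure v x)).
  by rewrite tensor_mapE pureN linear0 add0r.
Defined.

Definition odd_out : cmap2 T (hull_shifted X).
Proof.
refine (@CMap2 _ T (hull_shifted X) (lin_of (@odd_out_linear _ _ _))
  (lin_of (@odd_out_linear _ _ _)) _ _).
- move=> [a b]; change (contract c _ (tensor_map (d0 V) idfun a -
    tensor_map idfun (d1 X) b) = - d1 X (contract c _ b)).
  by rewrite linearB contract_map contract_vanish ?sub0r.
- move=> [a b]; change (contract c _ (tensor_map (d0 V) idfun a -
    tensor_map idfun (d0 X) b) = - d0 X (contract c _ b)).
  by rewrite linearB contract_map contract_vanish ?sub0r.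
Defined.
End Odd.

Section Homotopy.
Variables (s0 : {linear c0 V -> c1 V}) (s1 : {linear c1 V -> c0 V}).

(** The homotopy s (x) 1; s is odd on B_2, so the diagonal blocks are zero. *)
Definition tensor_s0 : {linear c0 T -> c1 T} :=
  pair_map (zero_map _ _) (tensor_map s1 idfun) (tensor_map s0 idfun) (zero_map _ _).
Definition tensor_s1 : {linear c1 T -> c0 T} :=
  pair_map (zero_map _ _) (tensor_map s1 idfun) (tensor_map s0 idfun) (zero_map _ _).

Lemma tensor_s0E a b :
  tensor_s0 (a, b) = (tensor_map s1 idfun b, tensor_map s0 idfun a).
Proof. by apply: injective_projections; [exact: add0r|exact: addr0]. Qed.
Lemma tensor_s1E a b :
  tensor_s1 (a, b) = (tensor_map s1 idfun b, tensor_map s0 idfun a).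
Proof. by apply: injective_projections; [exact: add0r|exact: addr0]. Qed.

Lemma tensor_d0E a b : d0 T (a, b) =
  (tensor_map idfun (d0 X) a + tensor_map (d1 V) idfun b,
   tensor_map (d0 V) idfun a - tensor_map idfun (d1 X) b).
Proof. by []. Qed.
Lemma tensor_d1E a b : d1 T (a, b) =
  (tensor_map idfun (d1 X) a + tensor_map (d1 V) idfun b,
   tensor_map (d0 V) idfun a - tensor_map idfun (d0 X) b).
Proof. by []. Qed.

(** The two terms containing the differential of X cancel because of the sign in the tensor
    differential, which leaves (d s + s d) (x) 1. *)
Lemma tensor_homotopy0 a b :
  d1 T (tensor_s0 (a, b)) + tensor_s1 (d0 T (a, b)) =
  (tensor_map (d1 V) idfun (tensor_map s0 idfun a) +
     tensor_map s1 idfun (tensor_map (d0 V) idfun a),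
   tensor_map (d0 V) idfun (tensor_map s1 idfun b) +
     tensor_map s0 idfun (tensor_map (d1 V) idfun b)).
Proof.
rewrite tensor_s0E tensor_d1E tensor_d0E tensor_s1E; apply: injective_projections.
  change (tensor_map idfun (d1 X) (tensor_map s1 idfun b) +
      tensor_map (d1 V) idfun (tensor_map s0 idfun a) +
      tensor_map s1 idfun (tensor_map (d0 V) idfun a - tensor_map idfun (d1 X) b) =
    tensor_map (d1 V) idfun (tensor_map s0 idfun a) +
      tensor_map s1 idfun (tensor_map (d0 V) idfun a)).
  by rewrite linearB tensor_map_swap [X in X + _]addrC addrACA subrr addr0.
change (tensor_map (d0 V) idfun (tensor_map s1 idfun b) -
    tensor_map idfun (d0 X) (tensor_map s0 idfun a) +
    tensor_map s0 idfun (tensor_map idfun (d0 X) a + tensor_map (d1 V) idfun b) =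
  tensor_map (d0 V) idfun (tensor_map s1 idfun b) +
    tensor_map s0 idfun (tensor_map (d1 V) idfun b)).
by rewrite linearD tensor_map_swap addrA subrK.
Qed.

Lemma tensor_homotopy1 a b :
  d0 T (tensor_s1 (a, b)) + tensor_s0 (d1 T (a, b)) =
  (tensor_map (d1 V) idfun (tensor_map s0 idfun a) +
     tensor_map s1 idfun (tensor_map (d0 V) idfun a),
   tensor_map (d0 V) idfun (tensor_map s1 idfun b) +
     tensor_map s0 idfun (tensor_map (d1 V) idfun b)).
Proof.
rewrite tensor_s1E tensor_d0E tensor_d1E tensor_s0E; apply: injective_projections.
  change (tensor_map idfun (d0 X) (tensor_map s1 idfun b) +
      tensor_map (d1 V) idfun (tensor_map s0 idfun a) +
      tensor_map s1 idfun (tensor_map (d0 V) idfun a - tensor_map idfun (d0 X) b) =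
    tensor_map (d1 V) idfun (tensor_map s0 idfun a) +
      tensor_map s1 idfun (tensor_map (d0 V) idfun a)).
  by rewrite linearB tensor_map_swap [X in X + _]addrC addrACA subrr addr0.
change (tensor_map (d0 V) idfun (tensor_map s1 idfun b) -
    tensor_map idfun (d1 X) (tensor_map s0 idfun a) +
    tensor_map s0 idfun (tensor_map idfun (d1 X) a + tensor_map (d1 V) idfun b) =
  tensor_map (d0 V) idfun (tensor_map s1 idfun b) +
    tensor_map s0 idfun (tensor_map (d1 V) idfun b)).
by rewrite linearD tensor_map_swap addrA subrK.
Qed.
End Homotopy.

Lemma tensor_splitting (U : lmodType Lambda) (V0 V1 : lmodType k)
    (d : {linear V0 -> V1}) (d' : {linear V1 -> V0})
    (s : {linear V0 -> V1}) (s' : {linear V1 -> V0})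
    n (v : 'I_n -> V0) (c : 'I_n -> {linear V0 -> k^o}) :
  (forall x, x - \sum_t (c t x : k) *: v t = d' (s x) + s' (d x)) ->
  forall a : tensor V0 U, a - \sum_t pure (v t) (contract (c t) U a) =
    tensor_map d' idfun (tensor_map s idfun a) + tensor_map s' idfun (tensor_map d idfun a).
Proof.
move=> H; elim/tensor_pure_ind => [x y|a b ha hb].
  have pB (u u' : V0) : pure (u - u') y = pure u y - pure u' y.
    by apply/eqP; rewrite eq_sym subr_eq -pure_addl subrK.
  rewrite !tensor_mapE -pure_addl -H pB pure_suml; congr (_ - _).
  by apply: eq_bigr => t _; rewrite contractE pure_bal.
have -> : \sum_t pure (v t) (contract (c t) U (a + b)) =
    \sum_t pure (v t) (contract (c t) U a) + \sum_t pure (v t) (contract (c t) U b).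
  by rewrite -big_split; apply: eq_bigr => t _; rewrite linearD pure_addr.
by rewrite opprD addrACA ha hb !linearD addrACA.
Qed.

Theorem twist_hull_object h0 h1 :
  subquot_dim (fun x : c0 V => d0 V x = 0) (fun x => exists y, x = d1 V y) h0 ->
  subquot_dim (fun x : c1 V => d1 V x = 0) (fun x => exists y, x = d0 V y) h1 ->
  exists N : hull k Q, homotopy_equiv N (twist X M) /\
    cl N = cl M - (cl X *+ h0 - cl X *+ h1).
Proof.
move=> dim0 dim1.
have [r0 [r0K r0r]] := generalized_inverse (d0 V).
have [r1 [r1K r1r]] := generalized_inverse (d1 V).
have [v [c [v_coc r1v c_van cv vE]]] := cohomology_split (@d0d1 _ V) r0K r1K r1r dim0.
have [w [e [w_coc r0w e_van ew wE]]] := cohomology_split (@d1d0 _ V) r1K r0K r0r dim1.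
(* The homotopies found in the two degrees are the components of a single one: as d d = 0, the term
   r0 (d0 x) of the even splitting equals s1 (d0 x), and likewise in odd degree. *)
pose s0 : {linear c0 V -> c1 V} := lin_of (sub_retract_linear (d0 V) r0 r1).
pose s1 : {linear c1 V -> c0 V} := lin_of (sub_retract_linear (d1 V) r1 r0).
have {}vE x : x - \sum_t (c t x : k) *: v t = d1 V (s0 x) + s1 (d0 V x).
  rewrite vE; congr (_ + _); rewrite -[RHS]/(r0 (d0 V x - r1 (d1 V (d0 V x)))).
  by rewrite d1d0 linear0 subr0.
have {}wE x : x - \sum_t (e t x : k) *: w t = d0 V (s1 x) + s0 (d1 V x).
  rewrite wE; congr (_ + _); rewrite -[RHS]/(r1 (d1 V x - r0 (d0 V (d1 V x)))).
  by rewrite d0d1 linear0 subr0.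
have s0v t : s0 (v t) = 0.
  by rewrite -[LHS]/(r1 (v t - r0 (d0 V (v t)))) v_coc linear0 subr0 r1v.
have s1w t : s1 (w t) = 0.
  by rewrite -[LHS]/(r0 (w t - r1 (d1 V (w t)))) w_coc linear0 subr0 r0w.
pose R0 a := @Retract _ _ T X (even_in (v_coc a)) (even_out (c_van a)).
pose R1 b := @Retract _ _ T (hull_shifted X) (odd_in (w_coc b)) (odd_out (e_van b)).
(* Positions below h0 carry the even classes and the next h1 the odd ones; zero maps are the default
   beyond. *)
pose t s : retract T := match (insub s : option 'I_h0) with
  | Some a => R0 a
  | None => if (insub (s - h0)%N : option 'I_h1) is Some b then R1 b
            else @Retract _ _ T X (zero_map2 _ _) (zero_map2 _ _) end.
have tL (a : 'I_h0) : t a = R0 a by rewrite /t valK.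
have tR (b : 'I_h1) : t (h0 + b)%N = R1 b.
  by rewrite /t insubN ?ltnNge ?leq_addr // addKn valK.
have tP s : (s < h0 + h1)%N -> (exists a : 'I_h0, s = a) \/ (exists b : 'I_h1, s = (h0 + b)%N).
  move=> sh; have [sL|sR] := ltnP s h0; first by left; exists (Ordinal sL).
  have sR' : (s - h0 < h1)%N by rewrite ltn_subLR.
  by right; exists (Ordinal sR'); rewrite /= subnKC.
have t_id : identity_upto t (h0 + h1).
  move=> s /tP[[a ->]|[b ->]]; rewrite ?tL ?tR; split=> x.
  - by rewrite [LHS]contractE cv eqxx !scale1r.
  - by rewrite [LHS]contractE cv eqxx !scale1r.
  - by rewrite [LHS]contractE ew eqxx !scale1r.
  - by rewrite [LHS]contractE ew eqxx !scale1r.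
have t_ortho : orthogonal_upto t (h0 + h1).
  move=> s s' /tP[[a ->]|[b ->]] /tP[[a' ->]|[b' ->]]; rewrite ?tL ?tR => ss; split=> x.
  - by rewrite [LHS]contractE cv -val_eqE /= (negPf ss) !scale0r.
  - by rewrite [LHS]contractE cv -val_eqE /= (negPf ss) !scale0r.
  - exact: (linear0 (contract (c a) (c0 X))).
  - exact: (linear0 (contract (c a) (c1 X))).
  - exact: (linear0 (contract (e b) (c1 X))).
  - exact: (linear0 (contract (e b) (c0 X))).
  - by rewrite [LHS]contractE ew (_ : b == b' = false) ?scale0r // -val_eqE -(eqn_add2l h0) (negPf ss).
  - by rewrite [LHS]contractE ew (_ : b == b' = false) ?scale0r // -val_eqE -(eqn_add2l h0) (negPf ss).
have [W [E [G [clW [GE0 GE1] [EG0 EG1] [B0 B1] _]]]] := hull_biproduct eta_add t_id t_ortho.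
have sum_cl : cl W = cl X *+ h0 - cl X *+ h1.
  rewrite clW big_split_ord /=; congr (_ + _).
    under eq_bigr => a _ do rewrite tL /=.
    by rewrite sumr_const card_ord.
  under eq_bigr => b _ do rewrite tR /= (hull_class_shift eta_add).
  by rewrite sumr_const card_ord mulNrn.
(* N is the cone of W -> T -> M, where W is a sum of h0 copies of X and h1 copies of X[1]. *)
exists (Hull (hull_cone (comp_map2 (ev X M) E) (hullP W) (hullP M))); split; last first.
  have := @hull_class_triangle _ _ _ eta_add W M (Hull (hull_cone (comp_map2 (ev X M) E) (hullP W) (hullP M)))
    (comp_map2 (ev X M) E) (homotopy_equiv_refl _).
  by rewrite sum_cl => ->; rewrite addrAC subrr add0r.
have sum_pair (U U' : lmodType Lambda) (I : finType) (F : I -> U * U') :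
    \sum_i F i = (\sum_i (F i).1, \sum_i (F i).2).
  by elim/big_rec3: _ => // i u1 u2 u3 _ ->.
apply: (@cone_retract _ _ _ _ E G (ev X M) (tensor_s0 s0 s1) (tensor_s1 s0 s1)) => //.
- move=> [a b]; rewrite EG0 tensor_homotopy0 big_split_ord /=.
  under eq_bigr => s _ do rewrite tL.
  under [X in _ - (_ + X) = _]eq_bigr => s _ do rewrite tR.
  rewrite !sum_pair /=; apply: injective_projections.
    change (a - (\sum_i pure (v i) (contract (c i) (c0 X) a) + \sum_(i < h1) 0) =
      tensor_map (d1 V) idfun (tensor_map s0 idfun a) +
      tensor_map s1 idfun (tensor_map (d0 V) idfun a)).
    by rewrite big1_eq addr0; exact: tensor_splitting vE a.
  change (b - (\sum_(i < h0) 0 + \sum_i pure (w i) (contract (e i) (c1 X) b)) =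
    tensor_map (d0 V) idfun (tensor_map s1 idfun b) +
    tensor_map s0 idfun (tensor_map (d1 V) idfun b)).
  by rewrite big1_eq add0r; exact: tensor_splitting wE b.
- move=> [a b]; rewrite EG1 tensor_homotopy1 big_split_ord /=.
  under eq_bigr => s _ do rewrite tL.
  under [X in _ - (_ + X) = _]eq_bigr => s _ do rewrite tR.
  rewrite !sum_pair /=; apply: injective_projections.
    change (a - (\sum_i pure (v i) (contract (c i) (c1 X) a) + \sum_(i < h1) 0) =
      tensor_map (d1 V) idfun (tensor_map s0 idfun a) +
      tensor_map s1 idfun (tensor_map (d0 V) idfun a)).
    by rewrite big1_eq addr0; exact: tensor_splitting vE a.
  change (b - (\sum_(i < h0) 0 + \sum_i pure (w i) (contract (e i) (c0 X) b)) =
    tensor_map (d0 V) idfun (tensor_map s1 idfun b) +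
    tensor_map s0 idfun (tensor_map (d1 V) idfun b)).
  by rewrite big1_eq add0r; exact: tensor_splitting wE b.
- apply: B0 => s x /tP[[a sE]|[b sE]]; move: x; rewrite sE ?tL ?tR => x.
    change (tensor_s0 s0 s1 (pure (v a) x, 0) = 0); rewrite tensor_s0E linear0.
    by rewrite tensor_mapE s0v pure0l.
  change (tensor_s0 s0 s1 (0, pure (w b) x) = 0); rewrite tensor_s0E linear0.
  by rewrite tensor_mapE s1w pure0l.
- apply: B1 => s x /tP[[a sE]|[b sE]]; move: x; rewrite sE ?tL ?tR => x.
    change (tensor_s1 s0 s1 (pure (v a) x, 0) = 0); rewrite tensor_s1E linear0.
    by rewrite tensor_mapE s0v pure0l.
  change (tensor_s1 s0 s1 (0, pure (w b) x) = 0); rewrite tensor_s1E linear0.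
  by rewrite tensor_mapE s1w pure0l.
Qed.

End TwistObject.

(** * Homotopically projective 2-periodic complexes *)

Section Kernel.
Variables (R : pzRingType) (U V : lmodType R) (f : {linear U -> V}).

Definition kernel_pred : {pred U} := fun x => f x == 0.

Lemma kernel_submod_closed : submod_closed kernel_pred.
Proof.
split=> [|a x y /eqP fx /eqP fy]; first by apply/eqP; rewrite linear0.
by apply/eqP; rewrite linearP fx fy scaler0 addr0.
Qed.

HB.instance Definition _ := GRing.isSubmodClosed.Build R U kernel_pred kernel_submod_closed.

Record kernel := Kernel { kernel_val :> U; kernel_valP : kernel_val \in kernel_pred }.

HB.instance Definition _ := [isSub for kernel_val].
HB.instance Definition _ := [Choice of kernel by <:].
HB.instance Definition _ := [SubChoice_isSubLmodule of kernel by <:].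
End Kernel.

(** Exactness makes d a surjection onto the kernel of d', through which projectivity lifts h. *)
Lemma projective_lift (R : pzRingType) (X U V W : lmodType R)
    (d : {linear U -> V}) (d' : {linear V -> W}) (h : {linear X -> V}) :
  projective X -> (forall y, d' (d y) = 0) -> (forall x, d' x = 0 -> exists y, x = d y) ->
  (forall x, d' (h x) = 0) -> exists s : {linear X -> U}, forall x, d (s x) = h x.
Proof.
move=> Xp dd ex dh.
have kP (Y : lmodType R) (g : {linear Y -> V}) : (forall y, d' (g y) = 0) ->
    {g' : {linear Y -> kernel d'} | forall y, kernel_val (g' y) = g y}.
  move=> dg; have gk y : g y \in kernel_pred d' by apply/eqP.
  have glin : linear (fun y => Kernel (gk y)).
    by move=> a x y; apply: val_inj; exact: linearP.
  by exists (lin_of glin).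
have [p pE] := kP _ d dd; have [h' hE] := kP _ h dh.
have [|s sE] := Xp _ _ p h'.
  move=> [y yk]; have [z yz] := ex y (eqP yk); exists z; apply: val_inj.
  by rewrite /= pE -yz.
by exists s => x; rewrite -pE -hE; congr kernel_val; exact: sE.
Qed.

Section Kprojective.
Variable R : pzRingType.
Implicit Types A X Y M N : cplx2 R.

Definition acyclic2 A : Prop :=
  (forall x, d0 A x = 0 -> exists y, x = d1 A y) /\
  (forall x, d1 A x = 0 -> exists y, x = d0 A y).

Definition nullhomotopic X Y (f0 : c0 X -> c0 Y) (f1 : c1 X -> c1 Y) : Prop :=
  exists (s0 : {linear c0 X -> c1 Y}) (s1 : {linear c1 X -> c0 Y}),
    (forall x, f0 x = d1 Y (s0 x) + s1 (d0 X x)) /\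
    (forall x, f1 x = d0 Y (s1 x) + s0 (d1 X x)).

(** K-projectivity. A 2-periodic complex is in effect unbounded, so projective terms alone do not
    guarantee it. *)
Definition kproj X : Prop := forall A (f : cmap2 X A), acyclic2 A -> nullhomotopic (m0 f) (m1 f).

Lemma acyclic2_shift A : acyclic2 A -> acyclic2 (shift2 A).
Proof.
move=> [ex0 ex1]; split=> x /eqP; rewrite /= oppr_eq0 => /eqP.
  by move=> /ex1[y ->]; exists (- y); rewrite linearN opprK.
by move=> /ex0[y ->]; exists (- y); rewrite linearN opprK.
Qed.

Lemma pair_lin (U U' V : lmodType R) (f : {linear V -> U}) (f' : {linear V -> U'}) :
  linear (fun x : V => (f x, f' x) : U * U').
Proof. by move=> a x y; apply: injective_projections; rewrite /= linearP. Qed.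

Lemma fst_lin (U V V' : lmodType R) (f : {linear U -> (V * V')%type}) :
  linear (fun x => (f x).1).
Proof. by move=> a x y; rewrite linearP. Qed.
Lemma snd_lin (U V V' : lmodType R) (f : {linear U -> (V * V')%type}) :
  linear (fun x => (f x).2).
Proof. by move=> a x y; rewrite linearP. Qed.

Section Lifting.
Variables (X M N : cplx2 R) (eps : cmap2 M N).
Hypotheses (Xk : kproj X) (eps_qis : acyclic2 (cone eps)).

(** Regard h as a map into the cone of eps. In a nullhomotopy of it, the components along M form the
    lift f and those along N the homotopy. *)
Lemma kproj_surj (h : cmap2 X N) : exists f : cmap2 X M,
  nullhomotopic (fun x => m0 h x - m0 eps (m0 f x)) (fun x => m1 h x - m1 eps (m1 f x)).
Proof.
pose F0 : {linear c0 X -> c0 (cone eps)} := lin_of (pair_lin (m0 h) (zero_map _ _)).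
pose F1 : {linear c1 X -> c1 (cone eps)} := lin_of (pair_lin (m1 h) (zero_map _ _)).
have P0 x : F1 (d0 X x) = d0 (cone eps) (F0 x).
  by apply: injective_projections; rewrite /= !linear0 ?addr0 ?oppr0 ?m0P.
have P1 x : F0 (d1 X x) = d1 (cone eps) (F1 x).
  by apply: injective_projections; rewrite /= !linear0 ?addr0 ?oppr0 ?m1P.
have [s [t [sE tE]]] := Xk (CMap2 P0 P1) eps_qis.
pose f0 : {linear c0 X -> c0 M} := lin_of (snd_lin s).
pose f1 : {linear c1 X -> c1 M} := lin_of (snd_lin t).
have f0P x : f1 (d0 X x) = d0 M (f0 x).
  by have := congr1 snd (sE x); rewrite /= addrC => /esym/eqP; rewrite subr_eq0 => /eqP.
have f1P x : f0 (d1 X x) = d1 M (f1 x).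
  by have := congr1 snd (tE x); rewrite /= addrC => /esym/eqP; rewrite subr_eq0 => /eqP.
exists (CMap2 f0P f1P), (lin_of (fst_lin s)), (lin_of (fst_lin t)); split=> x /=.
  have /= -> := congr1 fst (sE x); by rewrite addrAC addrK.
have /= -> := congr1 fst (tE x); by rewrite addrAC addrK.
Qed.

(** A nullhomotopy s of eps f makes (s, -f) a chain map into the shifted cone; when that map is
    contracted, the components along M contract f. *)
Lemma kproj_inj (f : cmap2 X M) :
  nullhomotopic (fun x => m0 eps (m0 f x)) (fun x => m1 eps (m1 f x)) ->
  nullhomotopic (m0 f) (m1 f).
Proof.
move=> [s [t [sE tE]]].
pose F0 : {linear c0 X -> c0 (shift2 (cone eps))} := lin_of (pair_lin s (opp_map (m0 f))).
pose F1 : {linear c1 X -> c1 (shift2 (cone eps))} := lin_of (pair_lin t (opp_map (m1 f))).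
have P0 x : F1 (d0 X x) = d0 (shift2 (cone eps)) (F0 x).
  apply: injective_projections; rewrite /= linearN ?opprK ?m0P //.
    by rewrite opprB sE [d1 _ _ + _]addrC addrK.
  by rewrite linearN.
have P1 x : F0 (d1 X x) = d1 (shift2 (cone eps)) (F1 x).
  apply: injective_projections; rewrite /= linearN ?opprK ?m1P //.
    by rewrite opprB tE [d0 _ _ + _]addrC addrK.
  by rewrite linearN.
have [S [S' [SE SE']]] := Xk (CMap2 P0 P1) (acyclic2_shift eps_qis).
exists (opp_map (lin_of (snd_lin S))), (opp_map (lin_of (snd_lin S'))); split=> x /=.
  have /= /eqP := congr1 snd (SE x); rewrite opprK eqr_oppLR => /eqP ->.
  by rewrite opprD linearN.
have /= /eqP := congr1 snd (SE' x); rewrite opprK eqr_oppLR => /eqP ->.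
by rewrite opprD linearN.
Qed.
End Lifting.

(** * Folded three-term complexes *)

Section ThreeFold.
Variables (X2 X1 X0 : lmodType R) (p2 : {linear X2 -> X1}) (p1 : {linear X1 -> X0}).
Hypothesis p12 : forall x, p1 (p2 x) = 0.

Lemma three_fold_d0 : linear (fun x : X0 * X2 => p2 x.2).
Proof. by move=> a x y; rewrite /= linearP. Qed.

(** A model of the folded complex with finite products in place of sums over all integers,
    convenient for computing Hom. *)
Definition three_fold : cplx2 R.
Proof.
refine (@Cplx2 R (X0 * X2)%type X1 (lin_of three_fold_d0)
  (lin_of (pair_lin p1 (zero_map X1 X2))) _ _) => x /=.
  by apply: injective_projections; rewrite //= p12.
by rewrite linear0.
Defined.

Lemma three_fold_kproj : projective X2 -> projective X1 -> projective X0 -> kproj three_fold.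
Proof.
move=> pr2 pr1 pr0 A f [ex0 ex1].
have inl_lin : linear (fun x : X0 => (x, 0) : X0 * X2).
  by move=> a x y; apply: injective_projections; rewrite //= scaler0 addr0.
have inr_lin : linear (fun x : X2 => (0, x) : X0 * X2).
  by move=> a x y; apply: injective_projections; rewrite //= scaler0 addr0.
pose i0 := lin_of inl_lin; pose i2 := lin_of inr_lin.
have f0P := m0P f; have f1P := m1P f; rewrite /= in f0P f1P.
have [|s0 s0E] := @projective_lift _ _ _ _ _ (d1 A) (d0 A) (lin_comp (m0 f) i0) pr0 (@d0d1 _ A) ex0.
  by move=> x; rewrite -[LHS]/(d0 A (m0 f (x, 0))) -f0P /= !linear0.
have sub_lin (U V : lmodType R) (g g' : {linear U -> V}) : linear (fun x => g x - g' x).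
  by move=> a x y; rewrite [g _]linearP [g' _]linearP opprD scalerBr addrACA.
have [|s1 s1E] := @projective_lift _ _ _ _ _ (d0 A) (d1 A)
    (lin_of (sub_lin _ _ (m1 f) (lin_comp s0 p1))) pr1 (@d1d0 _ A) ex1.
  by move=> x; rewrite /= linearB -f1P s0E /= subrr.
have [|s2 s2E] := @projective_lift _ _ _ _ _ (d1 A) (d0 A)
    (lin_of (sub_lin _ _ (lin_comp (m0 f) i2) (lin_comp s1 p2))) pr2 (@d0d1 _ A) ex0.
  by move=> x; rewrite /= linearB -f0P s1E /= p12 linear0 subr0 subrr.
exists (sum_map s0 s2), s1; split=> [[x y]|x] /=.
  rewrite linearD s0E s2E /= addrA subrK -linearD; congr (m0 f _).
  by apply: injective_projections; rewrite /= ?addr0 ?add0r.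
by rewrite s1E /= linear0 addr0 subrK.
Qed.
End ThreeFold.

Section Concentrated.
Variable S : lmodType R.

(** Its terms need not be projective: it is the common target of the augmentations, and it replaces
    a resolution of S as the second argument of Hom. *)
Definition point2 : cplx2 R :=
  @Cplx2 R S 'rV[R]_0 (zero_map _ _) (zero_map _ _) (fun=> erefl) (fun=> erefl).

Lemma point2_cone_acyclic M (eps : cmap2 M point2) :
  (forall (n : S) m, d1 M m = 0 -> exists x, m0 eps x = n /\ m = d0 M x) ->
  (forall x, m0 eps x = 0 -> d0 M x = 0 -> exists m, x = d1 M m) ->
  acyclic2 (cone eps).
Proof.
move=> h0 h1; split=> [[n m] /(congr1 snd)/eqP|[z x]] /=.
  rewrite oppr_eq0 => /eqP dm; have [|x [<- xm]] := h0 n (- m); first by rewrite linearN dm oppr0.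
  exists (0, x); apply: injective_projections; first by rewrite /= add0r.
  by rewrite -[RHS]/(- d0 M x) -xm opprK.
move=> /[dup] /(congr1 fst) /= + /(congr1 snd)/eqP /=.
rewrite add0r oppr_eq0 => e0 /eqP e1; have [m xm] := h1 x e0 e1.
exists (0, - m); apply: injective_projections; first by rewrite [LHS]thinmx0 [RHS]thinmx0.
by rewrite -[RHS]/(- d1 M (- m)) linearN opprK.
Qed.

Lemma point2_map_subproof M (q : {linear c0 M -> S}) : (forall x, q (d1 M x) = 0) ->
  (forall x : c0 M, zero_map (c1 M) 'rV[R]_0 (d0 M x) = d0 point2 (q x)) /\
  (forall x : c1 M, q (d1 M x) = d1 point2 (zero_map (c1 M) 'rV[R]_0 x)).
Proof. by []. Qed.

Definition point2_map M (q : {linear c0 M -> S}) (qd : forall x, q (d1 M x) = 0) :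
  cmap2 M point2 :=
  @CMap2 R M point2 q (zero_map _ _) (point2_map_subproof qd).1 (point2_map_subproof qd).2.
End Concentrated.
End Kprojective.

Section DirectSumMaps.
Variables (R : pzRingType) (I : choiceType) (M : I -> lmodType R).

Lemma dsum_in_subproof i (x : M i) :
  exists s : seq I, forall j, j \notin s -> dfwith (fun j => 0 : M j) x j = 0.
Proof.
exists [:: i] => j; rewrite inE => ji; rewrite dfwith_out //.
by rewrite eq_sym.
Qed.

Definition dsum_in_fun i (x : M i) : dsum M := DSum (dsum_in_subproof x).

Lemma dsum_in_eq i (x : M i) : dsum_in_fun x i = x.
Proof. exact: dfwith_in. Qed.
Lemma dsum_in_neq i j (x : M i) : j != i -> dsum_in_fun x j = 0.
Proof. by move=> ji; apply: dfwith_out; rewrite eq_sym. Qed.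

Lemma dsum_in_linear i : linear (@dsum_in_fun i).
Proof.
move=> a x y; apply: dsum_ext => j; rewrite -[RHS]/(a *: dsum_in_fun x j + dsum_in_fun y j).
have [->|ji] := eqVneq j i; first by rewrite !dsum_in_eq.
by rewrite !dsum_in_neq // scaler0 addr0.
Qed.

Definition dsum_in i : {linear M i -> dsum M} := lin_of (@dsum_in_linear i).

Variable s : seq I.
Hypotheses (s_uniq : uniq s) (s_cover : forall i, i \notin s -> forall x : M i, x = 0).

Lemma dsum_out_linear (U : lmodType R) (g : forall i, {linear M i -> U}) :
  linear (fun x : dsum M => \sum_(i <- s) g i (x i)).
Proof.
move=> a x y; rewrite scaler_sumr -big_split; apply: eq_bigr => i _ /=.
exact: linearP.
Qed.

Definition dsum_out (U : lmodType R) (g : forall i, {linear M i -> U}) : {linear dsum M -> U} :=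
  lin_of (dsum_out_linear g).

Lemma dsum_out_in (U : lmodType R) (g : forall i, {linear M i -> U}) i x :
  dsum_out g (dsum_in i x) = g i x.
Proof.
rewrite -[LHS]/(\sum_(j <- s) g j (dsum_in_fun x j)).
have [is_|is_] := boolP (i \in s).
  rewrite (bigD1_seq i) // dsum_in_eq big1 => [|j ji]; first by rewrite [LHS]addr0.
  by rewrite dsum_in_neq // linear0.
rewrite [x](s_cover is_) linear0 big1 // => j _.
have [->|ji] := eqVneq j i; first by rewrite dsum_in_eq linear0.
by rewrite dsum_in_neq // linear0.
Qed.

Lemma dsum_expand (x : dsum M) : x = \sum_(i <- s) dsum_in i (x i).
Proof.
apply: dsum_ext => j.
have -> : (\sum_(i <- s) dsum_in i (x i) : dsum M) j = \sum_(i <- s) dsum_in_fun (x i) j.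
  by elim/big_rec2: _ => // i u v _ <-.
have [js|js] := boolP (j \in s).
  rewrite (bigD1_seq j) // dsum_in_eq big1 => [|i ij]; first by rewrite [RHS]addr0.
  by rewrite dsum_in_neq // eq_sym.
by rewrite [LHS](s_cover js) [RHS](s_cover js).
Qed.

Lemma dsum_linear_ext (U : lmodType R) (f g : {linear dsum M -> U}) :
  (forall i x, f (dsum_in i x) = g (dsum_in i x)) -> f =1 g.
Proof.
by move=> fg x; rewrite (dsum_expand x) !linear_sum; apply: eq_bigr => i _.
Qed.
End DirectSumMaps.

Definition int_range (b : nat) : seq int := [seq (m%:Z - b%:Z) | m <- iota 0 b.*2.+1].

Lemma int_range_uniq b : uniq (int_range b).
Proof. by rewrite map_inj_uniq ?iota_uniq // => m n /addIr[]. Qed.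

Lemma mem_int_range b (n : int) : n \notin int_range b -> (b < `|n|)%N.
Proof.
apply: contraR; rewrite -leqNgt => h; apply/mapP; exists `|(n + b%:Z)%R|%N; last by lia.
by rewrite mem_iota; lia.
Qed.

(** * Folding bounded complexes of projectives *)

Section Fold.
Variables (R : pzRingType) (P : cplx R).
Local Notation even_in := (dsum_in (fun n : int => P (n * 2))).
Local Notation odd_in := (dsum_in (fun n : int => P (n * 2 + 1))).

Lemma fold_d0_in n x :
  d0 (fold2 P) (even_in n x) =
  odd_in n (cdiff P (n * 2) (n * 2 + 1) x).
Proof.
apply: dsum_ext => m; rewrite -[LHS]/(cdiff P (m * 2) (m * 2 + 1) (dsum_in_fun x m)).
rewrite -[RHS]/(dsum_in_fun _ m); have [->|mn] := eqVneq m n; first by rewrite !dsum_in_eq.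
by rewrite !dsum_in_neq // linear0.
Qed.

Lemma fold_d1_in n m x : n = m - 1 ->
  d1 (fold2 P) (odd_in n x) =
  even_in m (cdiff P (n * 2 + 1) (m * 2) x).
Proof.
move=> nE; subst n; apply: dsum_ext => j.
rewrite -[LHS]/(cdiff P ((j - 1) * 2 + 1) (j * 2)
  (dsum_in_fun (M := fun n : int => P (n * 2 + 1)) x (j - 1))).
rewrite -[RHS]/(dsum_in_fun _ j); have [->|mn] := eqVneq j m; first by rewrite !dsum_in_eq.
by rewrite !dsum_in_neq ?linear0 //; apply: contraNneq mn => /addIr->.
Qed.

Section Kprojective.
Hypotheses (P_proj : forall n, projective (P n)) (P_pos : forall n : int, 0 < n -> forall x : P n, x = 0).
Variable b : nat.
Hypothesis P_bound : vanishes_beyond b P.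
Variables (A : cplx2 R) (f : cmap2 (fold2 P) A).
Hypothesis A_acyclic : acyclic2 A.

Let f0 n : {linear P (n * 2) -> c0 A} := lin_comp (m0 f) (even_in n).
Let f1 n : {linear P (n * 2 + 1) -> c1 A} :=
  lin_comp (m1 f) (odd_in n).

Let f0P n x : d0 A (f0 n x) = f1 n (cdiff P (n * 2) (n * 2 + 1) x).
Proof. by rewrite -[LHS]/(d0 A (m0 f (even_in n x))) -m0P fold_d0_in. Qed.
Let f1P n m x : n = m - 1 -> d1 A (f1 n x) = f0 m (cdiff P (n * 2 + 1) (m * 2) x).
Proof. by move=> nm; rewrite -[LHS]/(d1 A (m1 f (odd_in n x))) -m1P (fold_d1_in _ nm). Qed.

Let even_eq (se : forall n, {linear P (n * 2) -> c1 A})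
    (so : forall n, {linear P (n * 2 + 1) -> c0 A}) (n : int) : Prop :=
  forall x, d1 A (se n x) = f0 n x - so n (cdiff P (n * 2) (n * 2 + 1) x).
(** The degrees 2n + 1 and 2m are consecutive when n = m - 1; keeping this as an equation avoids
    transport between components. *)
Let odd_eq (se : forall n, {linear P (n * 2) -> c1 A})
    (so : forall n, {linear P (n * 2 + 1) -> c0 A}) (m : int) : Prop :=
  forall n, n = m - 1 -> forall x,
    d0 A (so n x) = f1 n x - se m (cdiff P (n * 2 + 1) (m * 2) x).

Let sub_comp_lin (U V W : lmodType R) (g : {linear U -> W}) (h : {linear V -> W})
    (e : {linear U -> V}) : linear (fun x => g x - h (e x)).
Proof.
by move=> a x y; rewrite [g _]linearP [e _]linearP [h _]linearP opprD scalerBr addrACA.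
Qed.

(* Descending induction: the homotopy is built from degree 0 downwards, each
   component being a lift through a projective. *)
Lemma partial_homotopy (N : nat) : exists se so, forall n : int, - N%:Z < n ->
  even_eq se so n /\ odd_eq se so n.
Proof.
elim: N => [|N [se [so H]]].
  exists (fun n => zero_map _ _), (fun n => zero_map _ _) => n n0; split.
    by move=> x; rewrite (P_pos (n := n * 2) _ x) ?linear0 ?addr0 //; lia.
  by move=> m mE x; rewrite (P_pos (n := m * 2 + 1) _ x) ?linear0 ?addr0 //; lia.
pose n0 : int := - N%:Z; have [ex0 ex1] := A_acyclic.
have [|t tE] := @projective_lift _ _ _ _ _ (d1 A) (d0 A)
    (lin_of (sub_comp_lin (f0 n0) (so n0) (cdiff P (n0 * 2) (n0 * 2 + 1))))
    (@P_proj _) (@d0d1 _ A) ex0.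
  move=> x; rewrite /= linearB -[m0 f _]/(f0 n0 x) f0P.
  have n1 : - N%:Z < n0 + 1 by lia.
  rewrite (proj2 (H _ n1) n0 (esym (addrK 1 n0))).
  by rewrite cdiffK linear0 subr0 subrr.
have [|t' tE'] := @projective_lift _ _ _ _ _ (d0 A) (d1 A)
    (lin_of (sub_comp_lin (f1 (n0 - 1)) t (cdiff P ((n0 - 1) * 2 + 1) (n0 * 2))))
    (@P_proj _) (@d1d0 _ A) ex1.
  move=> x; rewrite /= linearB -[m1 f _]/(f1 (n0 - 1) x) (f1P _ erefl) tE /=.
  by rewrite cdiffK linear0 subr0 subrr.
pose se' := dfwith se t; pose so' := dfwith so t'.
exists se', so' => n nN; have [nE|nE] := eqVneq n n0.
  subst n; split=> [x|m mE x].
    by rewrite /se' dfwith_in tE /so' dfwith_out //; lia.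
  by subst m; rewrite /se' /so' !dfwith_in tE'.
have [|Hn Hn'] := H n; first by lia.
split=> [x|m mE x].
  by rewrite /se' /so' !dfwith_out ?Hn //; lia.
by rewrite /se' /so' !dfwith_out ?(Hn' _ mE) //; lia.
Qed.

(** Boundedness makes all equations below a certain degree trivial, so a partial homotopy that
    reaches far enough is complete, and only finitely many components have to be summed. *)
Lemma fold_nullhomotopic : nullhomotopic (m0 f) (m1 f).
Proof.
have [se [so H]] := partial_homotopy b.+1.
have He n : even_eq se so n.
  have [/H[] //|nb] := boolP (- b.+1%:Z < n); move=> x.
  by rewrite (P_bound (n := n * 2) _ x) ?linear0 ?addr0 //; lia.
have Ho n : odd_eq se so n.
  have [/H[] //|nb] := boolP (- b.+1%:Z < n); move=> m mE x.
  by rewrite (P_bound (n := m * 2 + 1) _ x) ?linear0 ?addr0 //; lia.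
have ce i : i \notin int_range b -> forall x : P (i * 2), x = 0.
  by move=> /mem_int_range h x; apply: P_bound; lia.
have co i : i \notin int_range b.+1 -> forall x : P (i * 2 + 1), x = 0.
  by move=> /mem_int_range h x; apply: P_bound; lia.
pose S0 : {linear c0 (fold2 P) -> c1 A} := dsum_out (int_range b) se.
pose S1 : {linear c1 (fold2 P) -> c0 A} := dsum_out (int_range b.+1) so.
have S0E n x : S0 (even_in n x) = se n x.
  exact: dsum_out_in (int_range_uniq b) ce _ _ _ _.
have S1E n x : S1 (odd_in n x) = so n x.
  exact: dsum_out_in (int_range_uniq b.+1) co _ _ _ _.
have add_lin (U V : lmodType R) (g h : {linear U -> V}) : linear (fun x => g x + h x).
  by move=> a x y; rewrite [g _]linearP [h _]linearP scalerDr addrACA.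
exists S0, S1; split=> x.
- have := dsum_linear_ext (int_range_uniq b) ce (f := m0 f)
    (g := lin_of (add_lin _ _ (lin_comp (d1 A) S0) (lin_comp S1 (d0 (fold2 P))))).
  apply=> n y; rewrite -[RHS]/(d1 A (S0 (even_in n y)) + S1 (d0 (fold2 P) (even_in n y))).
  by rewrite S0E fold_d0_in S1E (He n) subrK.
- have := dsum_linear_ext (int_range_uniq b.+1) co (f := m1 f)
    (g := lin_of (add_lin _ _ (lin_comp (d0 A) S1) (lin_comp S0 (d1 (fold2 P))))).
  apply=> n y; have nE : n = (n + 1) - 1 by rewrite addrK.
  rewrite -[RHS]/(d0 A (S1 (odd_in n y)) + S0 (d1 (fold2 P) (odd_in n y))).
  by rewrite S1E (fold_d1_in _ nE) S0E (Ho (n + 1) _ nE) subrK.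
Qed.
End Kprojective.
End Fold.

Section FoldResolution.
Variables (R : pzRingType) (S : lmodType R) (P : cplx R).
Variables (q : cmap P (stalk S)) (q_qis : quasi_iso q).

Lemma stalk_zero n (x : stalk S n) : n != 0 -> x = 0.
Proof.
move=> n0; move: x; rewrite /= /stalk_obj (negPf n0) => x.
exact: thinmx0.
Qed.

Lemma resolution_exact (a b c : int) (z : P b) : b = a + 1 -> c = b + 1 ->
  cdiff P b c z = 0 -> q b z = 0 -> exists w, z = cdiff P a b w.
Proof.
move=> ba cb; have aE : a = b - 1 by rewrite ba addrK.
subst c a => dz qz; have [inj _] := q_qis b.
by apply: inj => //; exists 0; rewrite qz.
Qed.

Lemma augmentation_linear : linear (fun x : fold_even P => q 0 (x 0) : S).
Proof. by move=> a x y; rewrite -[RHS](linearP (q 0)). Qed.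

Lemma augmentation_d1 (x : fold_odd P) : lin_of augmentation_linear (d1 (fold2 P) x) = 0.
Proof. rewrite -[LHS]/(q (0 * 2) _).
exact: (cmapP q (0 * 2) (x (0 - 1))). Qed.

Definition augmentation : cmap2 (fold2 P) (point2 S) := point2_map (M := fold2 P) augmentation_d1.

Lemma augmentation_acyclic : acyclic2 (cone augmentation).
Proof.
apply: point2_cone_acyclic => [s m dm|x qx dx].
  have dm' n j : j = n + 1 -> cdiff P (n * 2 + 1) (j * 2) (m n) = 0.
    move=> jn; have nE : n = j - 1 by rewrite jn addrK.
    by subst n; exact: (congr1 (fun y : dsum _ => y j) dm).
  (* The preimage is 0 wherever n and m n allow it, to keep finite support; at n = 0 a cycle is
     added whose image under the augmentation is the missing part of s. *)
  have H n : exists w : P (n * 2), m n = cdiff P (n * 2) (n * 2 + 1) w /\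
      ((n != 0 -> m n = 0 -> w = 0) /\ (forall e : 0 = n,
        q 0 (eq_rect_r (fun j : int => P (j * 2)) w e) = s)).
    have [w wE] : exists w, m n = cdiff P (n * 2) (n * 2 + 1) w.
      apply: (resolution_exact (c := (n + 1) * 2)) => //; first by lia.
        exact: dm'.
      by apply: stalk_zero; lia.
    have [n0|n0] := eqVneq n 0; last first.
      have [mn|mn] := eqVneq (m n) 0.
        by exists 0; rewrite linear0; split=> //; split=> // e; rewrite e eqxx in n0.
      by exists w; split=> //; split=> [_ mn0|e]; [rewrite mn0 eqxx in mn|rewrite e eqxx in n0].
    subst n; have [_ /(_ (s - q 0 w) erefl) [z [dz [y]]]] := q_qis 0.
    move/eqP; rewrite subr_eq0 => /eqP sz.
    have dz' : cdiff P (0 * 2) (0 * 2 + 1) z = 0 := dz.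
    exists (w + z); rewrite linearD -wE dz' addr0; split=> //; split=> // e.
    by rewrite (Prop_irrelevance e erefl) /= linearD -sz addrC subrK.
  pose w n := projT1 (cid (H n)); have wE n := projT2 (cid (H n)).
  have ws : exists t : seq int, forall n, n \notin t -> w n = 0.
    have [t tE] := dsumP m; exists (0 :: t) => n; rewrite inE negb_or => /andP[n0 nt].
    by have [_ [h _]] := wE n; apply: h n0 (tE n nt).
  exists (DSum ws); split; last by apply: dsum_ext => n; case: (wE n).
  by have [_ [_ /(_ erefl)]] := wE 0.
have H n : exists w : P (n * 2 + 1), x (n + 1) = cdiff P (n * 2 + 1) ((n + 1) * 2) w /\
    (x (n + 1) = 0 -> w = 0).
  have [x0|x0] := eqVneq (x (n + 1)) 0; first by exists 0; rewrite linear0.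
  have [w wE] : exists w, x (n + 1) = cdiff P (n * 2 + 1) ((n + 1) * 2) w.
    apply: (resolution_exact (c := (n + 1) * 2 + 1)) => //; first by lia.
      exact: (congr1 (fun y : dsum _ => y (n + 1)) dx).
    have [/= n0|n0] := eqVneq ((n + 1) * 2 : int) 0; last exact: stalk_zero.
    have -> // : forall j : int, j = 0 -> q (j * 2) (x j) = 0 by move=> j ->.
    by lia.
  by exists w; split=> // xn; rewrite xn eqxx in x0.
pose w n := projT1 (cid (H n)); have wE n := projT2 (cid (H n)).
have ws : exists t : seq int, forall n, n \notin t -> w n = 0.
  have [t tE] := dsumP x; exists [seq n - 1 | n <- t] => n nt.
  have [_ h] := wE n; apply: h; apply: tE; apply: contra nt => nt.
  by apply/mapP; exists (n + 1); rewrite ?addrK.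
exists (DSum ws); apply: dsum_ext => j.
have h n : j = n + 1 -> x j = cdiff P (n * 2 + 1) (j * 2) (w n).
  by move=> ->; case: (wE n).
by apply: h; rewrite subrK.
Qed.
End FoldResolution.

(** * Comparison of K-projective complexes *)

Section Nullhomotopic.
Variable R : pzRingType.
Implicit Types W X Y M N : cplx2 R.

Lemma nullhomotopic_eq X Y (f0 g0 : c0 X -> c0 Y) (f1 g1 : c1 X -> c1 Y) :
  f0 =1 g0 -> f1 =1 g1 -> nullhomotopic f0 f1 -> nullhomotopic g0 g1.
Proof. by move=> /funext-> /funext->. Qed.

Lemma nullhomotopicB X Y (f0 g0 : c0 X -> c0 Y) (f1 g1 : c1 X -> c1 Y) :
  nullhomotopic f0 f1 -> nullhomotopic g0 g1 ->
  nullhomotopic (fun x => f0 x - g0 x) (fun x => f1 x - g1 x).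
Proof.
have sub_lin (U V : lmodType R) (s s' : {linear U -> V}) : linear (fun x => s x - s' x).
  by move=> a x y; rewrite [s _]linearP [s' _]linearP opprD scalerBr addrACA.
move=> [s0 [s1 [sE0 sE1]]] [t0 [t1 [tE0 tE1]]].
exists (lin_of (sub_lin _ _ s0 t0)), (lin_of (sub_lin _ _ s1 t1)); split=> x.
  by rewrite sE0 tE0 /= linearB opprD addrACA.
by rewrite sE1 tE1 /= linearB opprD addrACA.
Qed.

Lemma nullhomotopic_post X Y M (h : cmap2 Y M) (f0 : c0 X -> c0 Y) (f1 : c1 X -> c1 Y) :
  nullhomotopic f0 f1 -> nullhomotopic (fun x => m0 h (f0 x)) (fun x => m1 h (f1 x)).
Proof.
move=> [s0 [s1 [sE0 sE1]]]; exists (lin_comp (m1 h) s0), (lin_comp (m0 h) s1).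
by split=> x; rewrite ?sE0 ?sE1 /= linearD ?m0P ?m1P.
Qed.

Lemma nullhomotopic_pre W X Y (g : cmap2 W X) (f0 : c0 X -> c0 Y) (f1 : c1 X -> c1 Y) :
  nullhomotopic f0 f1 -> nullhomotopic (fun x => f0 (m0 g x)) (fun x => f1 (m1 g x)).
Proof.
move=> [s0 [s1 [sE0 sE1]]]; exists (lin_comp s0 (m0 g)), (lin_comp s1 (m1 g)).
by split=> x; rewrite ?sE0 ?sE1 /= ?m0P ?m1P.
Qed.

Lemma sub_map2_subproof X Y (f g : cmap2 X Y) :
  [/\ linear (fun x => m0 f x - m0 g x), linear (fun x => m1 f x - m1 g x),
      forall x, m1 f (d0 X x) - m1 g (d0 X x) = d0 Y (m0 f x - m0 g x) &
      forall x, m0 f (d1 X x) - m0 g (d1 X x) = d1 Y (m1 f x - m1 g x)].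
Proof.
split=> [a x y|a x y|x|x]; last 2 first.
- by rewrite linearB !m0P.
- by rewrite linearB !m1P.
- by rewrite [m0 f _]linearP [m0 g _]linearP opprD scalerBr addrACA.
- by rewrite [m1 f _]linearP [m1 g _]linearP opprD scalerBr addrACA.
Qed.

Lemma sub_map2 X Y (f g : cmap2 X Y) : exists h : cmap2 X Y,
  (forall x, m0 h x = m0 f x - m0 g x) /\ (forall x, m1 h x = m1 f x - m1 g x).
Proof.
have [l0 l1 h0 h1] := sub_map2_subproof f g.
by exists (@CMap2 R X Y (lin_of l0) (lin_of l1) h0 h1).
Qed.

Lemma kproj_homotopic X M N (eps : cmap2 M N) (f g : cmap2 X M) :
  kproj X -> acyclic2 (cone eps) ->
  nullhomotopic (fun x => m0 eps (m0 f x) - m0 eps (m0 g x))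
    (fun x => m1 eps (m1 f x) - m1 eps (m1 g x)) ->
  nullhomotopic (fun x => m0 f x - m0 g x) (fun x => m1 f x - m1 g x).
Proof.
move=> Xk eqis; have [h [hE0 hE1]] := sub_map2 f g => H.
apply: (nullhomotopic_eq hE0 hE1); apply: (kproj_inj Xk eqis).
by apply: nullhomotopic_eq H => x; rewrite ?hE0 ?hE1 linearB.
Qed.

(** Both g f and the identity are lifts of [ex] along [ex], and lifts from a K-projective complex
    are unique up to homotopy. *)
Lemma kproj_inverse X Y N (ex : cmap2 X N) (ey : cmap2 Y N) (f : cmap2 X Y) (g : cmap2 Y X) :
  kproj X -> acyclic2 (cone ex) ->
  nullhomotopic (fun x => m0 ex x - m0 ey (m0 f x)) (fun x => m1 ex x - m1 ey (m1 f x)) ->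
  nullhomotopic (fun x => m0 ey x - m0 ex (m0 g x)) (fun x => m1 ey x - m1 ex (m1 g x)) ->
  homotopic (m0 g \o m0 f) id (m1 g \o m1 f) id.
Proof.
move=> Xk xqis fE gE.
have H : nullhomotopic (fun x => m0 ex (m0 (comp_map2 g f) x) - m0 ex (m0 (id_map2 X) x))
    (fun x => m1 ex (m1 (comp_map2 g f) x) - m1 ex (m1 (id_map2 X) x)).
  have zN : nullhomotopic (fun _ : c0 X => 0 : c0 N) (fun _ : c1 X => 0 : c1 N).
    by exists (zero_map _ _), (zero_map _ _); split=> x; rewrite /= linear0 addr0.
  apply: nullhomotopic_eq (nullhomotopicB (nullhomotopicB zN (nullhomotopic_pre f gE)) fE) => x /=.
    by rewrite sub0r opprB opprB addrA subrK.
  by rewrite sub0r opprB opprB addrA subrK.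
exact: (@kproj_homotopic _ _ _ _ (comp_map2 g f) (id_map2 X) Xk xqis H).
Qed.

Lemma kproj_equiv X Y N (ex : cmap2 X N) (ey : cmap2 Y N) :
  kproj X -> kproj Y -> acyclic2 (cone ex) -> acyclic2 (cone ey) -> homotopy_equiv X Y.
Proof.
move=> Xk Yk xqis yqis.
have [f fE] := kproj_surj Xk yqis ex; have [g gE] := kproj_surj Yk xqis ey.
exists f, g; split; first exact: kproj_inverse fE gE.
exact: kproj_inverse gE fE.
Qed.

Lemma shift_map2_subproof X Y (f : cmap2 X Y) :
  (forall x, m0 f (d0 (shift2 X) x) = d0 (shift2 Y) (m1 f x)) /\
  (forall x, m1 f (d1 (shift2 X) x) = d1 (shift2 Y) (m0 f x)).
Proof. by split=> x; rewrite /= linearN ?m0P ?m1P. Qed.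

Definition shift_map2 X Y (f : cmap2 X Y) : cmap2 (shift2 X) (shift2 Y) :=
  @CMap2 R (shift2 X) (shift2 Y) (m1 f) (m0 f)
    (shift_map2_subproof f).1 (shift_map2_subproof f).2.

Lemma shift_map2_acyclic X Y (f : cmap2 X Y) :
  acyclic2 (cone f) -> acyclic2 (cone (shift_map2 f)).
Proof.
move=> [ex0 ex1]; split=> -[n m] H.
  have [|[y x] /(congr1 (fun z => (- z.1, z.2)))/= E] := ex1 (- n, m).
    have /= e1 := congr1 fst H; have /= e2 := congr1 snd H.
    apply: injective_projections => /=; first by rewrite linearN.
    by rewrite -[RHS]oppr0 -e2 opprK.
  exists (y, - x); rewrite opprK in E; rewrite E.
  apply: injective_projections => /=; first by rewrite [m1 f (- x)]linearN opprD.
  by rewrite [d1 X (- x)]linearN opprK.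
have [|[y x] /(congr1 (fun z => (- z.1, z.2)))/= E] := ex0 (- n, m).
  have /= e1 := congr1 fst H; have /= e2 := congr1 snd H.
  apply: injective_projections => /=; first by rewrite linearN.
  by rewrite -[RHS]oppr0 -e2 opprK.
exists (y, - x); rewrite opprK in E; rewrite E.
apply: injective_projections => /=; first by rewrite [m0 f (- x)]linearN opprD.
by rewrite [d0 X (- x)]linearN opprK.
Qed.
End Nullhomotopic.

(** The hypotheses say that phi induces an isomorphism of Z / B onto Z' / B'. A basis is pulled back
    along it, and the errors b' - phi b are absorbed by B'. *)
Lemma subquot_dim_iso (k : fieldType) (V V' : lmodType k) (Z B : V -> Prop)
    (Z' B' : V' -> Prop) (phi : {linear V -> V'}) n :
  (forall a u v, Z u -> Z v -> Z (a *: u + v)) -> B' 0 ->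
  (forall a u v, B' u -> B' v -> B' (a *: u + v)) ->
  (forall v, Z v -> Z' (phi v)) -> (forall v, B v -> B' (phi v)) ->
  (forall v, Z v -> B' (phi v) -> B v) ->
  (forall v', Z' v' -> exists2 v, Z v & B' (v' - phi v)) ->
  subquot_dim Z' B' n -> subquot_dim Z B n.
Proof.
move=> Zlin B0 Blin ZZ BB inj surj [b' [bZ bu]].
pose b i := projT1 (cid2 (surj _ (bZ i))).
have [bZ' bB] : (forall i, Z (b i)) /\ (forall i, B' (b' i - phi (b i))).
  by split=> i; rewrite /b; case: (cid2 (surj _ (bZ i))).
have Zsub z (c : 'rV[k]_n) : Z z -> Z (z - \sum_(i < n) c 0 i *: b i).
  move=> zZ; rewrite -sumrN; elim/big_rec: _ => [|i u _ IH]; first by rewrite addr0.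
  by rewrite addrCA -scaleNr; apply: Zlin.
have Bsum (c : 'rV[k]_n) : B' (\sum_(i < n) c 0 i *: (b' i - phi (b i))).
  by elim/big_rec: _ => // i u _; apply: Blin.
have key z (c : 'rV[k]_n) : phi (z - \sum_(i < n) c 0 i *: b i) =
    (phi z - \sum_(i < n) c 0 i *: b' i) + \sum_(i < n) c 0 i *: (b' i - phi (b i)).
  rewrite linearB linear_sum -addrA; congr (_ + _).
  rewrite -sumrN -sumrN -big_split; apply: eq_bigr => i _.
  by rewrite linearZ /= scalerBr addKr.
exists b; split=> // z zZ; have [c [cB cu]] := bu _ (ZZ _ zZ).
exists c; split=> [|c' c'B].
  by apply: inj; [exact: Zsub|rewrite key -[X in X + _]scale1r; apply: Blin].
apply: cu; have := BB _ c'B; rewrite key => H.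
rewrite -(addrK (\sum_(i < n) c' 0 i *: (b' i - phi (b i))) (phi z - _)).
by rewrite addrC -[X in X + _]scaleN1r; apply: Blin.
Qed.

(** * Cohomology of B_2 as homotopy classes of maps *)

Section HomCohomology.
Variables (k : fieldType) (L : algType k).
Implicit Types X Y M N : cplx2 L.

Definition hom_dim0 X M n := subquot_dim (fun x : c0 (B2 X M) => d0 (B2 X M) x = 0)
  (fun x => exists y, x = d1 (B2 X M) y) n.
Definition hom_dim1 X M n := subquot_dim (fun x : c1 (B2 X M) => d1 (B2 X M) x = 0)
  (fun x => exists y, x = d0 (B2 X M) y) n.

Lemma B2_cocycle X M (f : B2_0 X M) : d0 (B2 X M) f = 0 <->
  (forall x, homk_fun f.2 (d0 X x) = d0 M (homk_fun f.1 x)) /\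
  (forall x, homk_fun f.1 (d1 X x) = d1 M (homk_fun f.2 x)).
Proof.
split=> [H|[h0 h1]].
  have e1 := congr1 fst H; have e2 := congr1 snd H; split=> x.
    apply/esym/eqP; rewrite -subr_eq0; apply/eqP.
    exact: (congr1 (fun h => homk_fun h x) e1).
  apply/esym/eqP; rewrite -subr_eq0 addrC; apply/eqP.
  exact: (congr1 (fun h => homk_fun h x) e2).
apply: injective_projections; apply: homk_ext => x.
  rewrite -[LHS]/(d0 M (homk_fun f.1 x) - homk_fun f.2 (d0 X x)).
  by rewrite h0 subrr.
rewrite -[LHS]/(- homk_fun f.1 (d1 X x) + d1 M (homk_fun f.2 x)).
by rewrite h1 addNr.
Qed.

Lemma B2_boundary X M (f : B2_0 X M) : (exists y, f = d1 (B2 X M) y) <->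
  nullhomotopic (X := X) (Y := M) (homk_fun f.1) (homk_fun f.2).
Proof.
split=> [[[s t] ->]|[s [t [sE tE]]]].
  by exists s, t; split=> x //=; rewrite addrC.
exists ((s : homk _ _), (t : homk _ _)); apply: injective_projections; apply: homk_ext => x.
  by rewrite -[LHS]/(homk_fun f.1 x) sE.
by rewrite -[LHS]/(homk_fun f.2 x) tE addrC.
Qed.

Lemma cocycle_map X M (f : B2_0 X M) : d0 (B2 X M) f = 0 ->
  exists g : cmap2 X M, m0 g = f.1 /\ m1 g = f.2.
Proof. by move=> /B2_cocycle[h0 h1]; exists (@CMap2 L X M f.1 f.2 h0 h1). Qed.

Lemma map_cocycle X M (g : cmap2 X M) :
  d0 (B2 X M) ((m0 g : homk _ _), (m1 g : homk _ _)) = 0.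
Proof. by apply/B2_cocycle; split=> x; [exact: m0P|exact: m1P]. Qed.

Lemma cocycle_linear X M (f g : B2_0 X M) a :
  d0 (B2 X M) f = 0 -> d0 (B2 X M) g = 0 -> d0 (B2 X M) (a *: f + g) = 0.
Proof. by move=> f0 g0; rewrite linearP f0 g0 scaler0 addr0. Qed.

Lemma boundary_linear X M (f g : B2_0 X M) a :
  (exists y, f = d1 (B2 X M) y) -> (exists y, g = d1 (B2 X M) y) ->
  exists y, a *: f + g = d1 (B2 X M) y.
Proof. by move=> [y ->] [z ->]; exists (a *: y + z); rewrite linearP. Qed.

(** By K-projectivity of the source, composition with [eps] is bijective on homotopy classes:
    [kproj_surj] and [kproj_inj]. *)
Lemma hom_dim0_post X M N (eps : cmap2 M N) n :
  kproj X -> acyclic2 (cone eps) -> hom_dim0 X N n -> hom_dim0 X M n.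
Proof.
move=> Xk eqis.
apply: (subquot_dim_iso (phi := lin_of (dsum2_linear (hom_post (c0 X) (m0 eps)) (hom_post (c1 X) (m1 eps))))).
- by move=> a u v; apply: cocycle_linear.
- by exists 0; rewrite linear0.
- by move=> a u v; apply: boundary_linear.
- by move=> f /B2_cocycle[h0 h1]; apply/B2_cocycle; split=> x /=; rewrite ?h0 ?h1 ?m0P ?m1P.
- by move=> f /B2_boundary f0; apply/B2_boundary; exact: (nullhomotopic_post eps f0).
- case=> f0 f1 /cocycle_map[g [/= gE0 gE1]] /B2_boundary H; subst f0 f1; apply/B2_boundary.
  exact: (kproj_inj Xk eqis H).
- case=> f0 f1 /cocycle_map[h [/= hE0 hE1]]; subst f0 f1; have [g gE] := kproj_surj Xk eqis h.
  exists ((m0 g : homk _ _), (m1 g : homk _ _)); first exact: map_cocycle.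
  exact/B2_boundary.
Qed.

Lemma hom_dim0_pre X Y N n : homotopy_equiv X Y -> hom_dim0 Y N n -> hom_dim0 X N n.
Proof.
move=> [f [g [gf fg]]].
apply: (subquot_dim_iso (phi := lin_of (dsum2_linear (hom_pre (c0 N) (m0 g)) (hom_pre (c1 N) (m1 g))))).
- by move=> a u v; apply: cocycle_linear.
- by exists 0; rewrite linear0.
- by move=> a u v; apply: boundary_linear.
- by move=> h /B2_cocycle[h0 h1]; apply/B2_cocycle; split=> x /=; rewrite -?h0 -?h1 ?m0P ?m1P.
- by move=> h /B2_boundary h0; apply/B2_boundary; exact: (nullhomotopic_pre g h0).
- case=> h0 h1 /cocycle_map[e [/= eE0 eE1]] /B2_boundary H; subst h0 h1; apply/B2_boundary.
  have := nullhomotopicB (nullhomotopic_pre f H) (nullhomotopic_post e gf).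
  by apply: nullhomotopic_eq => x /=; rewrite linearB opprB addrCA subrr addr0.
- case=> h0 h1 /cocycle_map[e [/= eE0 eE1]]; subst h0 h1.
  exists ((m0 (comp_map2 e f) : homk _ _), (m1 (comp_map2 e f) : homk _ _)).
    exact: map_cocycle.
  apply/B2_boundary.
  have zN : nullhomotopic (fun _ : c0 Y => 0 : c0 N) (fun _ : c1 Y => 0 : c1 N).
    by exists (zero_map _ _), (zero_map _ _); split=> x; rewrite /= linear0 addr0.
  apply: nullhomotopic_eq (nullhomotopicB zN (nullhomotopic_post e fg)) => x /=;
  by rewrite linearB sub0r opprB.
Qed.

(** The two complexes differ by an exchange of degrees and signs, so transport of dimensions has to
    be proved in even degree only. *)
Lemma hom_dim_shift X M n : hom_dim0 X (shift2 M) n <-> hom_dim1 X M n.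
Proof.
have dE (x : B2_1 X M) : d0 (B2 X (shift2 M)) x = - d1 (B2 X M) x.
  by apply: injective_projections; apply: homk_ext => y /=; rewrite opprD.
have dE' (x : B2_0 X M) : d1 (B2 X (shift2 M)) x = - d0 (B2 X M) x.
  by apply: injective_projections; apply: homk_ext => y /=; rewrite opprD opprK.
have Ze (x : B2_1 X M) : d0 (B2 X (shift2 M)) x = 0 <-> d1 (B2 X M) x = 0.
  by rewrite dE; split=> [/eqP|->]; [rewrite oppr_eq0 => /eqP|rewrite oppr0].
have Be (x : B2_1 X M) : (exists y, x = d1 (B2 X (shift2 M)) y) <-> (exists y, x = d0 (B2 X M) y).
  by split=> -[y ->]; exists (- y); rewrite linearN ?dE' ?opprK.
split; first exact: (subquot_dim_ext Ze Be).
by apply: (subquot_dim_ext (V := B2_1 X M)) => x; split; move/Ze || move/Be.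
Qed.
End HomCohomology.

(** * Maps from the folded mesh complex to a simple module *)

Section MeshFold.
Variables (k : fieldType) (Q : quiver) (i j : vert Q).
Local Notation DQ := (double_quiver Q).
Local Notation Lambda := (preprojective k Q).

Definition mesh_fold : cplx2 Lambda := three_fold (@mesh_p12 k Q i).

Lemma inl_linear (R : pzRingType) (U V : lmodType R) : linear (fun x : U => (x, 0) : U * V).
Proof. by move=> a x y; apply: injective_projections; rewrite //= scaler0 addr0. Qed.

Lemma mesh_fold_even_char (f : {linear c0 mesh_fold -> simple k j}) x :
  f (d1 mesh_fold x) = 0.
Proof. exact: (mesh_p1_char (lin_comp f (lin_of (@inl_linear _ _ _)))). Qed.

Lemma mesh_fold_odd_char (f : {linear c1 mesh_fold -> simple k j}) x :
  f (d0 mesh_fold x) = 0.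
Proof. exact: (mesh_p2_char f). Qed.

(** The even term is a pair of copies of Lambda e_i. Indexing them by booleans presents it as a
    single [pmod], to which [pmod_hom_dim] applies. *)
Let r2 (_ : bool) : Lambda := @lvertex k Q i.
Let r2_idem b : r2 b * r2 b = r2 b. Proof. exact: lvertex_idem. Qed.
Let gen0 := pmod_gen (@mesh_r0_idem k Q i) tt.
Let gen2 b := pmod_gen r2_idem b.

Let to_fold : {linear pmod r2 -> c0 mesh_fold} :=
  pmod_map (M := c0 mesh_fold) r2 (fun b => if b then (gen0, 0) else (0, gen0)).
Let of_fold : {linear c0 mesh_fold -> pmod r2} :=
  sum_map (pmod_map (@mesh_r0 k Q i) (fun=> gen2 true))
          (pmod_map (@mesh_r0 k Q i) (fun=> gen2 false)).

Let to_fold_gen b : to_fold (gen2 b) = if b then (gen0, 0) else (0, gen0).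
Proof.
apply: pmod_map_gen; case: b; apply: injective_projections => /=;
  rewrite ?scaler0 //; exact: (pmod_genK (@mesh_r0_idem k Q i)).
Qed.

Let of_foldK b : of_fold (to_fold (gen2 b)) = gen2 b.
Proof.
rewrite to_fold_gen; case: b.
  rewrite -[LHS]/(pmod_map (@mesh_r0 k Q i) (fun=> gen2 true) gen0 +
    pmod_map (@mesh_r0 k Q i) (fun=> gen2 false) 0) linear0 addr0.
  apply: (pmod_map_gen (@mesh_r0_idem k Q i)); exact: (pmod_genK r2_idem).
rewrite -[LHS]/(pmod_map (@mesh_r0 k Q i) (fun=> gen2 true) 0 +
  pmod_map (@mesh_r0 k Q i) (fun=> gen2 false) gen0) linear0 add0r.
apply: (pmod_map_gen (@mesh_r0_idem k Q i)); exact: (pmod_genK r2_idem).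
Qed.

Let to_foldK x : to_fold (of_fold x) = x.
Proof.
case: x => x y; rewrite -[of_fold _]/(pmod_map (@mesh_r0 k Q i) (fun=> gen2 true) x +
  pmod_map (@mesh_r0 k Q i) (fun=> gen2 false) y).
have E1 (g : pmod r2) z : pmod_map (@mesh_r0 k Q i) (fun=> g) z = (z tt : Lambda) *: g.
  by rewrite pmod_mapE sum_unit.
rewrite !E1 linearD !linearZ (to_fold_gen true) (to_fold_gen false).
have E (z : pmod (@mesh_r0 k Q i)) : z = (z tt : Lambda) *: gen0.
  by rewrite [LHS](pmod_expand (@mesh_r0_idem k Q i)) sum_unit.
apply: injective_projections => /=; rewrite !scaler0 ?addr0 ?add0r -E //.
Qed.

(** Arrows act as zero on S_j, so every map from the even term is a cocycle and no nonzero one is a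
    boundary; what is counted is the full Hom space of that term. *)
Lemma mesh_fold_hom_dim0 : hom_dim0 mesh_fold (point2 (simple k j)) ((i == j) + (i == j)).
Proof.
have rV0 (x : 'rV[Lambda]_0) : x = 0 by exact: thinmx0.
have -> : ((i == j) + (i == j))%N = #|(fun=> i == j) : pred bool|.
  by case: (i == j); [rewrite card_bool|rewrite card0].
have dim : subquot_dim (V := homk (pmod r2) (simple k j)) (fun=> True) (fun f => f = 0)
    #|(fun=> i == j) : pred bool|.
  apply: (pmod_hom_dim r2_idem (chi := preproj_char j)); first exact: preproj_char_scalar.
  by move=> b; rewrite [LHS]lvertex_char eq_sym.
apply: (subquot_dim_iso (V := B2_0 mesh_fold (point2 (simple k j))) (phi := lin_of
  (fst_lin (lin_of (dsum2_linear (hom_pre (simple k j) to_fold) idfun))))) dim => //.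
- by move=> a f g; apply: cocycle_linear.
- by move=> a f g -> ->; rewrite scaler0 addr0.
- move=> f /B2_boundary[s [t [sE _]]]; apply: homk_ext => x.
  rewrite -[LHS]/(homk_fun f.1 (to_fold x)) sE [d1 _ _]/(0 : simple k j) add0r.
  exact: mesh_fold_odd_char.
- move=> f _ f0; exists 0; rewrite linear0; apply: injective_projections; apply: homk_ext => x.
    rewrite -[LHS]/(homk_fun f.1 x) -(to_foldK x).
    exact: (congr1 (fun h => homk_fun h (of_fold x)) f0).
  exact: rV0.
- move=> h _; exists ((lin_comp h of_fold : homk _ _), 0).
    apply/B2_cocycle; split=> x; first exact: rV0.
    exact: (mesh_fold_even_char (lin_comp h of_fold)).
  apply/eqP; rewrite subr_eq0; apply/eqP/homk_ext => x.
  have H b : homk_fun h (gen2 b) = lin_comp (lin_comp h of_fold) to_fold (gen2 b).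
    by rewrite -[RHS]/(homk_fun h (of_fold (to_fold (gen2 b)))) of_foldK.
  exact: (pmod_hom_ext H x).
Qed.

Lemma mesh_fold_hom_dim1 : hom_dim1 mesh_fold (point2 (simple k j))
  #|[pred b : arr DQ | (src b == i) && (tgt b == j)]|.
Proof.
have rV0 (x : 'rV[Lambda]_0) : x = 0 by exact: thinmx0.
have dim : subquot_dim (V := homk (pmod (@mesh_r1 k Q i)) (simple k j)) (fun=> True)
    (fun f => f = 0) #|[pred b : arr DQ | (src b == i) && (tgt b == j)]|.
  apply: (pmod_hom_dim (@mesh_r1_idem k Q i) (chi := preproj_char j)).
    exact: preproj_char_scalar.
  move=> b; rewrite /mesh_r1 /=; case: ifP => _; last exact: raddf0.
  by rewrite lvertex_char eq_sym.
have phi_lin : linear (fun f : B2_1 mesh_fold (point2 (simple k j)) => f.2) by [].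
apply: (subquot_dim_iso (phi := lin_of phi_lin)) dim => //.
- by move=> a f g f0 g0; rewrite linearP f0 g0 scaler0 addr0.
- by move=> a f g -> ->; rewrite scaler0 addr0.
- move=> f [[s t] ->]; apply: homk_ext => x.
  rewrite -[LHS]/(- homk_fun s (d1 mesh_fold x) + 0) addr0.
  by rewrite mesh_fold_even_char oppr0.
- move=> f _ f0; exists 0; rewrite linear0; apply: injective_projections => //.
  apply: homk_ext => x; exact: rV0.
- move=> h _; exists (0, h); last exact: subrr.
  apply: injective_projections; apply: homk_ext => x; last exact: rV0.
  rewrite -[LHS]/(0 + homk_fun h (d0 mesh_fold x)) add0r.
  exact: mesh_fold_odd_char.
Qed.

Hypotheses (Q_connected : quiver_connected Q) (Q_acyclic : quiver_acyclic Q).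
Hypothesis Q_not_dynkin : ~ dynkin_type Q.

Lemma mesh_fold_kproj : kproj mesh_fold.
Proof.
by apply: three_fold_kproj;
  [apply: (pmod_projective (@mesh_r0_idem k Q i))|apply: (pmod_projective (@mesh_r1_idem k Q i))|
   apply: (pmod_projective (@mesh_r0_idem k Q i))].
Qed.

Lemma mesh_fold_aug_linear : linear (fun x : c0 mesh_fold => @mesh_q k Q i x.1).
Proof. by move=> a x y; rewrite linearP. Qed.

Lemma mesh_fold_aug_d1 x : lin_of mesh_fold_aug_linear (d1 mesh_fold x) = 0.
Proof. exact: mesh_p1_char. Qed.

Definition mesh_fold_aug : cmap2 mesh_fold (point2 (simple k i)) :=
  point2_map (M := mesh_fold) mesh_fold_aug_d1.

Lemma mesh_fold_aug_acyclic : acyclic2 (cone mesh_fold_aug).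
Proof.
apply: point2_cone_acyclic => [n m /(congr1 fst)/mesh_p1_exact[y ->]|[x y] /= x0 y0].
  by have [z <-] := mesh_q_surj n; exists (z, y).
have [m ->] := mesh_q_exact x0; exists m.
by rewrite (mesh_p2_inj Q_connected Q_acyclic Q_not_dynkin y0).
Qed.
End MeshFold.

(** * The twist on simple roots *)

Section TwistedSimples.
Variables (k : fieldType) (Q : quiver).
Hypotheses (Q_connected : quiver_connected Q) (Q_acyclic : quiver_acyclic Q).
Hypothesis Q_not_dynkin : ~ dynkin_type Q.
Local Notation DQ := (double_quiver Q).
Local Notation M j := (mesh_complex k j).

(** P meets the mesh complex only up to homotopy: both foldings are K-projective and augment to S_i.
    The resolution of S_j in the second argument is replaced by S_j itself, which K-projectivity of
    the source permits. *)
Lemma fold_resolution_hom (i j : vert Q) (P : cplx (preprojective k Q)) :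
  minimal_resolution P i ->
  hom_dim0 (fold2 P) (fold2 (M j)) ((i == j) + (i == j)) /\
  hom_dim1 (fold2 P) (fold2 (M j)) #|[pred b : arr DQ | (src b == i) && (tgt b == j)]|.
Proof.
move=> [[[b Pb] P_fg [q q_qis]] P_pos _].
have [_ _ [q' q'_qis]] := @mesh_resolution k Q j Q_connected Q_acyclic Q_not_dynkin.
have Pk : kproj (fold2 P).
  by move=> A f; apply: (fold_nullhomotopic (fun n => (P_fg n).2) P_pos Pb).
have equiv : homotopy_equiv (fold2 P) (mesh_fold k i).
  apply: kproj_equiv Pk (@mesh_fold_kproj k Q i) (augmentation_acyclic q_qis) _.
  exact: mesh_fold_aug_acyclic.
have q'_aug := augmentation_acyclic q'_qis; split.
  apply: (hom_dim0_post Pk q'_aug); apply: (hom_dim0_pre equiv).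
  exact: mesh_fold_hom_dim0.
apply/hom_dim_shift; apply: (hom_dim0_post Pk (shift_map2_acyclic q'_aug)).
apply: (hom_dim0_pre equiv); apply/hom_dim_shift; exact: mesh_fold_hom_dim1.
Qed.

Lemma double_arrow_card (i j : vert Q) :
  #|[pred b : arr DQ | (src b == i) && (tgt b == j)]| =
  (#|[pred b : arr Q | (src b == i) && (tgt b == j)]| +
   #|[pred b : arr Q | (src b == j) && (tgt b == i)]|)%N.
Proof.
rewrite -!sum1_card big_mkcond big_sumType -!big_mkcond; congr (_ + _)%N.
by apply: eq_bigl => b; rewrite !inE andbC.
Qed.

Lemma symmetric_form_simple_roots (B : root_lattice Q -> root_lattice Q -> int) i j :
  euler_form k B -> symmetric_form B (simple_root j) (simple_root i) =
    ((i == j) + (i == j))%N%:Z - #|[pred b : arr DQ | (src b == i) && (tgt b == j)]|%:Z.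
Proof.
move=> BP; rewrite /symmetric_form !(euler_simple_roots _ _ BP) double_arrow_card.
by rewrite [j == i]eq_sym !PoszD opprD addrACA; congr (_ + _); rewrite addrC.
Qed.
End TwistedSimples.

Lemma root_lattice_ind (Q : quiver) (A : root_lattice Q -> Prop) :
  (forall u v, A u -> A v -> A (u - v)) -> (forall j, A (simple_root j)) -> forall u, A u.
Proof.
move=> AB Aroot u; have /card_gt0P[j0 _] := vert_gt0 Q.
have A0 : A 0 by rewrite -(subrr (simple_root j0)); exact: AB.
have AN v : A v -> A (- v) by move=> Av; rewrite -sub0r; exact: AB.
have AD v w : A v -> A w -> A (v + w) by move=> Av Aw; rewrite -[w]opprK; exact/AB/AN.
have AM v (n : nat) : A v -> A (v *+ n) by move=> Av; elim: n => // n IH; rewrite mulrS; exact: AD.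
have -> : u = \sum_j simple_root j *~ u j.
  apply/ffunP => l; rewrite sum_ffunE (bigD1 l) //= big1 => [|j jl].
    by rewrite [RHS]addr0 ffunMzE ffunE eqxx intz.
  by rewrite ffunMzE ffunE eq_sym (negPf jl) mul0rz.
apply: big_ind => // j _; case: (u j) => n; first exact: AM.
by rewrite NegzE mulrNz; exact/AN/AM.
Qed.

Theorem proposition3p10 (k : fieldType) (Q : quiver)
  (Q_connected : quiver_connected Q) (Q_acyclic : quiver_acyclic Q)
  (Q_not_dynkin : ~ dynkin_type Q)
  (euler : root_lattice Q -> root_lattice Q -> int)
  (eulerP : euler_form k euler)
  (eta : K0 k Q -> root_lattice Q)
  (eta_add : forall x y, eta (K0_add x y) = eta x + eta y)
  (eta_bij : bijective eta)
  (eta_simple : forall j P (hP : projective_resolution P (stalk (simple k j))),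
     eta (K0_class (simple_hull hP)) = simple_root j)
  (i : vert Q)
  (P : cplx (preprojective k Q)) (P_minimal : minimal_resolution P i)
  (T : K0 k Q -> K0 k Q) (T_twist : induced_by_twist P T) :
  forall x : K0 k Q, eta (T x) = simple_reflection euler i (eta x).
Proof.
have [T_add T_class] := T_twist; have [hP _ _] := P_minimal.
have [BDl BDr _] := eulerP.
have on_simple j : exists x, eta x = simple_root j /\
    eta (T x) = simple_reflection euler i (simple_root j).
  (* [eta_simple] covers every resolution of S_j, so the mesh complex may represent its class. *)
  pose M := simple_hull (@mesh_resolution k Q j Q_connected Q_acyclic Q_not_dynkin).
  have [dim0 dim1] := fold_resolution_hom Q_connected Q_acyclic Q_not_dynkin j P_minimal.
  (* N lies in the hull and is homotopy equivalent to the twist of M, so [T_class] evaluates T on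
     the class of M. *)
  have [N [NT N_class]] := @twist_hull_object k Q eta eta_add (simple_hull hP) M _ _ dim0 dim1.
  exists (K0_class M); split; first exact: eta_simple.
  rewrite (T_class M N NT); move: N_class.
  rewrite /hull_class !eta_simple => ->; rewrite /simple_reflection.
  by rewrite (symmetric_form_simple_roots i j eulerP) mulrzBr.
have form_sub u v w : symmetric_form euler (u - v) w =
    symmetric_form euler u w - symmetric_form euler v w.
  apply/eqP; rewrite -[_ == _]subr_eq eq_sym opprK /symmetric_form addrACA.
  by rewrite -BDl -BDr subrK.
have [eta' etaK eta'K] := eta_bij.
(* [K0] carries only an addition; differences are formed in the root lattice and carried back by the
   inverse of eta. *)
have T_sub u v : eta (T (eta' (u - v))) = eta (T (eta' u)) - eta (T (eta' v)).
  apply/eqP; rewrite eq_sym subr_eq -eta_add -T_add; apply/eqP; congr (eta (T _)).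
  by rewrite -[RHS]etaK eta_add !eta'K subrK.
suff H u : eta (T (eta' u)) = simple_reflection euler i u.
  by move=> x; rewrite -{1}(etaK x) H.
move: u; apply: root_lattice_ind => [u v uE vE|j].
  rewrite T_sub uE vE /simple_reflection form_sub mulrzBr.
  by rewrite opprD addrACA -opprD.
by have [x [<- <-]] := on_simple j; rewrite etaK.
Qed.
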